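(* There is an absolute constant $c>0$ such that every finite simple graph $G$ satisfies $\mathrm{cr}(G)\le c\,\mathrm{pcr}(G)^{3/2}$; that is, $\mathrm{cr}(G)=O(\mathrm{pcr}(G)^{3/2})$.
   Context: All graphs are finite, simple and undirected. A drawing of a graph $G$ maps vertices to distinct points of the plane and edges to simple continuous curves joining the images of their endpoints and passing through no other vertex point; any two curves share only finitely many points, no two curves are tangent, and no three curves pass through a common point. The crossing number $\mathrm{cr}(G)$ is the minimum number of crossing points over all drawings of $G$. The pair crossing number $\mathrm{pcr}(G)$ is the minimum, over all drawings of $G$, of the number of unordered pairs of edges that cross at least once. *)

(* Defs.v *)
From HB Require Import structures.
From mathcomp Require Import all_boot all_order all_algebra finmap.
From mathcomp Require Import all_classical all_reals all_analysis.
Set Implicit Arguments.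
Unset Strict Implicit.
Unset Printing Implicit Defensive.
Import Order.TTheory GRing.Theory Num.Theory numFieldNormedType.Exports.
Local Open Scope classical_set_scope.
Local Open Scope ring_scope.

(* A finite simple graph on the vertex type V is given by its edge set,
   whose members are two-element sets of vertices. *)
Definition simple_graph (V : finType) (E : {set {set V}}) : Prop :=
  forall e, e \in E -> #|e| = 2%N.

(* The value of curve at e is only relevant when e is an edge, and there
   only on the parameter interval [0, 1]. *)
Record drawing (R : realType) (V : finType) := Drawing {
  pos : V -> R * R ;
  curve : {set V} -> R -> R * R }.

Section Drawings.
Context (R : realType) (V : finType).
Implicit Types (D : drawing R V) (E : {set {set V}}) (e f g : {set V}).

Definition edge_arc D e : set (R * R) := curve D e @` `[0, 1].
Definition edge_interior D e : set (R * R) := curve D e @` `]0, 1[.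

(* S and T cross, as opposed to touch, at p: some topological chart h of the
   plane around p straightens S and T to the two coordinate axes. *)
Definition cross_at (S T : set (R * R)) (p : R * R) : Prop :=
  exists h : R * R -> R * R,
    [/\ continuous h, injective h, (forall U, open U -> open (h @` U)),
        h (0, 0) = p &
        forall z, (S (h z) <-> z.2 = 0) /\ (T (h z) <-> z.1 = 0)].

(* Curves sharing an endpoint meet there without crossing or being tangent;
   the last two conditions therefore concern interior points only. *)
Record is_drawing E D : Prop := IsDrawing {
  pos_inj : injective (pos D) ;
  curve_continuous : forall e, e \in E ->
    {within `[0, 1], continuous (curve D e)} ;
  curve_simple : forall e, e \in E ->
    {in `[0, 1] &, injective (curve D e)} ;
  curve_ends : forall e, e \in E ->
    [set curve D e 0; curve D e 1] = pos D @` [set` e] ;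
  curve_avoids : forall e v, e \in E -> v \notin e -> ~ edge_arc D e (pos D v) ;
  finite_meet : forall e f, e \in E -> f \in E -> e != f ->
    finite_set (edge_arc D e `&` edge_arc D f) ;
  no_tangency : forall e f p, e \in E -> f \in E -> e != f ->
    edge_interior D e p -> edge_interior D f p ->
    cross_at (edge_interior D e) (edge_interior D f) p ;
  no_triple_point : forall e f g, e \in E -> f \in E -> g \in E ->
    e != f -> f != g -> e != g ->
    edge_interior D e `&` edge_interior D f `&` edge_interior D g = set0 }.

Definition crossing_points E D : set (R * R) :=
  [set p | exists e f, [/\ e \in E, f \in E, e != f,
                           edge_interior D e p & edge_interior D f p]].

Lemma finite_crossing_points E D :
  is_drawing E D -> finite_set (crossing_points E D).
Proof.
move=> H; pose I := [set P : {set V} * {set V} |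
  [/\ P.1 \in E, P.2 \in E & P.1 != P.2]].
apply: (@sub_finite_set _ _
  (\bigcup_(P in I) (edge_arc D P.1 `&` edge_arc D P.2))).
  move=> p [e [f [eE fE ef [x x1 <-] [y y1 yx]]]]; exists (e, f) => //=.
  move: x1 y1; rewrite /= !in_itv /= => /andP[? ?] /andP[? ?].
  by split; [exists x => //|exists y => //]; rewrite /= in_itv /= !ltW.
apply: bigcup_finite; first exact: finite_finset.
by move=> [e f] /= [eE fE ef]; exact: (finite_meet H).
Qed.

Definition crossings E D : nat := #|` fset_set (crossing_points E D)|%fset.

Definition crossing_pairs E D : {set {set {set V}}} :=
  [set P : {set {set V}} | `[< exists e f, [/\ e \in E, f \in E, e != f,
     P = [set e; f]%SET & edge_interior D e `&` edge_interior D f !=set0] >]]%SET.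

End Drawings.

(* The least element of A; the value on the empty set is a dummy. It is
   only used below on sets that are nonempty because every graph has a drawing. *)
Definition nat_min (A : set nat) : nat :=
  xget 0%N [set n | A n /\ forall m, A m -> (n <= m)%N].

Lemma nat_minP (A : set nat) : A !=set0 ->
  A (nat_min A) /\ forall m, A m -> (nat_min A <= m)%N.
Proof.
move=> [n An]; rewrite /nat_min.
have ex : exists n, `[< A n >] by exists n; apply/asboolP.
case: (ex_minnP ex) => m /asboolP Am mmin.
case: xgetP => [k _ [] //|/(_ m) []].
by split => // k Ak; apply: mmin; apply/asboolP.
Qed.

Definition cr (R : realType) (V : finType) (E : {set {set V}}) : nat :=
  nat_min [set n | exists2 D : drawing R V, is_drawing E D & n = crossings E D].

Definition pcr (R : realType) (V : finType) (E : {set {set V}}) : nat :=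
  nat_min [set n | exists2 D : drawing R V,
                     is_drawing E D & n = #|crossing_pairs E D|].

(* Main.v *)
(* Take a drawing with the least number k of crossing pairs and lay a fine square
   grid over it. The cells met by an edge e outside of square blocks around the
   vertices form a string W e, and strings of distinct edges touch only if the
   edges cross, so that there are O(k) touching pairs.

   A string graph with M touching pairs has a set of O(sqrt M) strings whose
   removal leaves only components that carry at most half of M: after the removal
   of a sparse breadth-first layer every cell is joined to a root by a chain of
   strings that meets O(sqrt M) strings of the big component, and a parity
   argument yields four cells around a grid point whose chains break up the big
   component. Applying this recursively, and giving the strings removed first the
   lowest levels, one gets levels such that the components C_e of e
   among the strings of level at least lev e satisfy sum_e |C_e| = O(M^(3/2)).

   Now redraw all edges inside the cells of the strings, minimizing first a weighted
   length in which cells carrying strings of high level are far cheaper than others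
   and then the number of crossings. By minimality an edge e stays on the strings
   of C_e, visits no cell twice, and crosses each other edge at most once. If e
   and f cross in a cell, then one of them is in the component of the other, hence
   there are O(k^(3/2)) crossings. *)

Require Import Defs.
From HB Require Import structures.
From mathcomp Require Import all_boot all_order all_algebra finmap.
From mathcomp Require Import boolp.
From mathcomp Require Import ring lra zify.
Set Implicit Arguments.
Unset Strict Implicit.
Unset Printing Implicit Defensive.
Import Order.TTheory GRing.Theory Num.Theory.
Local Open Scope ring_scope.

(** Passing to grid cells turns the topology into combinatorics: the only use of planarity in the
    separator is a parity count over walks of cells, which replaces the Jordan curve theorem. A pair
    of edges may cross arbitrarily often in the given drawing, so the new one may depend only on
    which strings touch; hence the edges are rerouted by minimality instead of following the old
    curves. The price is that two edges whose own strings are far apart may now cross on foreign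
    strings, and the levels exist to bound the number of such pairs. Constants: with mass at most
    s^2, a separator has at most 14 s = s + s + 4 * 3 s strings, namely those of degree above s, one
    layer, and those met by four chains. With s at most 2 sqrt M and parts of at most half the mass,
    the recursion over levels asks for c >= 28 + (3/4) c, where 3/4 exceeds sqrt (1/2); so c = 112.
    As M is at most 4 k, the final constant is 112 * 4 * 2 = 896. *)

Definition cell := (int * int)%type.

Definition adj (p q : cell) : bool :=
  ((p.1 == q.1) && ((q.2 == p.2 + 1) || (p.2 == q.2 + 1))) ||
  ((p.2 == q.2) && ((q.1 == p.1 + 1) || (p.1 == q.1 + 1))).

Definition touch (p q : cell) : bool := (p == q) || adj p q.

Lemma adjP p q : adj p q ->
  [\/ q = (p.1 + 1, p.2), q = (p.1 - 1, p.2), q = (p.1, p.2 + 1) |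
      q = (p.1, p.2 - 1)].
Proof.
case: p q => [a b] [c d] /= /orP[]/andP[/eqP /= -> /orP[]/eqP ->].
- by constructor 3.
- by constructor 4; congr (_, _); ring.
- by constructor 1.
- by constructor 2; congr (_, _); ring.
Qed.

Lemma adjC p q : adj p q = adj q p.
Proof.
rewrite /adj [p.1 == q.1]eq_sym [p.2 == q.2]eq_sym.
by congr (_ && _ || _ && _); exact: orbC.
Qed.

Lemma touchC p q : touch p q = touch q p.
Proof. by rewrite /touch eq_sym adjC. Qed.

Definition linked (w : seq cell) : bool :=
  if w is c :: w' then path adj c w' else false.

Lemma path_sub (T : eqType) (e : rel T) (x : T) (s : seq T) (c : T) :
  path e x s -> c \in x :: s ->
  exists s', [/\ path e x s', last x s' = c & {subset x :: s' <= x :: s}].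
Proof.
move=> ps; rewrite in_cons => /predU1P[->|cs].
  by exists [::]; split => // y; rewrite !inE => ->.
case/splitPr: cs ps => s1 s2; rewrite cat_path => /and3P[p1 e1 _].
exists (rcons s1 c); split; rewrite ?rcons_path ?p1 ?last_rcons //.
by move=> y; rewrite !(inE, mem_rcons, mem_cat) => /or3P[]->; rewrite ?orbT.
Qed.

Lemma path_revsym (T : eqType) (e : rel T) (x : T) (s : seq T) :
  symmetric e -> path e x s ->
  exists s', [/\ path e (last x s) s', last (last x s) s' = x &
                 {subset last x s :: s' <= x :: s}].
Proof.
move=> es ps; exists (rev (belast x s)); split.
- by rewrite rev_path (eq_path (e' := e)) // => u v; rewrite es.
- by case: s ps => //= y s _; rewrite rev_cons last_rcons.
- move=> y; rewrite -rev_rcons -lastI mem_rev //.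
Qed.

Lemma linked_walk w c d : linked w -> c \in w -> d \in w ->
  exists s, [/\ path adj c s, last c s = d & {subset c :: s <= w}].
Proof.
case: w => // x w /= pw cw dw.
have [s1 [p1 l1 i1]] := path_sub pw cw.
have [s2 [p2 l2 i2]] := path_sub pw dw.
have [s3 [p3 l3 i3]] := path_revsym adjC p1.
rewrite l1 in p3 l3 i3; exists (s3 ++ s2); split.
- by rewrite cat_path p3 l3.
- by rewrite last_cat l3.
- move=> y; rewrite in_cons mem_cat orbA -in_cons => /orP[/i3/i1 //|ys].
  by apply: i2; rewrite in_cons ys orbT.
Qed.

Lemma path_first (T : eqType) (e : rel T) (P : pred T) x s : path e x s ->
  P (last x s) -> exists s', [/\ path e x s', P (last x s') &
    {subset x :: s' <= x :: s} /\
    forall y, y \in x :: s' -> P y -> y = last x s'].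
Proof.
elim: s x => [|z s IH] x /=.
  by move=> _ Px; exists [::]; split=> //; split=> // y; rewrite inE => /eqP.
move=> /andP[xz ps] Pl; have [Px|nPx] := boolP (P x).
  exists [::]; split => //=; split => y; rewrite !inE; first by move=> ->.
  by move/eqP.
have [s' [p' P' [i' f']]] := IH _ ps Pl.
exists (z :: s'); rewrite /= xz p'; split=> //; split.
  move=> y; rewrite in_cons => /predU1P[->|/i']; rewrite !inE ?eqxx //.
  by move=> ->; rewrite orbT.
move=> y; rewrite in_cons => /predU1P[-> /(negP nPx)//|ys Py].
exact: f'.
Qed.

Lemma hline (i i' j : int) : exists s,
  [/\ path adj (i, j) s, last (i, j) s = (i', j) &
      forall c, c \in (i, j) :: s -> c.2 = j].
Proof.
have H (n : nat) (a : int) : exists s,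
   [/\ path adj (a, j) s, last (a, j) s = (a + n%:Z, j) &
      forall c, c \in (a, j) :: s -> c.2 = j].
  elim: n a => [|n IH] a.
    by exists [::]; split; rewrite ?addr0 // => c; rewrite inE => /eqP ->.
  have [s [p l m]] := IH (a + 1).
  exists ((a + 1, j) :: s); split => /=.
  - by rewrite p andbT /adj /= !eqxx orbT.
  - by rewrite l; congr (_, _); lia.
  - by move=> c; rewrite in_cons => /predU1P[-> //|/m].
case: (leP i i') => ii.
  have [s] := H (`|i' - i|%N) i.
  by rewrite (_ : i + _ = i'); [exists s|lia].
have [s [p l m]] := H (`|i - i'|%N) i'.
have [s' [p' l' m']] := path_revsym adjC p.
rewrite l (_ : i' + _ = i) in p' l' m'; last by lia.
by exists s'; split => // c /m' /m.
Qed.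

Lemma vline (i j j' : int) : exists s,
  [/\ path adj (i, j) s, last (i, j) s = (i, j') &
      forall c, c \in (i, j) :: s -> c.1 = i].
Proof.
have [s [p l m]] := hline j j' i.
exists [seq (c.2, c.1) | c <- s]; split.
- rewrite -[(i, j)]/((fun c : cell => (c.2, c.1)) (j, i)) path_map.
  by rewrite (eq_path (e' := adj)) // => -[a b] [c d]; rewrite /adj /= orbC.
- by rewrite (last_map (fun c : cell => (c.2, c.1)) _ (j, i)) l.
- move=> c; rewrite -[(i, j)]/((fun c : cell => (c.2, c.1)) (j, i)) -map_cons.
  by move=> /mapP[d /m di ->].
Qed.

(** * Parity and the cells of a grid *)

(* Only a vertical step can cross the horizontal ray that starts just above the
   centre of q and runs to the right; par counts these crossings modulo 2. *)
Definition kappa (q c d : cell) : bool :=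
  [&& c.1 == d.1, q.1 < c.1 &
      ((c.2 == q.2) && (d.2 == q.2 + 1)) || ((d.2 == q.2) && (c.2 == q.2 + 1))].

Fixpoint par (q c : cell) (s : seq cell) : bool :=
  if s is d :: s' then kappa q c d (+) par q d s' else false.

(** A horizontal move of [q] only affects vertical steps that use one of the two excluded cells. A
    vertical move shifts the ray by one row; the difference then counts the steps into or out of the
    half row to the right of the upper of the two cells, so it is the coboundary of the indicator
    [phi] of that half row. Its open end is guarded by an excluded cell. *)
Lemma kappa_adj q q' : adj q q' -> exists phi : pred cell,
  forall c d, adj c d -> c \notin [:: q; q'] -> d \notin [:: q; q'] ->
    kappa q c d (+) kappa q' c d = phi c (+) phi d.
Proof.
have Hh (r : cell) : forall c d, adj c d -> c != (r.1 + 1, r.2) ->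
    d != (r.1 + 1, r.2) -> kappa r c d = kappa (r.1 + 1, r.2) c d.
  by case: r => [a b] [c1 c2] d /adjP /= [] ->;
    rewrite /kappa !xpair_eqE /=; lia.
have Hv (r : cell) : forall c d, adj c d -> c != (r.1, r.2 + 1) ->
    d != (r.1, r.2 + 1) -> kappa r c d (+) kappa (r.1, r.2 + 1) c d =
    ((c.2 == r.2 + 1) && (r.1 < c.1)) (+) ((d.2 == r.2 + 1) && (r.1 < d.1)).
  by case: r => [a b] [c1 c2] d /adjP /= [] ->;
    rewrite /kappa !xpair_eqE /=; lia.
move=> /adjP[]E; rewrite E.
- exists pred0 => c d cd; rewrite !inE !negb_or => /andP[_ c1] /andP[_ d1].
  by rewrite (Hh q) // addbb.
- exists pred0 => c d cd; rewrite !inE !negb_or => /andP[c1 _] /andP[d1 _].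
  by rewrite (Hh (q.1 - 1, q.2)) //= ?subrK -?surjective_pairing ?addbb.
- exists (fun c => (c.2 == q.2 + 1) && (q.1 < c.1)) => c d cd.
  by rewrite !inE !negb_or => /andP[_ c1] /andP[_ d1]; exact: Hv.
- exists (fun c => (c.2 == q.2) && (q.1 < c.1)) => c d cd.
  rewrite !inE !negb_or => /andP[c1 _] /andP[d1 _].
  have := Hv (q.1, q.2 - 1) c d cd; rewrite /= subrK -surjective_pairing.
  by move=> /(_ c1 d1) <-; rewrite addbC.
Qed.

Lemma par_adj q q' : adj q q' -> exists phi : pred cell, forall c s,
  path adj c s -> {in c :: s, forall d, d \notin [:: q; q']} ->
  par q c s (+) par q' c s = phi c (+) phi (last c s).
Proof.
move=> /kappa_adj[phi H]; exists phi => c s; elim: s c => [|d s IH] c /=.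
  by rewrite addbb.
move=> /andP[cd ps] av; have {}IH := IH d ps.
rewrite addbACA H ?av ?inE ?eqxx ?orbT // IH ?addbA ?addbK //.
by move=> y yd; apply: av; rewrite inE yd orbT.
Qed.

(** This is the winding number modulo 2 about [q] of the closed walk made of [T x], the step from
    [x] to [y], and [T y]: both tails are meant to end at one root, and orientation is irrelevant
    modulo 2. *)
Definition loop_par (T : cell -> seq cell) (q x y : cell) : bool :=
  par q x (T x) (+) kappa q x y (+) par q y (T y).

Definition tc (I : Type) (W : I -> seq cell) (u v : I) : bool :=
  has (fun c => has (touch c) (W v)) (W u).

Definition rin (I : finType) (W : I -> seq cell) (S : {set I}) : rel I :=
  [rel u v | [&& u \in S, v \in S & tc W u v]].

Lemma tcC (I : Type) (W : I -> seq cell) (u v : I) : tc W u v = tc W v u.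
Proof.
apply/idP/idP => /hasP[c cu /hasP[d dv cd]];
  by apply/hasP; exists d => //; apply/hasP; exists c => //; rewrite touchC.
Qed.

Lemma rinC (I : finType) (W : I -> seq cell) (S : {set I}) :
  symmetric (rin W S).
Proof. by move=> u v; rewrite /rin /= (tcC W u) andbCA. Qed.

(** The coboundary terms cancel around the closed walk: [phi x], [phi y] and [phi rt] each occur
    twice. *)
Lemma loop_par_adj (T : cell -> seq cell) (rt q q' x y : cell) :
  (forall x, path adj x (T x) /\ last x (T x) = rt) ->
  adj x y -> adj q q' ->
  {in [:: q; q'], forall d, d \notin x :: T x /\ d \notin y :: T y} ->
  loop_par T q x y = loop_par T q' x y.
Proof.
move=> HT xy qq av; have [phi H] := par_adj qq.
have av' z d : d \in z :: T z -> z \in [:: x; y] -> d \notin [:: q; q'].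
  move=> dz; rewrite !inE => zz; apply/negP => dq.
  have [] := av d; first by rewrite !inE.
  by case/orP: zz dz => /eqP -> ->.
have Hz z : z \in [:: x; y] ->
    par q z (T z) (+) par q' z (T z) = phi z (+) phi rt.
  by move=> zz; have [pz <-] := HT z; apply: H => // d /av'; apply.
have Hxy : kappa q x y (+) kappa q' x y = phi x (+) phi y.
  have := H x [:: y]; rewrite /= xy !addbF; apply=> // d dd.
  have /orP[] : (d == x) || (d == y) by move: dd; rewrite !inE.
    by move/eqP => E; apply: (av' x); rewrite ?E !inE eqxx.
  by move/eqP => E; apply: (av' y); rewrite ?E !inE eqxx ?orbT.
have := Hz x; have := Hz y; rewrite !inE !eqxx orbT => /(_ isT) + /(_ isT).
move: Hxy; rewrite /loop_par.
move: (par q x _) (par q' x _) (par q y _) (par q' y _) => a a' b b'.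
move: (kappa q x y) (kappa q' x y) (phi x) (phi y) (phi rt) => k k' u v r.
do 3 move/(canRL (addbK _)) => ->.
by case: a'; case: b'; case: k'; case: u; case: v; case: r.
Qed.

(** The ray meets both vertical sides of a face or neither, unless it starts at the lower left
    corner. *)
Lemma kappa_square (q : cell) (a b : int) :
  q \notin [:: (a, b); (a + 1, b); (a, b + 1); (a + 1, b + 1)] ->
  kappa q (a, b) (a + 1, b) (+) kappa q (a + 1, b) (a + 1, b + 1) (+)
  kappa q (a, b + 1) (a + 1, b + 1) (+) kappa q (a, b) (a, b + 1) = false.
Proof. by case: q => c d; rewrite /kappa !inE !xpair_eqE /=; lia. Qed.

(* Every cell x has a walk T x to rt, and R x contains all strings of K that
   meet the cells x and T x. The closed curve formed by a step from x to y and
   the walks T x, T y thus avoids the big component left by R x :|: R y, so that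
   it has a well-defined parity around it. If each face of the grid left a big
   component, then the parities around a face would add up to zero, and hence so
   would those along the boundary of the box, which surrounds the strings. *)
Section Parity.
Context (I : finType) (W : I -> seq cell) (K : {set I}) (lo : int) (n : nat).
Context (T : cell -> seq cell) (rt : cell).
Context (R : cell -> {set I}) (R0 : {set I}) (big : {set I} -> pred I).

Let pt (i j : nat) : cell := (lo + i%:Z, lo + j%:Z).

Hypothesis n_gt0 : (0 < n)%N.
Hypothesis HT : forall x, path adj x (T x) /\ last x (T x) = rt.
Hypothesis HR : forall x g c, g \in K -> c \in W g -> c \in x :: T x -> g \in R x.
Hypothesis Hbd : forall i j, (i <= n)%N -> (j <= n)%N ->
  [|| i == 0, i == n, j == 0 | j == n]%N -> R (pt i j) = R0.
Hypothesis HW : forall g, g \in K -> linked (W g).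
Hypothesis Hbox : forall g c, g \in K -> c \in W g ->
  [&& lo < c.1, c.1 < lo + n%:Z, lo < c.2 & c.2 < lo + n%:Z].
Hypothesis big_in : forall S g, big S g -> g \in K :\: S.
Hypothesis big_mono : forall (S S' : {set I}) g, S \subset S' -> big S' g -> big S g.
Hypothesis big_conn : forall S g g', big S g -> big S g' ->
  connect (rin W (K :\: S)) g g'.

(** A string outside [R x :|: R y] has no cell on the closed walk, so the parity is constant along
    it; passing to a touching string costs at most one more step between adjacent cells, again off
    the walk. *)
Lemma loop_par_conn x y g g' q q' : adj x y ->
  connect (rin W (K :\: (R x :|: R y))) g g' ->
  g \in K :\: (R x :|: R y) -> q \in W g -> q' \in W g' ->
  loop_par T q x y = loop_par T q' x y.
Proof.
move=> xy; set S := K :\: _.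
have av h d : h \in S -> d \in W h -> d \notin x :: T x /\ d \notin y :: T y.
  rewrite inE in_setU negb_or => /andP[/andP[hx hy] hK] dW.
  by split; [apply: contra hx|apply: contra hy]; exact: HR.
have step h r r' : h \in S -> r \in W h -> r' \in W h ->
    loop_par T r x y = loop_par T r' x y.
  move=> hS rW rW'.
  have hK : h \in K by move: hS; rewrite inE => /andP[].
  have [s [ps <- ss]] := linked_walk (HW hK) rW rW'.
  elim: s r ps ss {rW rW'} => //= d s IH r /andP[rd ps] ss.
  rewrite -IH //; last by move=> z zs; apply: ss; rewrite inE zs orbT.
  apply: loop_par_adj HT xy rd _ => z zz; apply: (av h) => //; apply: ss.
  by move: zz; rewrite !inE => /orP[]->; rewrite ?orbT.
move=> /connectP[p]; elim: p g q => [|h p IH] g q /=.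
  by move=> _ -> gS qW qW'; exact: (step g).
move=> /andP[/and3P[gS hS /hasP[c cg /hasP[d dh cd]]] pp] g'E _ qg qg'.
rewrite (step _ _ _ gS qg cg) -(IH h d pp g'E hS dh qg').
case/predU1P: cd => [-> //|cd]; apply: loop_par_adj HT xy cd _ => z.
by rewrite !inE => /orP[]/eqP ->; [exact: (av g)|exact: (av h)].
Qed.

(** The winding parity of the loop about the big component; [wE] shows that the choice of string and
    cell is immaterial. Without a big component the value is a dummy. *)
Let w (x y : cell) : bool :=
  if [pick g | big (R x :|: R y) g] is Some g then
    loop_par T (head (0, 0) (W g)) x y else false.

Lemma head_linked (s : seq cell) d : linked s -> head d s \in s.
Proof. by case: s => //= c s _; rewrite mem_head. Qed.

Lemma wE x y g q : adj x y -> big (R x :|: R y) g -> q \in W g ->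
  w x y = loop_par T q x y.
Proof.
move=> xy bg qg; rewrite /w; case: pickP => [h bh|/(_ g)]; last by rewrite bg.
have hS := big_in bh; apply: (loop_par_conn xy (big_conn bh bg)) => //.
by apply/head_linked/HW; move: hS; rewrite inE => /andP[].
Qed.

Let adj_h i j : adj (pt i j) (pt i.+1 j).
Proof. by rewrite /adj /pt /= eqxx; lia. Qed.
Let adj_v i j : adj (pt i j) (pt i j.+1).
Proof. by rewrite /adj /pt /= eqxx; lia. Qed.

Lemma parity_face : exists i j, [/\ (i < n)%N, (j < n)%N &
  forall g, ~~ big (R (pt i j) :|: R (pt i.+1 j) :|: R (pt i j.+1)
                    :|: R (pt i.+1 j.+1)) g].
Proof.
pose S i j := R (pt i j) :|: R (pt i.+1 j) :|: R (pt i j.+1)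
                    :|: R (pt i.+1 j.+1).
have [/existsP[i /existsP[j /forallP H]]|no] :=
    boolP [exists i : 'I_n, exists j : 'I_n, forall g, ~~ big (S i j) g].
  by exists i, j; split.
exfalso; have {no} bigS i j : (i < n)%N -> (j < n)%N -> exists g, big (S i j) g.
  move=> ii jj; move: no; rewrite negb_exists => /forallP /(_ (Ordinal ii)).
  rewrite negb_exists => /forallP /(_ (Ordinal jj)); rewrite negb_forall.
  by case/existsP => g; rewrite negbK; exists g.
have [g0 bg0] := bigS 0 0 n_gt0 n_gt0.
pose h i j := w (pt i j) (pt i.+1 j); pose v i j := w (pt i j) (pt i j.+1).
(* Each of the four tails occurs in two of the four loops, so only the sides of the face remain. The
   cell [q] is no corner of it, because [g] lies outside [S i j]. *)
have face i j : (i < n)%N -> (j < n)%N ->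
    h i j (+) v i.+1 j (+) h i j.+1 (+) v i j = false.
  move=> ii jj; have [g bg] := bigS i j ii jj.
  have := big_in bg; rewrite inE => /andP[gS gK].
  have qW := head_linked (0, 0) (HW gK); set q := head _ _ in qW.
  have sub x y : R x :|: R y \subset S i j -> adj x y ->
      w x y = loop_par T q x y.
    by move=> /big_mono/(_ bg) b xy; exact: wE b qW.
  have [s1 [s2 [s3 s4]]] : R (pt i j) \subset S i j /\
     R (pt i.+1 j) \subset S i j /\ R (pt i j.+1) \subset S i j /\
     R (pt i.+1 j.+1) \subset S i j.
    by do !split; apply/subsetP => z zz; rewrite !inE zz ?orbT.
  rewrite /h /v !sub ?subUset ?s1 ?s2 ?s3 ?s4 //.
  have cn x : R x \subset S i j -> q \notin x :: T x.
    move=> /subsetP sx; apply/negP => qx; move/negP: gS; apply.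
    exact/sx/HR/qx.
  have E : kappa q (pt i j) (pt i.+1 j) (+) kappa q (pt i.+1 j) (pt i.+1 j.+1)
    (+) kappa q (pt i j.+1) (pt i.+1 j.+1) (+) kappa q (pt i j) (pt i j.+1)
    = false.
    have e k : lo + k.+1%:Z = lo + k%:Z + 1 by lia.
    have := cn _ s1; have := cn _ s2; have := cn _ s3; have := cn _ s4.
    rewrite /pt !e !in_cons !negb_or => /andP[q4 _] /andP[q3 _] /andP[q2 _].
    by move=> /andP[q1 _]; apply: kappa_square; rewrite !inE !negb_or q1 q2 q3.
  rewrite -[RHS]E /loop_par.
  move: (par q (pt i j) _) (par q (pt i.+1 j) _) (par q (pt i j.+1) _)
    (par q (pt i.+1 j.+1) _) => a b c d.
  move: (kappa _ _ _) => k; move: (kappa _ _ _) => l.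
  move: (kappa _ _ _) => m; move: (kappa _ _ _) => p.
  by case: a; case: b; case: c; case: d; case: k; case: l; case: m; case: p.
pose A i := \big[addb/false]_(0 <= j < n) v i j.
(* Summing [face] over a column of faces cancels the inner horizontal sides. *)
have col i : (i < n)%N -> A i (+) A i.+1 = h i 0 (+) h i n.
  move=> ii; have H m : (m <= n)%N ->
    \big[addb/false]_(0 <= j < m) v i j (+)
    \big[addb/false]_(0 <= j < m) v i.+1 j = h i 0 (+) h i m.
    elim: m => [|m IH] mn; first by rewrite !big_nil !addbb.
    rewrite !big_nat_recr //= addbACA IH ?(ltnW mn) //.
    have := face i m ii mn.
    by case: (h i 0%N); case: (h i m); case: (h i m.+1);
       case: (v i m); case: (v i.+1 m).
  exact: H.
have := big_in bg0; rewrite inE => /andP[gS gK].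
have qW := head_linked (0, 0) (HW gK); set q := head _ _ in qW.
(* Since all boundary cells share [R0], the one string [g0] and its cell [q] serve for every
   boundary edge. *)
have bR0 : big (R0 :|: R0) g0.
  apply: big_mono bg0; rewrite setUid -(@Hbd 0 0) //; apply/subsetP => z.
  by rewrite !inE => ->.
have bdE x y : R x = R0 -> R y = R0 -> adj x y ->
    w x y = par q x (T x) (+) kappa q x y (+) par q y (T y).
  by move=> Rx Ry xy; apply: (wE (g := g0)) => //; rewrite Rx Ry.
have row j : (j == 0)%N || (j == n) -> forall m, (m <= n)%N ->
    \big[addb/false]_(0 <= i < m) h i j =
    par q (pt 0 j) (T (pt 0 j)) (+) par q (pt m j) (T (pt m j)).
  move=> jj; have jn : (j <= n)%N by case/orP: jj => /eqP ->.
  elim=> [|m IH] mn; first by rewrite big_nil !addbb.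
  rewrite big_nat_recr //= IH ?(ltnW mn) // /h bdE //.
  - have -> : kappa q (pt m j) (pt m.+1 j) = false.
      by rewrite /kappa /pt /=; lia.
    by rewrite addbF addbA addbK.
  - by apply: Hbd; rewrite ?(ltnW mn) //; case/orP: jj => ->; rewrite ?orbT.
  - by apply: Hbd; rewrite //; case/orP: jj => ->; rewrite ?orbT.
(* The last term is the crossing of this boundary column with the ray. For the full height it is 0
   on the left column and 1 on the right one, because [q] lies strictly inside the box. *)
have cl i : (i == 0)%N || (i == n) -> forall m, (m <= n)%N ->
    \big[addb/false]_(0 <= j < m) v i j =
    par q (pt i 0) (T (pt i 0)) (+) par q (pt i m) (T (pt i m)) (+)
    (q.1 < lo + i%:Z) && (lo <= q.2 < lo + m%:Z).
  move=> ii; have iin : (i <= n)%N by case/orP: ii => /eqP ->.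
  elim=> [|m IH] mn.
    by rewrite big_nil !addbb; lia.
  rewrite big_nat_recr //= IH ?(ltnW mn) // /v bdE //.
  - have -> : kappa q (pt i m) (pt i m.+1) =
        (q.1 < lo + i%:Z) && (q.2 == lo + m%:Z).
      by rewrite /kappa /pt /= eqxx; congr (_ && _); lia.
    have -> : (lo <= q.2 < lo + m.+1%:Z) =
        (lo <= q.2 < lo + m%:Z) (+) (q.2 == lo + m%:Z) by lia.
    move: (q.1 < _) (lo <= _ < _) (q.2 == _) (par q (pt i 0) _)
      (par q (pt i m) _) (par q (pt i m.+1) _) => a b c d e f.
    by case: a; case: b; case: c; case: d; case: e; case: f.
  - by apply: Hbd; rewrite ?(ltnW mn) //; case/orP: ii => ->; rewrite ?orbT.
  - by apply: Hbd; rewrite //; case/orP: ii => ->; rewrite ?orbT.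
have /and4P[q1 q2 q3 q4] := Hbox gK qW.
have tel m : (m <= n)%N -> A 0%N (+) A m =
    \big[addb/false]_(0 <= i < m) h i 0 (+)
    \big[addb/false]_(0 <= i < m) h i n.
  elim: m => [|m IH] mn; first by rewrite !big_nil !addbb.
  rewrite !big_nat_recr //= addbACA -IH ?(ltnW mn) // -col //.
  by rewrite addbA addbK.
(* All tails cancel along the boundary, and the single crossing of the ray with the right column
   remains: a contradiction. *)
have := tel n (leqnn n); rewrite /A !cl ?row ?eqxx ?orbT //.
rewrite q2 (ltW q3) q4 addr0 ltNge (ltW q1) /=.
move: (par q (pt 0 0) _) (par q (pt n 0) _) (par q (pt 0 n) _)
  (par q (pt n n) _) => a b c d.
by case: a; case: b; case: c; case: d.
Qed.
End Parity.

Close Scope ring_scope.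

(** * Separators of string graphs on the grid *)

(** Hermite's identity: from [n] to [n.+1] the term [n %/ s] is replaced by [(n + s) %/ s], which is
    one larger. It evaluates the sum over all shifts in the choice of a sparse layer. *)
Lemma hermite (s n : nat) : (0 < s)%N -> (\sum_(p < s) (n + p) %/ s = n)%N.
Proof.
move=> s0; elim: n => [|n IH].
  by apply: big1 => p _; rewrite add0n divn_small ?ltn_ord.
have: (\sum_(p < s.+1) (n + p) %/ s = \sum_(p < s) (n + p) %/ s + (n %/ s).+1)%N.
  by rewrite big_ord_recr /= divnDr ?dvdnn // divnn s0 addn1.
rewrite big_ord_recl /= addn0 IH.
rewrite (eq_bigr (fun i : 'I_s => (n.+1 + i) %/ s)%N); first by lia.
by move=> i _; rewrite /bump add1n addnS addSn.
Qed.

(** [d v] is the least weight of a path from [r] to [v], both ends included. Weights are positive,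
    so the predecessor on an optimal path is strictly closer, and tight paths arise by induction on
    [d v]. *)
Lemma weighted_dist (I : finType) (e : rel I) (om : I -> nat) (r : I) :
  (forall u, 0 < om u)%N -> exists d : I -> nat,
  (forall u v, connect e r u -> e u v -> d v <= d u + om v)%N /\
  (forall v, connect e r v -> exists s,
     path (fun a b => e a b && (d b == d a + om b)%N) r s /\ last r s = v) /\
  (forall v, connect e r v -> om v <= d v)%N.
Proof.
move=> om0.
pose P v n := exists s, [/\ path e r s, last r s = v & n = \sum_(x <- r :: s) om x]%N.
have Pex v : exists n, connect e r v -> P v n /\ forall m, P v m -> (n <= m)%N.
  have [/connectP[s ps ls]|nc] := boolP (connect e r v); last by exists 0%N.
  have ex : exists n, `[< P v n >].
    by exists (\sum_(x <- r :: s) om x)%N; apply/asboolP; exists s.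
  case: (ex_minnP ex) => n /asboolP Pn nmin; exists n => _; split=> // m Pm.
  by apply: nmin; apply/asboolP.
have [d dP] := choice Pex.
have d1 u v : connect e r u -> e u v -> (d v <= d u + om v)%N.
  move=> cu uv; have [[s [ps ls du]] _] := dP u cu.
  apply: (dP v _).2; first exact: connect_trans cu (connect1 uv).
  exists (rcons s v); rewrite rcons_path ps ls uv last_rcons; split=> //.
  by rewrite -rcons_cons big_rcons du.
exists d; split=> //; split; last first.
  move=> v /dP[[s [_ <- ->]] _].
  by rewrite lastI big_rcons /= leq_addl.
move=> v; have [n] := ubnP (d v); elim: n v => // n IH v dn cv.
have [[s [ps ls dv]] vmin] := dP v cv.
case/lastP: s ps ls dv => [|s v'] ps ls dv; first by exists [::].
move: ps ls; rewrite rcons_path last_rcons => /andP[ps es] ?; subst v'.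
set u := last r s in es; have cu : connect e r u by apply/connectP; exists s.
have du : (d u <= \sum_(x <- r :: s) om x)%N by apply: (dP u cu).2; exists s.
move: dv; rewrite -rcons_cons big_rcons /= => dv.
have uv := d1 u v cu es; have := om0 v => ov.
have [|s' [ps' ls']] := IH u _ cu; first by lia.
exists (rcons s' v); rewrite rcons_path last_rcons ps' ls' es /=; split=> //.
by apply/eqP; lia.
Qed.

(** Along a tight path the intervals from [D u - om u] to [D u] follow one another without overlap.
    Those counted meet the interval from [a] to [a + sz]; as each has length at most [sz], together
    they cover at most [3 * sz]. *)
Lemma window_sum (I : eqType) (om D : I -> nat) (e : rel I) (sz a : nat) r s :
  (forall u, u \in r :: s -> om u <= sz)%N ->
  path (fun x y => e x y && (D y == D x + om y)%N) r s ->
  (om r <= D r)%N ->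
  (\sum_(u <- r :: s | (a <= D u) && (D u <= a + sz + om u)) om u <= 3 * sz)%N.
Proof.
move=> omS ps Dr; pose F s' :=
  (\sum_(u <- r :: s' | (a <= D u) && (D u <= a + sz + om u)) om u)%N.
rewrite -/(F s).
suff [] : [/\ (D (last r s) < a -> F s = 0)%N,
    (a <= D (last r s) -> F s + a <= D (last r s) + sz)%N & (F s <= 3 * sz)%N] by [].
elim/last_ind: s ps omS => [|s v IH] /=.
  move=> _ /(_ r); rewrite mem_head => /(_ isT) or.
  by rewrite /F big_cons big_nil; case: ifP; split; lia.
rewrite rcons_path => /andP[ps /andP[_ /eqP Dv]] omS.
have /IH {IH} : forall u, u \in r :: s -> (om u <= sz)%N.
  by move=> u us; apply: omS; rewrite -rcons_cons mem_rcons inE us orbT.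
move=> /(_ ps) [h1 h2 h3].
have ov : (om v <= sz)%N by apply: omS; rewrite -rcons_cons mem_rcons mem_head.
rewrite last_rcons /F -rcons_cons big_rcons /= -/(F s).
by case: ifP; split; lia.
Qed.

Lemma cells_bound (s : seq cell) : exists m : nat, forall c, c \in s ->
  [&& - m%:Z < c.1, c.1 < m%:Z, - m%:Z < c.2 & c.2 < m%:Z]%R.
Proof.
elim: s => [|c s [m IH]]; first by exists 0%N.
case: c => a b; exists (m + `|a| + `|b| + 1)%N => d; rewrite inE => /predU1P[->|/IH/and4P[]].
  by apply/and4P; split => /=; lia.
by case: d => x y /= *; apply/and4P; split; lia.
Qed.

Section Components.
Context (I : finType) (W : I -> seq cell).
Implicit Types (S B C : {set I}) (u v g : I).

Definition comp S u := [set v in S | connect (rin W S) u v].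
(** A degree that counts [u] itself when [u] is a nonempty string of [B]. Hence [mass B B], the
    number of ordered touching pairs with the diagonal, also bounds the number of strings. *)
Definition om B u := #|[set v in B | tc W u v]|.
Definition mass B C := (\sum_(u in C) om B u)%N.

Lemma conn_sym S : connect_sym (rin W S).
Proof. exact/sym_connect_sym/rinC. Qed.

Lemma comp_id S u : u \in S -> u \in comp S u.
Proof. by move=> uS; rewrite inE uS /=. Qed.

Lemma comp_sub S u : comp S u \subset S.
Proof. by apply/subsetP => v; rewrite inE => /andP[]. Qed.

Lemma comp_eq S u v : v \in comp S u -> comp S v = comp S u.
Proof.
rewrite inE => /andP[vS uv]; apply/setP => x; rewrite !inE.
by rewrite (same_connect (@conn_sym S) uv).
Qed.

Lemma connect_mono S S' u v : S \subset S' ->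
  connect (rin W S) u v -> connect (rin W S') u v.
Proof.
move=> /subsetP ss; apply: connect_sub => a b /and3P[aS bS ab].
by apply: connect1; rewrite /rin /= !ss.
Qed.

Lemma comp_mono S S' u : S \subset S' -> comp S u \subset comp S' u.
Proof.
move=> ss; apply/subsetP => v; rewrite !inE => /andP[/(subsetP ss) -> uv] /=.
exact: connect_mono uv.
Qed.

Lemma connect_in S u v : u \in S -> connect (rin W S) u v -> v \in S.
Proof.
move=> uS /connectP[p]; elim: p u uS => [|x p IH] u uS /= => [_ ->|] //.
by move=> /andP[/and3P[_ xS _] pp]; exact: IH.
Qed.

Lemma comp_conn_in S S' u : comp S u \subset S' -> u \in S ->
  comp S u \subset comp S' u.
Proof.
move=> ss uS; apply/subsetP => v vC; rewrite inE (subsetP ss) //=.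
have := vC; rewrite inE => /andP[_ /connectP[p pp ->]].
have uC : u \in comp S u by exact: comp_id.
suff H q x : path (rin W S) x q -> x \in comp S u ->
  connect (rin W S') x (last x q) by exact: H.
elim: q x => [|y q IH] x //= /andP[/and3P[xS yS t] pq] xC.
have yC : y \in comp S u.
  by rewrite -(comp_eq xC) inE yS connect1 // /rin /= xS yS.
apply: connect_trans (IH y pq yC); apply: connect1.
by rewrite /rin /= !(subsetP ss) // t.
Qed.

Lemma mass_mono B C C' : C \subset C' -> (mass B C <= mass B C')%N.
Proof.
move=> cc; rewrite /mass [leqRHS](big_setID C) /= (setIidPr cc).
exact: leq_addr.
Qed.

(** Two different components are disjoint, so both cannot carry more than half of the mass: the big
    component is unique. *)
Lemma mass_comps B S u v : S \subset B -> u \in S -> v \in S ->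
  (mass B B < 2 * mass B (comp S u))%N ->
  (mass B B < 2 * mass B (comp S v))%N -> connect (rin W S) u v.
Proof.
move=> SB uS vS mu mv; apply: contraT => nuv.
have dis : [disjoint comp S u & comp S v].
  rewrite -setI_eq0; apply/eqP/setP => x; rewrite !inE.
  apply/negP => /andP[/andP[_ ux] /andP[_ vx]]; move/negP: nuv; apply.
  by apply: connect_trans ux _; rewrite conn_sym.
have: (mass B (comp S u :|: comp S v) <= mass B B)%N.
  apply: mass_mono; rewrite subUset.
  by rewrite !(subset_trans _ SB) ?comp_sub.
have -> : (mass B (comp S u :|: comp S v) =
  mass B (comp S u) + mass B (comp S v))%N by rewrite /mass -bigU //; apply: eq_bigl => x; rewrite !inE.
lia.
Qed.

End Components.

Section Separator.
Context (I : finType) (W : I -> seq cell).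
Implicit Types (S B C F : {set I}) (u v g : I).

Lemma tc_refl u : linked (W u) -> tc W u u.
Proof.
case E: (W u) => [|c w] // _; apply/hasP; exists c; rewrite E ?mem_head //.
by apply/hasP; exists c; rewrite ?mem_head /touch ?eqxx.
Qed.

(** Walk along each string of the chain to a cell where it touches the preceding one, then change
    strings by at most one step. Stopping at the head of [W r] gives all chains the same final
    cell. *)
Lemma walk_chain S r p c : (forall g, g \in S -> linked (W g)) -> r \in S ->
  path (rin W S) r p -> c \in W (last r p) ->
  exists s, [/\ path adj c s, last c s = head (0, 0)%R (W r) &
    forall d, d \in c :: s -> exists2 u, u \in r :: p & d \in W u].
Proof.
move=> HW rS; elim/last_ind: p c => [|p v IH] c /=.
  move=> _ cr; have [s [ps ls ss]] :=
    linked_walk (HW r rS) cr (head_linked (0, 0)%R (HW r rS)).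
  by exists s; split=> // d /ss dr; exists r; rewrite ?mem_head.
rewrite rcons_path last_rcons => /andP[pp /and3P[uS vS /hasP[c1 c1u]]].
move=> /hasP[d1 d1v t] cv.
have [s1 [p1 l1 i1]] := linked_walk (HW v vS) cv d1v.
have [s2 [p2 l2 i2]] := IH c1 pp c1u.
have sub d : d \in c1 :: s2 -> exists2 u, u \in r :: rcons p v & d \in W u.
  by move=> /i2[u ur du]; exists u; rewrite // -rcons_cons mem_rcons inE ur orbT.
have sub1 d : d \in c :: s1 -> exists2 u, u \in r :: rcons p v & d \in W u.
  by move=> /i1 dv; exists v; rewrite // -rcons_cons mem_rcons mem_head.
move: t; rewrite touchC => /predU1P[e|a].
  exists (s1 ++ s2); rewrite cat_path p1 last_cat l1 e p2 l2; split=> // d.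
  rewrite in_cons mem_cat orbA -in_cons => /orP[/sub1 //|ds].
  by apply: sub; rewrite inE ds orbT.
exists (s1 ++ c1 :: s2); rewrite cat_path p1 last_cat l1 /= a p2 l2.
split=> // d; rewrite in_cons mem_cat orbA -in_cons => /orP[/sub1 //|ds].
exact: sub.
Qed.

Lemma rect_walk (x y : cell) : exists s, path adj x s /\ last x s = y.
Proof.
case: x y => [a b] [c d].
have [s1 [p1 l1 _]] := hline a c b; have [s2 [p2 l2 _]] := vline c b d.
by exists (s1 ++ s2); rewrite cat_path last_cat p1 l1 p2 l2.
Qed.

(** For a shift [p], the set consists of the strings whose interval from [d v - om W B v] to [d v]
    straddles a boundary between levels of width [s]. Summed over all shifts, Hermite's identity
    charges each [v] at most [om W B v]; so the total is at most the mass, and some shift costs at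
    most [s]. *)
Lemma level_choice B C (s : nat) (d : I -> nat) : (0 < s)%N -> C \subset B ->
  (mass W B B <= s * s)%N -> (forall v, v \in C -> om W B v <= d v)%N ->
  exists p, (#|[set v in C | (d v - om W B v + p) %/ s < (d v + p) %/ s]|
    <= s)%N.
Proof.
move=> s0 CB Ms od; pose X (p : nat) :=
  [set v in C | (d v - om W B v + p) %/ s < (d v + p) %/ s].
suff [p pX] : exists p : 'I_s, (#|X p| <= s)%N by exists p.
apply/existsP; apply: contraLR (Ms); rewrite negb_exists -ltnNge => /forallP no.
have : (\sum_(p < s) #|X p| <= mass W B B)%N.
  apply: leq_trans (mass_mono W B CB).
  rewrite (eq_bigr (fun p : 'I_s => \sum_(v in C) (v \in X p))%N); last first.
    move=> p _; rewrite -sum1_card big_mkcond [RHS]big_mkcond /=.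
    by apply: eq_bigr => v _; rewrite !inE; case: (v \in C); case: (_ < _)%N.
  rewrite exchange_big /=; apply: leq_sum => v vC.
  rewrite -[leqRHS](subKn (od v vC)).
  rewrite -[X in (_ <= X - _)%N](hermite (d v) s0) -[X in (_ <= _ - X)%N](hermite _ s0).
  rewrite -sumnB; last by move=> p _; rewrite leq_div2r // leq_add2r leq_subr.
  apply: leq_sum => p _; rewrite inE vC /=; lia.
apply: leq_trans; rewrite ltnNge; apply/negP => le.
have : (\sum_(p < s) s.+1 <= \sum_(p < s) #|X p|)%N.
  by apply: leq_sum => p _; rewrite ltnNge no.
rewrite sum_nat_const card_ord; nia.
Qed.

(** Here [X] is the sparse layer and [ch v] a shortest chain from [r] to [v]. After the removal of
    [X] a component lies within one level; only the strings in a window of bounded weight on the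
    chain can touch it, and each of them touches at most as many strings as its weight. *)
Lemma chain_cover B S r (s : nat) : (0 < s)%N ->
  (forall g, g \in B -> linked (W g)) -> (mass W B B <= s * s)%N ->
  S \subset B -> r \in S -> (forall u, u \in S -> om W B u <= s)%N ->
  exists (X : {set I}) (ch : I -> seq I),
  [/\ (#|X| <= s)%N,
   forall v, v \in comp W S r -> path (rin W S) r (ch v) /\ last r (ch v) = v &
   forall k v, k \in comp W S r -> k \notin X -> v \in comp W S r ->
    (#|[set g in comp W (S :\: X) k | has (tc W g) (r :: ch v)]| <= 3 * s)%N].
Proof.
move=> s0 HW Ms SB rS omS.
(* The maximum with 1 makes the weights positive on all of [I]; on [B] it changes nothing. *)
pose om' u := maxn 1 (om W B u).
have om'E u : u \in B -> om' u = om W B u.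
  move=> uB; apply/maxn_idPr; apply/card_gt0P; exists u.
  by rewrite inE uB tc_refl ?HW.
have [u|d [d1 [d2 d3]]] := @weighted_dist I (rin W S) om' r.
  by rewrite leq_max.
have cS v : v \in comp W S r -> v \in S /\ connect (rin W S) r v.
  by rewrite inE => /andP[].
have CB : comp W S r \subset B by exact: subset_trans (comp_sub _ _ _) SB.
have [v vC|p Xs] := @level_choice B (comp W S r) s d s0 CB Ms.
  by rewrite -om'E ?(subsetP CB) // d3 //; case: (cS v vC).
set X := [set v in _ | _] in Xs.
have chP v : exists t, v \in comp W S r ->
    path (fun a b => rin W S a b && (d b == d a + om' b)%N) r t /\ last r t = v.
  have [vC|//] := boolP (v \in comp W S r); last by exists [::].
  by have [_ /d2[t]] := cS v vC; exists t.
have [ch chP'] := choice chP; exists X, ch; split=> //.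
  move=> v /chP'[pv lv]; split=> //; apply: sub_path pv.
  by move=> a b /andP[].
move=> k v kC kX vC; set K := comp W (S :\: X) k.
have KC : K \subset comp W S r.
  by rewrite -(comp_eq kC); apply: comp_mono; exact: subsetDl.
have lev g : g \in K -> [/\ (om' g <= d g)%N, g \in comp W S r &
    (d g - om' g + p) %/ s = (d g + p) %/ s].
  move=> gK; have gC := subsetP KC g gK; have [gS cg] := cS g gC.
  split=> //; first exact: d3.
  have : g \notin X by move: gK; rewrite !inE => /andP[/andP[]].
  rewrite inE gC /= -om'E ?(subsetP SB) // -leqNgt => le.
  by apply/eqP; rewrite eqn_leq le leq_div2r // leq_add2r leq_subr.
have step a b : a \in comp W S r -> b \in S -> tc W a b -> (d b <= d a + om' b)%N.
  by move=> /cS[aS ca] bS ab; apply: d1 => //; rewrite /rin /= aS bS.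
(* The common level of [K]. It is constant because touching strings have distances that differ by at
   most a weight, and no string of [K] straddles a boundary. *)
pose j := ((d k + p) %/ s)%N.
have const g : g \in K -> ((d g + p) %/ s = j)%N.
  have kK : k \in K by apply: comp_id; rewrite inE kX; case: (cS k kC).
  suff H q y : y \in K -> path (rin W (S :\: X)) y q ->
      ((d (last y q) + p) %/ s = (d y + p) %/ s)%N.
    by rewrite inE => /andP[_ /connectP[q pq ->]]; exact: H.
  elim: q y => [|x q IH] y yK //= /andP[yx pq]; have /and3P[yS xS t] := yx.
  have xK : x \in K by rewrite /K -(comp_eq yK) inE xS connect1.
  rewrite IH //; have [oy yC ly] := lev y yK; have [ox xC lx] := lev x xK.
  have t' : tc W x y by rewrite tcC.
  have h1 := step x y xC (proj1 (cS y yC)) t'.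
  have h2 := step y x yC (proj1 (cS x xC)) t.
  by apply/eqP; rewrite eqn_leq -{1}lx -{2}ly !leq_div2r ?leq_add2r //;
    rewrite leq_subLR addnC.
have [pv lv] := chP' v vC; set c := r :: ch v.
have cC u : u \in c -> u \in comp W S r.
  have pv' : path (rin W S) r (ch v) by apply: sub_path pv => a b /andP[].
  move=> /(path_sub pv')[t [pt lt _]]; rewrite inE.
  have cu : connect (rin W S) r u by apply/connectP; exists t.
  by rewrite cu (connect_in rS cu).
pose D u := (d u + p)%N.
have win := @window_sum I om' D (rin W S) s (j * s) r (ch v).
apply: leq_trans (win _ _ _); first last.
- by apply: leq_trans (leq_addr _ _); exact: d3.
- by apply: sub_path pv => a b /andP[-> /eqP]; rewrite /D /= => ->; rewrite addnAC.
- move=> u /cC/cS[uS _]; rewrite om'E ?(subsetP SB) //; exact: omS.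
rewrite -/c big_mkcond /=.
have bnd (l : seq I) : {subset l <= c} ->
   (#|[set g in K | has (tc W g) l]| <= \sum_(u <- l)
      if (j * s <= D u) && (D u <= j * s + s + om' u) then om' u else 0)%N.
  elim: l => [|u l IH] lc.
    rewrite big_nil leqn0 cards_eq0; apply/eqP/setP => g.
    by rewrite !inE andbF.
  rewrite big_cons; apply: leq_trans (_ : #|[set g in K | tc W g u]| +
      #|[set g in K | has (tc W g) l]| <= _)%N; last first.
    apply: leq_add; last by apply: IH => x xl; apply: lc; rewrite inE xl orbT.
    have [uS cu] := cS u (cC u (lc u (mem_head _ _))).
    have uC := cC u (lc u (mem_head _ _)).
    have [/eqP -> //|/set0Pn[g]] :=
      boolP ([set g in K | tc W g u] == set0); first by rewrite cards0.
    rewrite inE => /andP[gK gu]; have [og gC lg] := lev g gK.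
    have h1 := step g u gC uS gu; have gu' : tc W u g by rewrite tcC.
    have h2 := step u g uC (proj1 (cS g gC)) gu'.
    have jg := const g gK; rewrite jg in lg.
    have e1 := divn_eq (d g - om' g + p) s; rewrite lg in e1.
    have e2 := ltn_ceil (d g + p) s0; rewrite jg in e2.
    (* If [u] touches some [g] of [K], then [d u] is at least [d g - om' g] and at most
       [d g + om' u]; as [g] lies within level [j], this puts [u] into the window. *)
    rewrite ifT; last first.
      move: og h1 h2 e1 e2; rewrite /D mulSn; clear.
      by move: (_ %% s)%N => x; move: (j * s)%N => y; lia.
    rewrite om'E ?(subsetP SB) //; apply/subset_leq_card/subsetP => x.
    rewrite inE => /andP[xK xu]; rewrite inE tcC xu andbT.
    exact: subsetP CB x (subsetP KC x xK).
  rewrite -cardsUI; apply: leq_trans (leq_addr _ _).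
  apply/subset_leq_card/subsetP => g; rewrite !inE /= => /andP[->].
  by case/orP=> ->; rewrite ?orbT.
exact: bnd.
Qed.

(** Every cell is sent to the head of [W r] by a walk that follows a chain once it meets a string of
    [C], so that [Rv] collects all strings of [K] near this walk. [F] is the union of these sets for
    the four corners of the face that the parity argument provides. *)
Lemma face_cut B S r (K : {set I}) (ch : I -> seq I) (m : nat) :
  (forall g, g \in B -> linked (W g)) -> S \subset B -> r \in S ->
  K \subset comp W S r ->
  (forall v, v \in comp W S r -> path (rin W S) r (ch v) /\ last r (ch v) = v) ->
  (forall v, v \in comp W S r ->
     #|[set g in K | has (tc W g) (r :: ch v)]| <= m)%N ->
  exists F : {set I}, [/\ F \subset K, (#|F| <= 4 * m)%N &
    forall u, u \in K :\: F ->
      (2 * mass W B (comp W (K :\: F) u) <= mass W B B)%N].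
Proof.
move=> HW SB rS KC chP Rm; set C := comp W S r in KC chP Rm.
have CS : C \subset S by exact: comp_sub.
have rC : r \in C by exact: comp_id.
set rt := head (0, 0)%R (W r).
have [m0 Hm0] := cells_bound (flatten [seq W g | g <- enum B]).
have {}Hm0 g c : g \in B -> c \in W g ->
    [&& - m0%:Z < c.1, c.1 < m0%:Z, - m0%:Z < c.2 & c.2 < m0%:Z]%R.
  move=> gB cg; apply: Hm0; apply/flattenP; exists (W g) => //.
  by apply/mapP; exists g; rewrite ?mem_enum.
pose lo := (- m0%:Z)%R; pose n := (2 * m0)%N.
have rtW : rt \in W r by apply/head_linked/HW/(subsetP SB).
have n0 : (0 < n)%N.
  have := Hm0 r rt (subsetP SB r rS) rtW; rewrite /n.
  by case: rt {rtW} => a b /= /and4P[h1 h2 _ _]; lia.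
pose off (c : cell) := [|| c.1 == lo, c.1 == lo + n%:Z, c.2 == lo | c.2 == lo + n%:Z]%R.
have offW c g : off c -> g \in B -> c \notin W g.
  move=> oc gB; apply/negP => /(Hm0 _ _ gB); move: oc; rewrite /off /lo /n.
  by case: c => a b /= /or4P[] /eqP -> /and4P[h1 h2 h3 h4]; lia.
have bwalk c : off c -> exists s, [/\ path adj c s, last c s = (lo, lo) &
    forall d, d \in c :: s -> off d].
  case: c => a b; rewrite /off /= => H.
  have [ab|ab] : ((a == lo) || (a == lo + n%:Z)%R) \/ ((b == lo) || (b == lo + n%:Z)%R).
  - by case/or4P: H => ->; rewrite ?orbT; [left|left|right|right].
  - have [s1 [p1 l1 i1]] := vline a b lo; have [s2 [p2 l2 i2]] := hline a lo lo.
    exists (s1 ++ s2); rewrite cat_path last_cat p1 l1 p2 l2; split=> // d.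
    rewrite in_cons mem_cat orbA -in_cons => /orP[/i1|ds]; rewrite /off.
      by move=> ->; rewrite orbA ab.
    by rewrite i2 ?eqxx ?orbT // inE ds orbT.
  - have [s1 [p1 l1 i1]] := hline a lo b; have [s2 [p2 l2 i2]] := vline lo b lo.
    exists (s1 ++ s2); rewrite cat_path last_cat p1 l1 p2 l2; split=> // d.
    rewrite in_cons mem_cat orbA -in_cons => /orP[/i1|ds]; rewrite /off.
      by move=> ->; rewrite ab !orbT.
    by rewrite i2 ?eqxx ?orbT // inE ds orbT.
pose G x (sv : seq cell * I) := [/\ path adj x sv.1, last x sv.1 = rt, sv.2 \in C &
  forall c g, c \in x :: sv.1 -> g \in C -> c \in W g ->
    exists2 u, u \in r :: ch sv.2 & c \in W u].
have GP x : exists sv, G x sv.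
  (* Any walk to the root is cut where it first meets a string of [C], and continued along the chain
     of that string. Up to this point it meets no other cell of [C]. *)
  have [s0 [p0 l0]] := rect_walk x rt.
  have [|s1 [p1 /existsP[g /andP[gC yg]] [_ f1]]] :=
      @path_first _ _ [pred c | [exists g, (g \in C) && (c \in W g)]] _ _ p0.
    by rewrite inE l0; apply/existsP; exists r; rewrite rC rtW.
  have [pg lg] := chP g gC.
  have [||s2 [p2 l2 i2]] := @walk_chain S r (ch g) (last x s1) _ rS pg.
  - by move=> h hS; apply: HW; exact: subsetP SB h hS.
  - by rewrite lg.
  exists (s1 ++ s2, g); split => //=.
  - by rewrite cat_path p1.
  - by rewrite last_cat.
  move=> c h; rewrite in_cons mem_cat orbA -in_cons => /orP[cs|cs] hC ch'.
    have -> : c = last x s1.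
      by apply: f1 => //; rewrite inE; apply/existsP; exists h; rewrite hC.
    by exists g => //; rewrite -{1}lg mem_last.
  by apply: i2; rewrite inE cs orbT.
have [f fP] := choice GP.
pose o : cell := (lo, lo).
have oo : off o by rewrite /off eqxx.
(* A cell on the frame goes around the frame, which carries no string, to the corner [o] and shares
   its chain. This makes [R] constant on the boundary of the box. *)
have TP x : exists s, G x (s, (f (if off x then o else x)).2).
  have [ox|ox] := boolP (off x); last first.
    by exists (f x).1; case: (fP x) => *; split.
  have [s1 [p1 l1 i1]] := bwalk x ox; have [po lo' vo io] := fP o.
  exists (s1 ++ (f o).1); split => //=.
  - by rewrite cat_path p1 l1.
  - by rewrite last_cat l1.
  move=> c h; rewrite in_cons mem_cat orbA -in_cons => /orP[cs|cs] hC ch'.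
    have := offW c h (i1 c cs); rewrite ch'.
    by move=> /(_ (subsetP SB h (subsetP CS h hC))).
  by apply: io hC ch'; rewrite inE cs orbT.
have [T TG] := choice TP.
pose Rv v := [set g in K | has (tc W g) (r :: ch v)].
pose R x := Rv (f (if off x then o else x)).2.
pose big (F : {set I}) : pred I := fun g =>
  (g \in K :\: F) && (mass W B B < 2 * mass W B (comp W (K :\: F) g))%N.
have KB : K \subset B by apply: subset_trans KC _; exact: subset_trans CS SB.
have [||||||||i [j [_ _ nb]]] := @parity_face I W K lo n T rt R (R o) big n0.
- by move=> x; case: (TG x).
- move=> x g c gK cg cx; rewrite /R inE gK andTb.
  have [_ _ _ /(_ c g cx (subsetP KC g gK) cg) [u ur cu]] := TG x.
  apply/hasP; exists u => //; apply/hasP; exists c => //.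
  by apply/hasP; exists c; rewrite /touch ?eqxx.
- move=> i j _ _ ij; rewrite /R oo ifT //; rewrite /off /=.
  case/or4P: ij => /eqP ->; rewrite ?addr0 ?eqxx ?orbT //.
- by move=> g gK; apply: HW; exact: subsetP KB g gK.
- move=> g c gK cg; have := Hm0 g c (subsetP KB g gK) cg; rewrite /lo /n.
  by case: c {cg} => a b /=; clear => /and4P[h1 h2 h3 h4]; apply/and4P; split; lia.
- by move=> F g /andP[].
- move=> F F' g FF /andP[]; rewrite inE => /andP[gF gK] lt.
  have ss : K :\: F' \subset K :\: F by exact: setDS.
  rewrite /big inE gK (contra (subsetP FF g) gF) /=.
  by apply: leq_trans lt _; rewrite leq_mul2l /= mass_mono // comp_mono.
- move=> F g g' /andP[gF lt] /andP[gF' lt']; apply: mass_comps lt lt' => //.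
  by apply: subset_trans KB; exact: subsetDl.
exists (R (lo + i%:Z, lo + j%:Z)%R :|: R (lo + i.+1%:Z, lo + j%:Z)%R :|:
  R (lo + i%:Z, lo + j.+1%:Z)%R :|: R (lo + i.+1%:Z, lo + j.+1%:Z)%R).
have RK x : R x \subset K by apply/subsetP => g; rewrite inE => /andP[].
have Rc x : (#|R x| <= m)%N by apply: Rm; case: (TG x).
split; first by rewrite !subUset !RK.
  have cU (P Q : {set I}) : (#|P :|: Q| <= #|P| + #|Q|)%N by exact: leq_card_setU.
  have -> : (4 * m = m + m + m + m)%N by lia.
  by do 3! (apply: leq_trans (cU _ _) _; apply: leq_add => //).
by move=> u uF; have := nb u; rewrite /big uF -leqNgt.
Qed.

End Separator.

(** * Levels *)

Section Levels.
Context (I : finType) (W : I -> seq cell).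
Implicit Types (S B C F : {set I}) (u v g : I).

(** Both components are big, and the smaller set's component sits in a big component of the larger
    set; uniqueness identifies the latter with that of [u]. *)
Lemma big_comp_in B S S' u v : S \subset B -> S' \subset S ->
  u \in S -> v \in S' ->
  (mass W B B < 2 * mass W B (comp W S u))%N ->
  (mass W B B < 2 * mass W B (comp W S' v))%N ->
  comp W S' v \subset comp W S u.
Proof.
move=> SB SS uS vS' mu mv; have vS := subsetP SS v vS'.
have vu : v \in comp W S u.
  rewrite inE vS; apply: (mass_comps SB uS vS mu).
  by apply: leq_trans mv _; rewrite leq_mul2l mass_mono // comp_mono.
by rewrite -(comp_eq vu); exact: comp_mono.
Qed.

(** The window argument needs degrees at most [s], so the at most [s] strings of larger degree go
    first ([F0]). A big component that survives loses the layer [X], and what is still big is cut by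
    a face ([F2]). By uniqueness, each later big component is inside the earlier one, so nothing
    outside [K] has to be cut. *)
Lemma separator B (s : nat) : (0 < s)%N ->
  (forall g, g \in B -> linked (W g)) -> (mass W B B <= s * s)%N ->
  exists F : {set I}, [/\ F \subset B, (#|F| <= 14 * s)%N &
    forall u, u \in B :\: F ->
      (2 * mass W B (comp W (B :\: F) u) <= mass W B B)%N].
Proof.
move=> s0 HW Ms; set M := mass W B B.
pose F0 := [set u in B | s < om W B u]%N.
have F0B : F0 \subset B by apply/subsetP => u; rewrite inE => /andP[].
have F0s : (#|F0| <= s)%N.
  rewrite -(leq_pmul2r s0); apply: leq_trans Ms.
  apply: leq_trans (mass_mono W B F0B); rewrite -sum_nat_const.
  by apply: leq_sum => u; rewrite inE => /andP[_ /ltnW].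
have [/forall_inP H|] := boolP [forall u in B :\: F0,
    2 * mass W B (comp W (B :\: F0) u) <= M]%N.
  by exists F0; split=> //; apply: leq_trans F0s _; rewrite leq_pmull.
rewrite negb_forall_in => /exists_inP[r rS]; rewrite -ltnNge => mr.
set S := B :\: F0 in rS mr.
have SB : S \subset B by exact: subsetDl.
have omS u : u \in S -> (om W B u <= s)%N.
  by rewrite 2!inE negb_and -leqNgt => /andP[/orP[/negP h /h|//]].
have [X [ch [Xs chP Rm]]] := chain_cover s0 HW Ms SB rS omS.
pose F1 := F0 :|: (X :&: B).
have F1B : F1 \subset B by rewrite subUset F0B subsetIr.
have F1s : (#|F1| <= 2 * s)%N.
  apply: leq_trans (leq_card_setU _ _) _; rewrite mul2n -addnn leq_add //.
  by apply: leq_trans Xs; exact/subset_leq_card/subsetIl.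
have BF1 : B :\: F1 = S :\: X.
  by apply/setP => u; rewrite !inE; case: (u \in B); rewrite ?andbF ?andbT // negb_or andbC.
have [/forall_inP H|] := boolP [forall u in B :\: F1,
    2 * mass W B (comp W (B :\: F1) u) <= M]%N.
  by exists F1; split=> //; apply: leq_trans F1s _; rewrite leq_mul2r orbT.
rewrite negb_forall_in => /exists_inP[k kS]; rewrite -ltnNge BF1 => mk.
rewrite BF1 in kS.
set K := comp W (S :\: X) k in mk.
have KC : K \subset comp W S r by exact: big_comp_in (subsetDl _ _) rS kS mr mk.
have kX : k \notin X by move: kS; rewrite inE => /andP[].
have kC : k \in comp W S r by apply: (subsetP KC); exact: comp_id.
have [F2 [F2K F2s F2b]] := face_cut HW SB rS KC chP (fun v => Rm k v kC kX).
have KB : K \subset B.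
  by apply: subset_trans SB; apply: subset_trans (comp_sub _ _ _) (subsetDl _ _).
exists (F1 :|: F2); split.
- by rewrite subUset F1B (subset_trans F2K).
- apply: leq_trans (leq_card_setU _ _) _; lia.
move=> u; rewrite setDUr => uF; set D := (B :\: F1) :&: (B :\: F2) in uF *.
rewrite leqNgt; apply/negP => mu.
have DS : D \subset S :\: X by rewrite -BF1 subsetIl.
have uD := uF.
have sub : comp W D u \subset K.
  by apply: big_comp_in DS kS uD mk mu; apply: subset_trans SB; exact: subsetDl.
have sub2 : comp W D u \subset K :\: F2.
  apply/subsetP => x xC; rewrite inE (subsetP sub) // andbT.
  by have := subsetP (comp_sub W D u) x xC; rewrite !inE => /and3P[].
have uK : u \in K :\: F2 by apply: (subsetP sub2); exact: comp_id.
have := F2b u uK; rewrite leqNgt => /negP; apply.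
apply: leq_trans mu _; rewrite leq_mul2l /= mass_mono //.
exact: comp_conn_in.
Qed.

Lemma om_mono B C u : C \subset B -> (om W C u <= om W B u)%N.
Proof.
move=> /subsetP CB; apply/subset_leq_card/subsetP => v.
by rewrite !inE => /andP[/CB -> ->].
Qed.

Lemma om_gt0 B u : linked (W u) -> u \in B -> (0 < om W B u)%N.
Proof.
by move=> lu uB; apply/card_gt0P; exists u; rewrite inE uB tc_refl.
Qed.

Definition lcomp B (lev : I -> nat) u :=
  comp W [set v in B | lev u <= lev v] u.

Lemma sqrt_ceil (R : rcfType) (M : nat) : (0 < M)%N ->
  exists s : nat, [/\ (0 < s)%N, (M <= s * s)%N &
    (s%:R <= 2 * Num.sqrt M%:R :> R)%R].
Proof.
move=> M0; have ex : exists s, (M <= s * s)%N by exists M; rewrite leq_pmull.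
case: (ex_minnP ex) => -[|s] Ms smin; first by move: Ms; rewrite leqNgt M0.
exists s.+1; split=> //.
have lt : (s * s < M)%N by rewrite ltnNge; apply/negP => /smin; rewrite ltnn.
have M1 : (1 <= Num.sqrt M%:R :> R)%R by rewrite -{1}sqrtr1 ler_sqrt ?ler1n.
have : (s%:R <= Num.sqrt M%:R :> R)%R.
  rewrite -(ler_pXn2r (n := 2)) ?nnegrE ?ler0n ?sqrtr_ge0 //.
  by rewrite sqr_sqrtr ?ler0n // -natrX ler_nat -mulnn ltnW.
by rewrite -natr1; lra.
Qed.

(** A separator string contributes at most all of [B], hence at most the mass; this costs 28 M sqrt
    M in total. The components of the rest have masses that add up to at most M while each is at
    most M / 2, so they contribute at most 84 M sqrt M by induction. *)
Lemma levels (R : rcfType) B : (forall g, g \in B -> linked (W g)) ->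
  exists lev : I -> nat, ((\sum_(u in B) #|lcomp B lev u|)%N%:R <=
    112 * (mass W B B)%:R * Num.sqrt (mass W B B)%:R :> R)%R.
Proof.
have [n] := ubnP #|B|; elim: n B => // n IH B; rewrite ltnS => Bn HW.
have [->|B0] := eqVneq B set0.
  exists (fun=> 0%N); rewrite big_set0 !mulr_ge0 ?sqrtr_ge0 ?ler0n //.
have BM : (#|B| <= mass W B B)%N.
  by rewrite -sum1_card; apply: leq_sum => u uB; rewrite om_gt0 ?HW.
have M0 : (0 < mass W B B)%N by apply: leq_trans BM; rewrite card_gt0.
have [s [s0 Ms sM]] := sqrt_ceil R M0.
have [F [FB Fs Fb]] := separator s0 HW Ms.
have IH' C : exists lev, C \proper B ->
    ((\sum_(u in C) #|lcomp C lev u|)%N%:R <=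
     112 * (mass W C C)%:R * Num.sqrt (mass W C C)%:R :> R)%R.
  have [CB|] := boolP (C \proper B); last by exists (fun=> 0%N).
  have [|g gC|lev h] := IH C; last by exists lev.
    by apply: leq_trans Bn; exact: proper_card.
  by apply: HW; exact: subsetP (proper_sub CB) g gC.
have [LV LVP] := choice IH'.
pose cm u := comp W (B :\: F) u.
(* Separator strings get the bottom level, so the strings of level at least that of [u] outside [F]
   avoid [F], and [lcomp] stays in one component of [B :\: F]. *)
pose lev u := if u \in F then 0%N else (LV (cm u) u).+1.
exists lev; rewrite (big_setID F) /= (setIidPr FB).
have h1 : (\sum_(u in F) #|lcomp B lev u| <= 14 * s * mass W B B)%N.
  apply: leq_trans (_ : (\sum_(u in F) mass W B B <= _)%N).
    apply: leq_sum => u _; apply: leq_trans BM; apply/subset_leq_card.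
    apply: subset_trans (comp_sub _ _ _) _.
    by apply/subsetP => v; rewrite inE => /andP[].
  by rewrite sum_nat_const leq_mul2r Fs orbT.
have sub u : u \in B :\: F -> lcomp B lev u \subset lcomp (cm u) (LV (cm u)) u.
  move=> uBF; have uF : u \notin F by move: uBF; rewrite inE => /andP[].
  have uB : u \in B by move: uBF; rewrite inE => /andP[].
  apply: comp_conn_in; last by rewrite inE uB /=.
  have sBF : [set v in B | lev u <= lev v]%N \subset B :\: F.
    apply/subsetP => v; rewrite !inE => /andP[-> le]; rewrite andbT.
    by apply/negP => vF; move: le; rewrite /lev vF (negPf uF).
  apply/subsetP => v vC; have vm := subsetP (comp_mono W u sBF) v vC.
  rewrite inE vm /=; have := subsetP (comp_sub W _ u) v vC.
  rewrite inE /lev (negPf uF) => /andP[_].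
  by case: ifP => // _; rewrite /cm (comp_eq vm) ltnS.
have h2 : (\sum_(u in B :\: F) #|lcomp B lev u| <=
    \sum_(C in cm @: (B :\: F)) \sum_(u in C) #|lcomp C (LV C) u|)%N.
  apply: leq_trans (_ : \sum_(u in B :\: F) #|lcomp (cm u) (LV (cm u)) u| <= _)%N.
    by apply: leq_sum => u uBF; exact/subset_leq_card/sub.
  rewrite (partition_big_imset cm) /=; apply: leq_sum => C _.
  rewrite big_mkcond [leqRHS]big_mkcond /=; apply: leq_sum => u _.
  case: ifP => // /andP[uBF /eqP <-].
  by rewrite ifT // /cm comp_id.
have h3 : (\sum_(C in cm @: (B :\: F)) mass W B C <= mass W B B)%N.
  apply: leq_trans (mass_mono W B (subsetDl B F)).
  rewrite /mass [leqRHS](partition_big_imset cm) /=; apply: leq_sum => C.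
  case/imsetP => u0 u0B ->; rewrite big_mkcond [leqRHS]big_mkcond /=.
  apply: leq_sum => u _; case: ifP => // uC.
  by rewrite (subsetP (comp_sub W _ u0)) //= /cm (comp_eq uC) eqxx.
set M := mass W B B in h1 h3 BM M0 sM *; set q : R := Num.sqrt M%:R.
have q0 : (0 <= q)%R by exact: sqrtr_ge0.
have h4 C : C \in cm @: (B :\: F) ->
    ((\sum_(u in C) #|lcomp C (LV C) u|)%N%:R <=
     84 * q * (mass W B C)%:R :> R)%R.
  case/imsetP => u uBF ->; set D := cm u; have D2 := Fb u uBF.
  have DB : D \subset B.
    by apply: subset_trans (comp_sub _ _ _) _; exact: subsetDl.
  have pD : D \proper B.
    rewrite properEneq DB andbT; apply/negP => /eqP DE; move: D2.
    by rewrite -/M -[comp _ _ _]/D DE -/M; lia.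
  apply: le_trans (LVP D pD) _.
  have mm : (mass W D D <= mass W B D)%N.
    by apply: leq_sum => v _; exact: om_mono.
  (* The factor 3/4 is a rational bound for sqrt (1/2), since 9/16 is at least 1/2. *)
  have : (Num.sqrt (mass W D D)%:R <= 3 / 4 * q :> R)%R.
    rewrite -(ler_pXn2r (n := 2)) ?nnegrE ?sqrtr_ge0 ?mulr_ge0 ?invr_ge0 //.
    rewrite exprMn !sqr_sqrtr ?ler0n //.
    have : ((2 * mass W D D)%N%:R <= M%:R :> R)%R.
      rewrite ler_nat; apply: leq_trans D2; by rewrite leq_mul2l.
    rewrite natrM expr2; have := ler0n R M; lra.
  move: mm; rewrite -(ler_nat R) => mm sq.
  apply: le_trans (_ : 112 * (mass W D D)%:R * (3 / 4 * q) <= _)%R.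
    by rewrite ler_wpM2l ?mulr_ge0 ?ler0n.
  have -> : (112 * (mass W D D)%:R * (3 / 4 * q) = 84 * q * (mass W D D)%:R)%R.
    by field.
  by rewrite ler_wpM2l ?mulr_ge0.
have h5 : ((\sum_(u in B :\: F) #|lcomp B lev u|)%N%:R <= 84 * q * M%:R :> R)%R.
  apply: le_trans (_ : (\sum_(C in cm @: (B :\: F))
     \sum_(u in C) #|lcomp C (LV C) u|)%N%:R <= _)%R; first by rewrite ler_nat.
  rewrite natr_sum; apply: le_trans (ler_sum _ h4) _.
  rewrite -mulr_sumr -natr_sum ler_wpM2l ?mulr_ge0 //.
  by rewrite ler_nat.
rewrite natrD; move: h1; rewrite -(ler_nat R) !natrM => h1.
have M0' : (0 <= M%:R :> R)%R by rewrite ler0n.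
have h6 : (s%:R * M%:R <= 2 * q * M%:R :> R)%R by rewrite ler_wpM2r.
have -> : (112 * M%:R * q = 14 * (2 * q * M%:R) + 84 * q * M%:R)%R by ring.
apply: lerD h5; apply: le_trans h1 _; rewrite -mulrA ler_wpM2l //.
Qed.

End Levels.

(** * Counting touching pairs and crossing pairs *)

Lemma card_pairs (I J : finType) (A : {set I}) (F : I -> {set J}) :
  #|[set p | (p.1 \in A) && (p.2 \in F p.1)]| = (\sum_(i in A) #|F i|)%N.
Proof.
rewrite -sum1_card (eq_bigl (fun p => (p.1 \in A) && (p.2 \in F p.1))); last first.
  by move=> p; rewrite inE.
rewrite -(pair_big_dep (mem A) (fun i => mem (F i)) (fun _ _ => 1%N)) /=.
by apply: eq_bigr => i _; rewrite sum1_card.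
Qed.

Lemma card_ordered_pairs (I : finType) (T : {set I * I}) (C : {set {set I}}) :
  (forall p, p \in T -> p.1 != p.2 /\ [set p.1; p.2] \in C) -> (#|T| <= 2 * #|C|)%N.
Proof.
move=> TC; rewrite -sum1_card.
rewrite (partition_big (fun p => [set p.1; p.2]) (mem C)) /=; last by move=> p /TC[].
rewrite mulnC -sum_nat_const; apply: leq_sum => P _; rewrite sum1_card.
have [/card0_eq/eq_card0 -> //|] := posnP
  #|[pred p : I * I | (p \in T) && ([set p.1; p.2] == P)]|.
case/card_gt0P => -[a b] /andP[ /TC[ab _] /eqP <-] /=.
apply: (@leq_trans #|[set (a, b); (b, a)]|); last by rewrite cards2; case: eqP.
apply/subset_leq_card/subsetP => -[x y] /andP[/TC[/= xy _] /eqP e].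
have : x \in [set a; b] by rewrite -e !inE eqxx.
have : y \in [set a; b] by rewrite -e !inE eqxx orbT.
by move: xy; rewrite !inE => /[swap] /orP[]/eqP -> /[swap] /orP[]/eqP ->;
  rewrite ?eqxx ?orbT.
Qed.

Section Counting.
Context (I : finType) (W : I -> seq cell) (E : {set I}).

(** Strings that touch no other string are left out, because their diagonal terms in the mass are
    not controlled by the number of crossing pairs. *)
Definition touching : {set I} := [set e in E | [exists f in E, (f != e) && tc W e f]].

(** One factor 2 orders the pairs. The other absorbs the diagonal: every string here has another
    neighbour, so counting it as its own neighbour at most doubles the degree. *)
Lemma mass_touching (C : {set {set I}}) :
  (forall e f, e \in E -> f \in E -> e != f -> tc W e f -> [set e; f] \in C) ->
  (mass W touching touching <= 4 * #|C|)%N.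
Proof.
move=> HC; pose F u := [set v in E | (v != u) && tc W u v].
have : (#|[set p | (p.1 \in touching) && (p.2 \in F p.1)]| <= 2 * #|C|)%N.
  apply: card_ordered_pairs => -[u v]; rewrite !inE /= => /and4P[/andP[uE _] vE vu t].
  by rewrite eq_sym vu; split=> //; apply: HC; rewrite // eq_sym.
rewrite card_pairs => le; rewrite (_ : 4 = 2 * 2)%N // -mulnA.
apply: (@leq_trans (2 * \sum_(u in touching) #|F u|)); last by rewrite leq_mul2l.
rewrite big_distrr; apply: leq_sum => u uT /=.
have F0 : (0 < #|F u|)%N.
  move: uT; rewrite inE => /andP[_ /existsP[v /and3P[vE vu t]]].
  by apply/card_gt0P; exists v; rewrite inE vE vu.
apply: (@leq_trans #|u |: F u|); last by rewrite cardsU1; case: (_ \notin _); lia.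
apply/subset_leq_card/subsetP => v; rewrite !inE => /andP[/andP[-> _] ->].
by rewrite andbT; case: eqP.
Qed.

(** The shared cell makes [g] and [g'] touch, and as [lev e <= lev f] all strings that join [e] to
    [f] have level at least [lev e]. Each step between distinct strings shows that both belong to
    [touching]. *)
Lemma lcomp_touching (lev : I -> nat) e f g g' p :
  e != f -> (lev e <= lev f)%N -> e \in E -> f \in E ->
  g \in lcomp W E lev e -> g' \in lcomp W E lev f -> p \in W g -> p \in W g' ->
  e \in touching /\ f \in lcomp W touching lev e.
Proof.
move=> ef lef eE fE; rewrite !inE => /andP[/andP[gE lg] cg] /andP[/andP[gE' lg'] cg'] pg pg'.
set S := [set v in E | (lev e <= lev v)%N] in cg.
set S' := [set v in E | (lev f <= lev v)%N] in cg'.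
pose T := [set v in touching | (lev e <= lev v)%N].
have SS : S' \subset S.
  by apply/subsetP => v; rewrite !inE => /andP[-> /(leq_trans lef) ->].
have gg : rin W S g g'.
  rewrite /rin /= !inE gE lg gE' (leq_trans lef lg') /=.
  by apply/hasP; exists p => //; apply/hasP; exists p => //; rewrite /touch eqxx.
have : connect (rin W S) e f.
  apply: connect_trans cg (connect_trans (connect1 gg) _).
  by rewrite conn_sym; exact: connect_mono cg'.
have sub : subrel (rin W S) (connect (rin W T)).
  move=> a b /and3P[]; rewrite !inE => /andP[aE la] /andP[bE lb] ab.
  have [->|nab] := eqVneq a b; first exact: connect0.
  apply: connect1; rewrite /rin /= !inE aE bE la lb ab !andbT; apply/andP; split.
    by apply/existsP; exists b; rewrite bE eq_sym nab.
  by apply/existsP; exists a; rewrite aE nab tcC.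
move/(connect_sub sub) => c; have eT : e \in T.
  by by case/connectP: c ef => -[|x s] /= => [_ ->|/andP[/and3P[]]//]; rewrite eqxx.
have := connect_in eT c; move: eT; rewrite !inE => /andP[-> _] -> /=.
by split.
Qed.

Lemma card_crossing (lev : I -> nat) (X : {set {set I}}) :
  (forall P, P \in X -> exists e f g g' p, [/\ e != f, e \in E /\ f \in E, P = [set e; f],
     g \in lcomp W E lev e /\ g' \in lcomp W E lev f & p \in W g /\ p \in W g']) ->
  (#|X| <= \sum_(e in touching) #|lcomp W touching lev e|)%N.
Proof.
move=> HX; rewrite -card_pairs.
set A := [set _ | _]; apply: leq_trans (leq_imset_card (fun p => [set p.1; p.2]) A).
apply/subset_leq_card/subsetP => P /HX[e [f [g [g' [p [ef [eE fE] -> [ge gf] [pg pg']]]]]]].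
have [le|le] := leqP (lev e) (lev f).
  have [eT fl] := lcomp_touching ef le eE fE ge gf pg pg'.
  by apply/imsetP; exists (e, f) => //; rewrite inE eT.
rewrite eq_sym in ef; have [fT el] := lcomp_touching ef (ltnW le) fE eE gf ge pg' pg.
by apply/imsetP; exists (f, e); [rewrite inE fT|rewrite setUC].
Qed.

End Counting.

Local Open Scope ring_scope.

(** * Routings of the edges through the cells *)

(* (true, false), (true, true), (false, false), (false, true) stand for the
   left, right, lower and upper side of a cell. *)
Definition side := (bool * bool)%type.
(* The index of a port names the point where a strand passes through the side;
   the point itself is only chosen through pos below. *)
Definition port := (side * nat)%type.
Definition chord := (cell * (port * port))%type.

Definition nb (c : cell) (k : side) : cell :=
  if k.1 then (if k.2 then c.1 + 1 else c.1 - 1, c.2)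
  else (c.1, if k.2 then c.2 + 1 else c.2 - 1).
Definition opp (k : side) : side := (k.1, ~~ k.2).

Notation ccell a := (a.1) (only parsing).
Notation cin a := (a.2.1) (only parsing).
Notation cout a := (a.2.2) (only parsing).

Definition flip (a : chord) : chord := (ccell a, (cout a, cin a)).

Definition link (a b : chord) : bool :=
  [&& ccell b == nb (ccell a) (cout a).1, (cin b).1 == opp (cout a).1 &
      (cin b).2 == (cout a).2].

Lemma nb_opp c k : nb (nb c k) (opp k) = c.
Proof. by case: c k => a b [[] []]; rewrite /nb /opp /= ?addrK ?subrK. Qed.

Lemma oppK : involutive opp. Proof. by case=> a b; rewrite /opp /= negbK. Qed.

Lemma nb_neq c k : nb c k != c.
Proof.
by case: c k => a b [[] []]; rewrite /nb xpair_eqE /= ?eqxx /= ?andbT; lia.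
Qed.

Lemma link_flip a b : link (flip b) (flip a) = link a b.
Proof.
rewrite /link /flip /=; apply/and3P/and3P => -[/eqP h1 /eqP h2 /eqP h3].
  by rewrite h1 h2 h3 nb_opp oppK.
by rewrite h1 h2 h3 nb_opp oppK.
Qed.

Definition rstrand (s : seq chord) : seq chord := rev (map flip s).

Lemma sorted_rstrand s : sorted link (rstrand s) = sorted link s.
Proof.
rewrite /rstrand rev_sorted.
case: s => //= a s; elim: s a => //= b s IH a; rewrite IH; congr (_ && _).
by rewrite link_flip.
Qed.

(** By [link], the entry index of a later chord is the exit index of the preceding one, so this
    lists each port of a strand once. *)
Definition idxs (s : seq chord) : seq nat :=
  if s is a :: s' then (cin a).2 :: [seq (cout x).2 | x <- s] else [::].

Definition fst_end (s : seq chord) : cell * port :=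
  if s is a :: _ then (ccell a, cin a) else ((0, 0), ((true, true), 0%N)).
Definition lst_end (s : seq chord) : cell * port :=
  if s is a :: s' then (ccell (last a s'), cout (last a s'))
  else ((0, 0), ((true, true), 0%N)).

Lemma rstrand_cons a s : rstrand (a :: s) = rcons (rstrand s) (flip a).
Proof. by rewrite /rstrand /= rev_cons. Qed.

Lemma rstrand_rcons s a : rstrand (rcons s a) = flip a :: rstrand s.
Proof. by rewrite /rstrand map_rcons rev_rcons. Qed.

Lemma lst_end_rcons s a : lst_end (rcons s a) = (ccell a, cout a).
Proof. by case: s => //= b s; rewrite last_rcons. Qed.

Lemma fst_end_rev s : fst_end (rstrand s) = lst_end s.
Proof. by elim/last_ind: s => // s a _; rewrite rstrand_rcons lst_end_rcons. Qed.

Lemma lst_end_rev s : lst_end (rstrand s) = fst_end s.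
Proof. by case: s => // a s; rewrite rstrand_cons lst_end_rcons. Qed.

Lemma idxs_rcons s a : s != [::] ->
  idxs (rcons s a) = rcons (idxs s) (cout a).2.
Proof. by case: s => //= b s _; rewrite map_rcons. Qed.

Lemma idxs_rev s : sorted link s -> idxs (rstrand s) = rev (idxs s).
Proof.
case: s => // a s; elim: s a => // b s IH a /= /andP[/and3P[_ _ /eqP ab] ps].
rewrite rstrand_cons idxs_rcons; last by rewrite rstrand_cons; case: rstrand.
by rewrite IH //= !rev_cons /= ab.
Qed.

Lemma sorted_cat_cons (s1 s2 : seq chord) c :
  sorted link (s1 ++ c :: s2) = sorted link (rcons s1 c) && path link c s2.
Proof.
by case: s1 => [|a s1] //=; rewrite cat_path rcons_path /= andbA.
Qed.

Lemma path_cat_cons (s1 s2 : seq chord) c d :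
  path link d (s1 ++ c :: s2) = path link d (rcons s1 c) && path link c s2.
Proof. by rewrite cat_path rcons_path /= andbA. Qed.

Lemma sorted_rcons_eq s c c1 : ccell c1 = ccell c -> cin c1 = cin c ->
  sorted link (rcons s c1) = sorted link (rcons s c).
Proof.
by move=> h1 h2; case: s => [|a s] //=; rewrite !rcons_path /link h1 h2.
Qed.

Lemma path_rcons_eq s c c1 b : ccell c1 = ccell c -> cin c1 = cin c ->
  path link b (rcons s c1) = path link b (rcons s c).
Proof. by move=> h1 h2; rewrite !rcons_path /link h1 h2. Qed.

Lemma path_eq s c c1 : ccell c1 = ccell c -> cout c1 = cout c ->
  path link c1 s = path link c s.
Proof. by move=> h1 h2; case: s => [|a s] //=; rewrite /link h1 h2. Qed.

(** * Interleaving of chord ends on the boundary of a cell *)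

Section Crossing.
Context (R : realFieldType) (pos : port -> R).
Hypothesis pos_inj : forall p p', pos p = pos p' -> p.2 = p'.2.

(* Exactly one of u and v lies between a and b. *)
Definition x4 (a b u v : R) : bool :=
  (a < u) (+) (a < v) (+) ((b < u) (+) (b < v)).

Definition crosses (a b : chord) : bool :=
  (ccell a == ccell b) && x4 (pos (cin a)) (pos (cout a)) (pos (cin b)) (pos (cout b)).

Lemma x4_flip a b u v : x4 b a u v = x4 a b u v.
Proof. by rewrite /x4 addbC. Qed.

Lemma x4_flip2 a b u v : x4 a b v u = x4 a b u v.
Proof. by rewrite /x4 (addbC (a < v)) (addbC (b < v)). Qed.

Lemma x4C a b u v : a != u -> a != v -> b != u -> b != v ->
  x4 u v a b = x4 a b u v.
Proof.
move=> h1 h2 h3 h4; have N (x y : R) : x != y -> (y < x) = ~~ (x < y).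
  by move=> xy; rewrite -leNgt le_eqVlt eq_sym (negPf xy).
rewrite /x4 !(N a) // !(N b) //.
by case: (a < u); case: (a < v); case: (b < u); case: (b < v).
Qed.

(** Of the three ways to pair four points on a circle, only one makes the chords cross. *)
Lemma x4_uncross a b c d : a != c -> a != d -> b != c -> b != d ->
  x4 a b c d -> x4 a d c b = false.
Proof.
rewrite /x4 => ac ad bc bd.
case: (ltgtP a c) ac => // ac _; case: (ltgtP a d) ad => // ad _;
case: (ltgtP b c) bc => // bc _; case: (ltgtP b d) bd => // bd _ //=;
case: (ltgtP a b) => // ab; case: (ltgtP d c) => // dc //=;
by rewrite ?dc ?ltxx //; exfalso; lra.
Qed.

(** [s x] tells on which side of the chord [u v] the point lies. Both sums have the same parity, so
    the inequality can fail only if [a], [b] lie on one side and [c], [d] on the other; but then the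
    chords [a b] and [c d] do not cross. *)
Lemma x4_third a b c d u v :
  a != c -> a != d -> b != c -> b != d -> x4 a b c d ->
  (x4 a d u v + x4 c b u v <= x4 a b u v + x4 c d u v)%N.
Proof.
move=> ac ad bc bd cr; rewrite /x4.
pose s x := (x < u) (+) (x < v); rewrite -/(s a) -/(s b) -/(s c) -/(s d).
suff H : ~ (s a = s b /\ s c = s d /\ s a != s c).
  by move: H; case: (s a); case: (s b); case: (s c); case: (s d) => //= [[]].
have T x y z : s x -> s y -> ~~ s z -> (z < x) = (z < y) /\ (x < z) = (y < z).
  rewrite /s; case: (ltP x u) => xu; case: (ltP x v) => xv //= _;
  case: (ltP y u) => yu; case: (ltP y v) => yv //= _;
  case: (ltP z u) => zu; case: (ltP z v) => zv //= _;
  by split; apply/idP/idP => ?; lra.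
move=> [sab [scd sac]]; move: cr; rewrite /x4.
case E: (s a) sac; rewrite /= => sc.
  have sb : s b by rewrite -sab.
  have sd : ~~ s d by rewrite -scd.
  by have [_ ->] := T a b c E sb sc; have [_ ->] := T a b d E sb sd; rewrite addbb.
have sc' : s c by case: (s c) sc.
have sd : s d by rewrite -scd.
have sb : ~~ s b by rewrite -sab E.
have [-> _] := T c d a sc' sd (negbT E); have [-> _] := T c d b sc' sd sb.
by rewrite !addbb.
Qed.

End Crossing.

Section States.
Context (R : realFieldType) (pos : port -> R).
Hypothesis pos_inj : forall p p', pos p = pos p' -> p.2 = p'.2.

Local Notation crosses := (crosses pos).

Definition apart (a b : chord) : bool := (a.1 == b.1) ==>
  [&& a.2.1.2 != b.2.1.2, a.2.1.2 != b.2.2.2,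
      a.2.2.2 != b.2.1.2 & a.2.2.2 != b.2.2.2].

Lemma apartC a b : apart a b = apart b a.
Proof.
rewrite /apart eq_sym; congr (_ ==> _).
by apply/and4P/and4P => -[h1 h2 h3 h4]; split; rewrite eq_sym.
Qed.

Lemma pos_neq (p p' : port) : p.2 != p'.2 -> pos p != pos p'.
Proof. by apply: contra => /eqP/pos_inj ->. Qed.

Lemma crossesC a b : apart a b -> crosses a b = crosses b a.
Proof.
rewrite /apart /crosses eq_sym; case: eqP => //= ab /and4P[h1 h2 h3 h4].
by rewrite x4C // eq_sym pos_neq // eq_sym.
Qed.

(** Ordered pairs are counted, the diagonal included: a chord with distinct ends counts as crossing
    itself, which adds at most 1 per chord and does no harm in comparisons of lists of equal
    length. *)
Definition ncross (L : seq chord) : nat :=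
  (\sum_(a <- L) \sum_(b <- L) crosses a b)%N.

Lemma perm_ncross L L' : perm_eq L L' -> ncross L = ncross L'.
Proof.
move=> LL; rewrite /ncross (perm_big _ LL) /=.
by apply: eq_bigr => a _; exact: perm_big.
Qed.

Lemma ncross_cons2 x y Z : ncross (x :: y :: Z) =
  (crosses x x + crosses x y + crosses y x + crosses y y +
   \sum_(g <- Z) (crosses x g + crosses y g) +
   \sum_(g <- Z) (crosses g x + crosses g y) + ncross Z)%N.
Proof.
have E : (\sum_(g <- Z) \sum_(b <- [:: x, y & Z]) crosses g b =
    \sum_(g <- Z) (crosses g x + crosses g y + \sum_(b <- Z) crosses g b))%N.
  by apply: eq_bigr => g _; rewrite !big_cons addnA.
rewrite /ncross !big_cons E !big_split /=; lia.
Qed.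

(** Exchanging the exits removes the crossing of [c] with [c'], which is counted twice, and by
    [x4_third] adds no crossing with other chords. *)
Lemma ncross_uncross c c' (Z : seq chord) : c.1 = c'.1 -> crosses c c' -> apart c c' ->
  c.2.1.2 != c.2.2.2 -> c'.2.1.2 != c'.2.2.2 ->
  (forall g, g \in Z -> apart c g /\ apart c' g) ->
  (ncross ((c.1, (c.2.1, c'.2.2)) :: (c.1, (c'.2.1, c.2.2)) :: Z) <
   ncross (c :: c' :: Z))%N.
Proof.
case: c c' => p [i o] [p' [i' o']] /= <- cr dcc' io io' dZ.
have := dcc'; rewrite /apart /= eqxx /= => /and4P[h1 h2 h3 h4].
move: cr; rewrite /crosses /= eqxx /= => cr.
have cr' : x4 (pos i') (pos o') (pos i) (pos o).
  by rewrite x4C // pos_neq.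
have u1 := x4_uncross (pos_neq h1) (pos_neq h2) (pos_neq h3) (pos_neq h4) cr.
have u2 : x4 (pos i') (pos o) (pos i) (pos o') = false.
  by apply: x4_uncross cr'; rewrite pos_neq // eq_sym.
have diag x y : x4 x y x y = (x != y).
  by rewrite /x4 !ltxx; case: ltgtP.
have third g : g \in Z ->
    (crosses (p, (i, o')) g + crosses (p, (i', o)) g <=
     crosses (p, (i, o)) g + crosses (p, (i', o')) g)%N /\
    (crosses g (p, (i, o')) + crosses g (p, (i', o)) <=
     crosses g (p, (i, o)) + crosses g (p, (i', o')))%N.
  move=> gZ; have [dg dg'] := dZ g gZ.
  have e1 : apart (p, (i, o')) g.
    move: dg dg'; rewrite /apart /=; case: (p == g.1) => //=.
    by move=> /and4P[-> -> _ _] /and4P[_ _ -> ->].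
  have e2 : apart (p, (i', o)) g.
    move: dg dg'; rewrite /apart /=; case: (p == g.1) => //=.
    by move=> /and4P[_ _ -> ->] /and4P[-> -> _ _].
  have H : (crosses (p, (i, o')) g + crosses (p, (i', o)) g <=
     crosses (p, (i, o)) g + crosses (p, (i', o')) g)%N.
    rewrite /crosses /=; case: eqP => //= _.
    exact: x4_third (pos_neq h1) (pos_neq h2) (pos_neq h3) (pos_neq h4) cr.
  split=> //.
  by rewrite -(crossesC e1) -(crossesC e2) -(crossesC dg) -(crossesC dg').
have h3' : i'.2 != o.2 by rewrite eq_sym.
rewrite !ncross_cons2 /crosses /= !eqxx /= !diag cr cr' u1 u2 !pos_neq //.
have l1 : (\sum_(g <- Z) (crosses (p, (i, o')) g + crosses (p, (i', o)) g) <=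
  \sum_(g <- Z) (crosses (p, (i, o)) g + crosses (p, (i', o')) g))%N.
  by rewrite big_seq [leqRHS]big_seq; apply: leq_sum => g /third[].
have l2 : (\sum_(g <- Z) (crosses g (p, (i, o')) + crosses g (p, (i', o))) <=
  \sum_(g <- Z) (crosses g (p, (i, o)) + crosses g (p, (i', o'))))%N.
  by rewrite big_seq [leqRHS]big_seq; apply: leq_sum => g /third[].
have b1 := leq_b1 (pos i != pos o'); have b2 := leq_b1 (pos i' != pos o).
move: l1 l2 b1 b2; rewrite /crosses /=; lia.
Qed.

Lemma in_idxs s a : sorted link s -> a \in s ->
  (a.2.1.2 \in idxs s) && (a.2.2.2 \in idxs s).
Proof.
case: s => // x s /=; elim: s x => [|y s IH] x /=.
  by move=> _; rewrite !inE => /eqP ->; rewrite !eqxx orbT.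
move=> /andP[/and3P[_ _ /eqP xy] ps]; rewrite in_cons => /predU1P[->|ay].
  by rewrite !inE !eqxx ?orbT.
have /andP[h1 h2] := IH y ps ay.
rewrite in_cons (in_cons x.2.1.2) -xy; apply/andP; split.
  by move: h1; rewrite !inE => /orP[->|/orP[->|->]]; rewrite ?orbT.
by move: h2; rewrite !inE => /orP[->|/orP[->|->]]; rewrite ?orbT.
Qed.

Lemma apart_strand s : sorted link s -> uniq (idxs s) ->
  pairwise apart s && all (fun a : chord => a.2.1.2 != a.2.2.2) s.
Proof.
case: s => // x s /=; elim: s x => [|y s IH] x.
  by rewrite /= inE => _ /andP[->].
rewrite /= => /andP[xy ps] /andP[]; rewrite !inE !negb_or => /and3P[x1 x2 x3].
move=> /andP[/andP[x4 x5] /andP[y1 us]].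
have yx : y.2.1.2 = x.2.2.2 by case/and3P: xy => _ _ /eqP.
have := IH y ps; rewrite /= yx us y1 !inE negb_or x4 x5 => /(_ isT).
move=> /andP[/andP[d1 ->] /andP[_ ->]]; rewrite x1 d1 /= !andbT.
(* Consecutive chords share an index, but they lie in different cells. *)
apply/andP; split; first by
  rewrite /apart; case/and3P: xy => /eqP -> _ _; rewrite eq_sym (negPf (nb_neq _ _)).
have sub z : z \in s -> (z.2.1.2 \in [seq (cout x).2 | x <- y :: s]) /\
    (z.2.2.2 \in [seq (cout x).2 | x <- s]).
  elim: s y ps {IH xy x3 x5 us y1 d1 x2 x4 yx} => // w s IH y /= /andP[yw ps].
  rewrite in_cons => /predU1P[->|zs].
    by case/and3P: yw => _ _ /eqP ->; rewrite !inE !eqxx.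
  have [h1 h2] := IH w ps zs; rewrite !inE; split.
    by move: h1; rewrite inE => /orP[]->; rewrite ?orbT.
  by rewrite h2 orbT.
apply/allP => z /sub[h1 h2]; rewrite /apart; apply/implyP => _.
have n1 : forall n : nat, n \in [seq (cout x).2 | x <- y :: s] ->
   (x.2.1.2 != n) && (x.2.2.2 != n).
  move=> n /= ; rewrite in_cons => /predU1P[->|ns]; first by rewrite x2 x4.
  by apply/andP; split; apply: contraTneq ns => <-.
have /andP[-> ->] := n1 _ h1.
have h2' : z.2.2.2 \in [seq (cout x).2 | x <- y :: s] by rewrite in_cons h2 orbT.
by have /andP[-> ->] := n1 _ h2'.
Qed.

End States.

(** * Strands of minimal length with fewest crossings *)

Section Minimal.
Context (R : realFieldType) (pos : port -> R).
Hypothesis pos_inj : forall p p', pos p = pos p' -> p.2 = p'.2.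
Context (I : finType) (E : {set I}) (ell : cell -> nat).
Context (allowed : pred cell) (endok : I -> rel (cell * port)).
Hypothesis ell_gt0 : forall c, (0 < ell c)%N.
Hypothesis endokC : forall e x y, endok e x y = endok e y x.

Local Notation crosses := (crosses pos).
Local Notation ncross := (ncross pos).

Definition valid (e : I) (s : seq chord) : bool :=
  [&& s != [::], sorted link s, endok e (fst_end s) (lst_end s) &
      all (fun a : chord => allowed a.1) s].

Definition collect (T : Type) (F : seq chord -> seq T) (D : {set I})
    (st : I -> seq chord) : seq T := flatten [seq F (st e) | e <- enum D].

Definition good (st : I -> seq chord) : Prop :=
  (forall e, e \in E -> valid e (st e)) /\ uniq (collect idxs E st).

Definition len (s : seq chord) : nat := (\sum_(a <- s) ell a.1)%N.
Definition cost1 st := len (collect id E st).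
Definition cost2 st := ncross (collect id E st).

Definition upd (st : I -> seq chord) e s : I -> seq chord :=
  fun x => if x == e then s else st x.

Lemma perm_collect (T : eqType) (F : seq chord -> seq T) (D : {set I}) st e :
  e \in D -> perm_eq (collect F D st) (F (st e) ++ collect F (D :\ e) st).
Proof.
move=> eD; rewrite /collect -[_ ++ _]/(flatten [seq F (st x) | x <- e :: enum (D :\ e)]).
apply/perm_flatten/perm_map; apply: uniq_perm; first exact: enum_uniq.
  by rewrite /= enum_uniq mem_enum !inE eqxx.
by move=> x; rewrite !inE !mem_enum !inE; case: eqP => [->|].
Qed.

Lemma collect_eq (T : Type) (F : seq chord -> seq T) (D : {set I}) st st' :
  {in D, st =1 st'} -> collect F D st = collect F D st'.
Proof.
move=> ss; congr flatten; apply/eq_in_map => x; rewrite mem_enum => xD.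
by rewrite ss.
Qed.

Lemma mem_collect (T : eqType) (F : seq chord -> seq T) (D : {set I}) st x :
  reflect (exists2 e, e \in D & x \in F (st e)) (x \in collect F D st).
Proof.
apply: (iffP flatten_mapP) => -[e eD xF]; exists e => //.
  by rewrite mem_enum in eD.
by rewrite mem_enum.
Qed.

Lemma perm_len s s' : perm_eq s s' -> len s = len s'.
Proof. by move=> ss; exact: perm_big. Qed.

Lemma len_cat s s' : len (s ++ s') = (len s + len s')%N.
Proof. by rewrite /len big_cat. Qed.

Lemma len_cons a s : len (a :: s) = (ell a.1 + len s)%N.
Proof. by rewrite /len big_cons. Qed.

Lemma idxs_cat_cons A c s c1 s1 : c.2.1 = c1.2.1 ->
  exists h, idxs (A ++ c :: s) = h :: [seq (cout x).2 | x <- A ++ c :: s] /\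
            idxs (A ++ c1 :: s1) = h :: [seq (cout x).2 | x <- A ++ c1 :: s1].
Proof.
by case: A => [|a A] /= e; [exists c.2.1.2; rewrite -e|exists a.2.1.2].
Qed.

Lemma idxs_uniq st e : good st -> e \in E -> uniq (idxs (st e)).
Proof.
move=> [_ u] eE; move: u; rewrite (perm_uniq (perm_collect _ _ eE)) cat_uniq.
by case/and3P.
Qed.

Lemma idxs_disj st e f x : good st -> e \in E -> f \in E -> e != f ->
  x \in idxs (st e) -> x \notin idxs (st f).
Proof.
move=> [_ u] eE fE ef xe; move: u; rewrite (perm_uniq (perm_collect _ _ eE)).
rewrite cat_uniq => /and3P[_ /hasPn n _]; apply/negP => xf.
have xc : x \in collect idxs (E :\ e) st.
  by apply/mem_collect; exists f; rewrite // !inE eq_sym ef.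
by move: (n x xc); rewrite /= xe.
Qed.

Lemma valid_sorted st e : good st -> e \in E -> sorted link (st e).
Proof. by move=> [v _] /v /and4P[]. Qed.

Lemma apart_other st e f a b : good st -> e \in E -> f \in E -> e != f ->
  a \in st e -> b \in st f -> apart a b.
Proof.
move=> gs eE fE ef ae bf.
have /andP[a1 a2] := in_idxs (valid_sorted gs eE) ae.
have /andP[b1 b2] := in_idxs (valid_sorted gs fE) bf.
have H x y : x \in idxs (st e) -> y \in idxs (st f) -> x != y.
  by move=> xe yf; apply: contraTneq yf => <-; exact: idxs_disj gs eE fE ef xe.
by rewrite /apart !H // implybT.
Qed.

Lemma pairwise_sub (T : eqType) (r : rel T) (A Z : seq T) c g :
  symmetric r -> pairwise r (A ++ c :: Z) -> g \in A ++ Z -> r c g.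
Proof.
move=> rs; rewrite pairwise_cat /= => /and3P[/allrelP h1 _ /andP[/allP h2 _]].
rewrite mem_cat => /orP[gA|/h2 //]; rewrite rs; apply: h1 => //; exact: mem_head.
Qed.

(** Between the two crossings [e] and [f] exchange their courses. The cells used and the indices are
    the same as before, counted over both strands, so length and goodness persist while both
    crossings disappear. *)
Lemma swap_step st e f A M Z B N Y c d c' d' :
  good st -> e \in E -> f \in E -> e != f ->
  st e = A ++ c :: M ++ d :: Z -> st f = B ++ c' :: N ++ d' :: Y ->
  crosses c c' -> crosses d d' -> c.1 != d.1 ->
  exists st', [/\ good st', cost1 st' = cost1 st & (cost2 st' < cost2 st)%N].
Proof.
move=> gs eE fE ef es fs cc dd cd.
have [vE uE] := gs.
have cc1 : c.1 = c'.1 by case/andP: cc => /eqP.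
have dd1 : d.1 = d'.1 by case/andP: dd => /eqP.
pose c1 : chord := (c.1, (c.2.1, c'.2.2)); pose c1' : chord := (c.1, (c'.2.1, c.2.2)).
pose d1 : chord := (d.1, (d'.2.1, d.2.2)); pose d1' : chord := (d.1, (d.2.1, d'.2.2)).
pose se := A ++ c1 :: N ++ d1 :: Z; pose sf := B ++ c1' :: M ++ d1' :: Y.
pose st' := upd (upd st e se) f sf.
have st'e : st' e = se by rewrite /st' /upd (negPf ef) eqxx.
have st'f : st' f = sf by rewrite /st' /upd eqxx.
have st'o x : x \in E :\ e :\ f -> st' x = st x.
  by rewrite !inE /st' /upd => /and3P[/negPf -> /negPf ->].
have fE' : f \in E :\ e by rewrite !inE fE eq_sym ef.
have pC (T : eqType) (F : seq chord -> seq T) s0 :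
    perm_eq (collect F E s0) (F (s0 e) ++ F (s0 f) ++ collect F (E :\ e :\ f) s0).
  rewrite (perm_trans (perm_collect _ _ eE)) // perm_cat2l.
  exact: perm_collect.
have /and4P[_ se1 se2 se3] := vE e eE; have /and4P[_ sf1 sf2 sf3] := vE f fE.
rewrite es in se1 se2 se3; rewrite fs in sf1 sf2 sf3.
have fE1 (P Q Q' : seq chord) (x x1 : chord) :
    x.1 = x1.1 -> x.2.1 = x1.2.1 -> fst_end (P ++ x1 :: Q') = fst_end (P ++ x :: Q).
  by move=> h1 h2; case: P => [|? ?] //=; rewrite h1 h2.
have lE1 (P Q Q' K : seq chord) (x x1 y y1 : chord) :
    y.1 = y1.1 -> y.2.2 = y1.2.2 ->
    lst_end (P ++ x1 :: Q' ++ y1 :: K) = lst_end (P ++ x :: Q ++ y :: K).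
  move=> h1 h2; rewrite -!cat_cons !catA.
  case/lastP: K => [|K z]; last by rewrite -!rcons_cons -!rcons_cat !lst_end_rcons.
  by rewrite !cats1 !lst_end_rcons h1 h2.
have ve : valid e se.
  apply/and4P; split; first by rewrite /se; case: (A).
  - rewrite /se sorted_cat_cons path_cat_cons.
    move: se1 sf1; rewrite !sorted_cat_cons !path_cat_cons.
    rewrite (@sorted_rcons_eq A c c1) // (@path_rcons_eq N d' d1) //.
    rewrite (@path_eq Z d d1) // (@path_eq (rcons N d') c' c1) //.
    by move=> /and3P[-> _ ->] /and3P[_ -> _].
  - by rewrite /se (fE1 _ (M ++ d :: Z) _ c) // (lE1 _ M _ _ c _ d).
  - move: se3 sf3; rewrite /se !all_cat /= !all_cat /=.
    by move=> /and5P[-> -> _ -> ->] /and5P[_ _ -> _ _].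
have vf : valid f sf.
  apply/and4P; split; first by rewrite /sf; case: (B).
  - rewrite /sf sorted_cat_cons path_cat_cons.
    move: se1 sf1; rewrite !sorted_cat_cons !path_cat_cons.
    rewrite (@sorted_rcons_eq B c' c1') // (@path_rcons_eq M d d1') //.
    rewrite (@path_eq Y d' d1') // (@path_eq (rcons M d) c c1') //.
    by move=> /and3P[_ -> _] /and3P[-> _ ->].
  - by rewrite /sf (fE1 _ (N ++ d' :: Y) _ c') // (lE1 _ N _ _ c' _ d').
  - move: se3 sf3; rewrite /sf !all_cat /= !all_cat /= cc1 dd1.
    by move=> /and5P[_ _ -> _ _] /and5P[-> -> _ -> ->].
have g' : good st'.
  split=> [x xE|].
    rewrite /st' /upd; case: eqP => [->//|_]; case: eqP => [->//|_].
    exact: vE.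
  rewrite (perm_uniq (pC _ idxs st')) st'e st'f (collect_eq _ st'o).
  rewrite -(perm_uniq (_ : perm_eq (collect idxs E st) _)) //.
  apply: perm_trans (pC _ idxs st) _.
  rewrite !catA perm_cat2r es fs /se /sf.
  have [h [-> ->]] := @idxs_cat_cons A c (M ++ d :: Z) c1 (N ++ d1 :: Z) erefl.
  have [h' [-> ->]] := @idxs_cat_cons B c' (N ++ d' :: Y) c1' (M ++ d1' :: Y) erefl.
  rewrite !map_cat /= !map_cat /=; apply/permP => P.
  rewrite /= !count_cat /= !count_cat /= !count_cat /=; clear; ring.
pose L0 := A ++ M ++ Z ++ B ++ N ++ Y ++ collect id (E :\ e :\ f) st.
have P0 : perm_eq (collect id E st) [:: c, c', d, d' & L0].
  apply: perm_trans (pC _ id st) _; rewrite es fs /L0; apply/permP => P.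
  rewrite /= !count_cat /= !count_cat /=; clear; ring.
have P1 : perm_eq (collect id E st') [:: c1, c1', d1, d1' & L0].
  apply: perm_trans (pC _ id st') _; rewrite st'e st'f (collect_eq _ st'o).
  rewrite /se /sf /L0; apply/permP => P.
  rewrite /= !count_cat /= !count_cat /=; clear; ring.
exists st'; split=> //.
  rewrite /cost1 (perm_len P0) (perm_len P1) /len !big_cons /= -cc1 -dd1.
  by clear; lia.
have /andP[pwe ioe] := apart_strand (valid_sorted gs eE) (idxs_uniq gs eE).
have /andP[pwf iof] := apart_strand (valid_sorted gs fE) (idxs_uniq gs fE).
have me x : x \in A ++ c :: M ++ d :: Z -> x \in st e by rewrite es.
have mf x : x \in B ++ c' :: N ++ d' :: Y -> x \in st f by rewrite fs.
have ce : c \in st e by apply: me; rewrite mem_cat mem_head orbT.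
have de : d \in st e by apply: me; rewrite !(mem_cat, in_cons) eqxx ?orbT.
have cf : c' \in st f by apply: mf; rewrite mem_cat mem_head orbT.
have df : d' \in st f by apply: mf; rewrite !(mem_cat, in_cons) eqxx ?orbT.
have oth x g : x \in st e -> g \in collect id (E :\ e :\ f) st -> apart x g.
  move=> xe /mem_collect[y]; rewrite !inE => /and3P[yf ye yE] gy.
  by apply: (apart_other gs eE yE) gy => //; rewrite eq_sym.
have otf x g : x \in st f -> g \in collect id (E :\ e :\ f) st -> apart x g.
  move=> xe /mem_collect[y]; rewrite !inE => /and3P[yf ye yE] gy.
  by apply: (apart_other gs fE yE) gy => //; rewrite eq_sym.
have ofe x g : x \in st f -> g \in st e -> apart x g.
  by move=> xf ge; rewrite apartC; exact: apart_other gs eE fE ef ge xf.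
have oef x g : x \in st e -> g \in st f -> apart x g.
  by move=> xf ge; exact: apart_other gs eE fE ef xf ge.
have selfe x P Q g : st e = P ++ x :: Q -> g \in P ++ Q -> apart x g.
  by move=> h gPQ; move: pwe; rewrite h => /pairwise_sub; apply => //; exact: apartC.
have selff x P Q g : st f = P ++ x :: Q -> g \in P ++ Q -> apart x g.
  by move=> h gPQ; move: pwf; rewrite h => /pairwise_sub; apply => //; exact: apartC.
have subc g : g \in L0 -> [\/ g \in A ++ M ++ Z, g \in B ++ N ++ Y |
    g \in collect id (E :\ e :\ f) st].
  rewrite /L0 !mem_cat => /orP[->|/orP[->|/orP[->|/orP[->|/orP[->|/orP[->|->]]]]]];
    rewrite ?orbT; by [constructor 1|constructor 2|constructor 3].
have mst (P M0 Z0 : seq chord) x y g : g \in P ++ M0 ++ Z0 ->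
    (g \in P ++ M0 ++ y :: Z0) && (g \in (P ++ x :: M0) ++ Z0) &&
    (g \in P ++ x :: M0 ++ y :: Z0).
  by rewrite !(mem_cat, in_cons) => /or3P[]->; rewrite ?orbT.
have inE0 g : g \in A ++ M ++ Z -> g \in st e.
  by move=> h; apply: me; have /andP[_ ->] := mst _ _ _ c d g h.
have inF0 g : g \in B ++ N ++ Y -> g \in st f.
  by move=> h; apply: mf; have /andP[_ ->] := mst _ _ _ c' d' g h.
have Dcd g : g \in L0 -> apart c g /\ apart c' g /\ apart d g /\ apart d' g.
  have es2 : st e = (A ++ c :: M) ++ d :: Z by rewrite es -catA.
  have fs2 : st f = (B ++ c' :: N) ++ d' :: Y by rewrite fs -catA.
  move=> /subc[h|h|h].
  - have /andP[/andP[h1 h2] _] := mst _ _ _ c d g h; have ge := inE0 g h.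
    split; first exact: selfe es h1.
    split; first exact: ofe.
    split; [exact: selfe es2 h2|exact: ofe].
  - have /andP[/andP[h1 h2] _] := mst _ _ _ c' d' g h; have gf := inF0 g h.
    split; first exact: oef.
    split; first exact: selff fs h1.
    split; [exact: oef|exact: selff fs2 h2].
  - by split; [exact: oth|split; [exact: otf|split; [exact: oth|exact: otf]]].
have ncd x y : x.1 = c.1 -> y.1 = d.1 -> apart x y && apart y x.
  by move=> h1 h2; rewrite /apart h1 h2 (eq_sym d.1) (negPf cd).
have io1 x : x \in st e -> x.2.1.2 != x.2.2.2 by move/(allP ioe).
have io2 x : x \in st f -> x.2.1.2 != x.2.2.2 by move/(allP iof).
rewrite /cost2 (perm_ncross _ P0) (perm_ncross _ P1).
(* The two cells are uncrossed one at a time; the intermediate list has new chords in the cell of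
   [d] only. *)
apply: ltn_trans (_ : (ncross [:: c, c', d1, d1' & L0] < _)%N).
  apply: ncross_uncross => //; [exact: oef|exact: io1|exact: io2|].
  move=> g; rewrite !in_cons => /predU1P[->|/predU1P[->|/Dcd[h1 [h2 _]]]] //.
    by split; [have /andP[] := ncd c d1 erefl erefl|have /andP[] := ncd c' d1 (esym cc1) erefl].
  by split; [have /andP[] := ncd c d1' erefl erefl|have /andP[] := ncd c' d1' (esym cc1) erefl].
have P2 (x y x' y' : chord) (L : seq chord) :
    perm_eq [:: x, x', y, y' & L] [:: y, y', x, x' & L].
  by apply/permP => P /=; clear; ring.
rewrite (perm_ncross _ (P2 _ _ _ _ _)) (perm_ncross _ (P2 c d c' d' L0)).
rewrite (_ : ncross [:: d1, d1', c, c' & L0] = ncross [:: d1', d1, c, c' & L0]); last first.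
  by apply: perm_ncross; apply/permP => P /=; clear; ring.
apply: ncross_uncross => //; [exact: oef|exact: io1|exact: io2|].
move=> g; rewrite !in_cons => /predU1P[->|/predU1P[->|/Dcd[_ [_ [h1 h2]]]]] //.
  by split; [have /andP[] := ncd c d erefl erefl|have /andP[] := ncd c d' erefl (esym dd1)].
by split; [have /andP[] := ncd c' d (esym cc1) erefl|have /andP[] := ncd c' d' (esym cc1) (esym dd1)].
Qed.

Lemma crosses_flipl a b : crosses (flip a) b = crosses a b.
Proof. by rewrite /crosses /= x4_flip. Qed.

Lemma crosses_flipr a b : crosses a (flip b) = crosses a b.
Proof. by rewrite /crosses /= x4_flip2. Qed.

Lemma ncross_flip S Z : ncross (map flip S ++ Z) = ncross (S ++ Z).
Proof.
rewrite /ncross !big_cat !big_map /=; congr (_ + _)%N; apply: eq_bigr => a _;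
  rewrite !big_cat !big_map /=; congr (_ + _)%N; apply: eq_bigr => b _;
  by rewrite ?crosses_flipl ?crosses_flipr.
Qed.

(** This serves edges that meet their two crossings in opposite orders; the symmetry of [endok]
    keeps the reversed strand valid. *)
Lemma rev_step st f : good st -> f \in E ->
  let st' := upd st f (rstrand (st f)) in
  [/\ good st', cost1 st' = cost1 st & cost2 st' = cost2 st].
Proof.
move=> gs fE st'; have [vE uE] := gs.
have st'f : st' f = rstrand (st f) by rewrite /st' /upd eqxx.
have st'o : {in E :\ f, st' =1 st}.
  by move=> x; rewrite !inE /st' /upd => /andP[/negPf ->].
have P1 : perm_eq (collect id E st') (map flip (st f) ++ collect id (E :\ f) st).
  apply: perm_trans (perm_collect _ _ fE) _.
  rewrite (collect_eq _ st'o) perm_cat2r st'f; apply/permPl; exact: perm_rev.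
split.
- split=> [x xE|].
    rewrite /st' /upd; case: eqP => [->|_]; last exact: vE.
    have /and4P[v1 v2 v3 v4] := vE f fE; apply/and4P; split.
    + by rewrite -size_eq0 size_rev size_map size_eq0.
    + by rewrite sorted_rstrand.
    + by rewrite fst_end_rev lst_end_rev endokC.
    + by rewrite all_rev all_map.
  rewrite -(perm_uniq (_ : perm_eq (collect idxs E st) _)) //.
  apply: perm_trans (perm_collect _ _ fE) _; rewrite perm_sym.
  apply: perm_trans (perm_collect _ _ fE) _.
  rewrite (collect_eq _ st'o) perm_cat2r st'f idxs_rev; last exact: valid_sorted.
  by apply/permPl; exact: perm_rev.
- rewrite /cost1 (perm_len P1) (perm_len (perm_collect _ _ fE)) /= !len_cat.
  by congr (_ + _)%N; rewrite /len big_map.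
- by rewrite /cost2 (perm_ncross _ P1) (perm_ncross _ (perm_collect _ _ fE)) ncross_flip.
Qed.

Definition minimal st := good st /\ forall st', good st' ->
  (cost1 st <= cost1 st')%N /\
  (cost1 st' = cost1 st -> (cost2 st <= cost2 st')%N).

Lemma arg_min_nat (T : Type) (P : T -> Prop) (f : T -> nat) x0 : P x0 ->
  exists x, P x /\ forall y, P y -> (f x <= f y)%N.
Proof.
move=> Px0; have ex : exists n, `[< exists2 x, P x & f x = n >].
  by exists (f x0); apply/asboolP; exists x0.
case: (ex_minnP ex) => n /asboolP[x Px <-] nmin; exists x; split=> // y Py.
by apply: nmin; apply/asboolP; exists y.
Qed.

Lemma exists_minimal st0 : good st0 -> exists st, minimal st.
Proof.
move=> /(arg_min_nat cost1)[st1 [g1 m1]].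
have [st [[g2 e2] m2]] :=
  @arg_min_nat _ (fun st => good st /\ cost1 st = cost1 st1) cost2 st1 (conj g1 erefl).
exists st; split=> // st' g'; split; first by rewrite e2; exact: m1.
by move=> e; apply: m2; rewrite e.
Qed.

Lemma nuniq_split (T T' : eqType) (h : T -> T') (s : seq T) : ~~ uniq (map h s) ->
  exists A c M d Z, s = A ++ c :: M ++ d :: Z /\ h c = h d.
Proof.
elim: s => //= a s IH; rewrite negb_and negbK => /orP[/mapP[d ds e]|/IH].
  by case/splitPr: ds => M Z; exists [::], a, M, d, Z.
by move=> [A [c [M [d [Z [-> e]]]]]]; exists (a :: A), c, M, d, Z.
Qed.

Lemma two_split (T : eqType) (s : seq T) c d : c \in s -> d \in s -> c != d ->
  exists A M Z, s = A ++ c :: M ++ d :: Z \/ s = A ++ d :: M ++ c :: Z.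
Proof.
elim: s => // a s IH; rewrite !inE => /predU1P[->|cs] /predU1P[->|ds] cd.
- by rewrite eqxx in cd.
- by case/splitPr: ds => M Z; exists [::], M, Z; left.
- by case/splitPr: cs => M Z; exists [::], M, Z; right.
- by have [A [M [Z [->|->]]]] := IH cs ds cd; exists (a :: A), M, Z; [left|right].
Qed.

Lemma replace_good st e s : good st -> e \in E -> valid e s -> uniq (idxs s) ->
  (forall i, i \in idxs s -> i \notin collect idxs (E :\ e) st) ->
  good (upd st e s).
Proof.
move=> [vE uE] eE vs us ds.
have o : {in E :\ e, upd st e s =1 st}.
  by move=> x; rewrite !inE /upd => /andP[/negPf ->].
split=> [x xE|].
  by rewrite /upd; case: eqP => [->//|_]; exact: vE.
rewrite (perm_uniq (perm_collect _ _ eE)) (collect_eq _ o) /upd eqxx.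
rewrite cat_uniq us; move: uE; rewrite (perm_uniq (perm_collect _ _ eE)) cat_uniq.
move=> /and3P[_ _ ->]; rewrite andbT; apply/hasPn => x xc.
by apply/negP => xs; move: (ds x xs); rewrite xc.
Qed.

Lemma cost1_upd st e s : e \in E ->
  (cost1 (upd st e s) + len (st e) = cost1 st + len s)%N.
Proof.
move=> eE; have o : {in E :\ e, upd st e s =1 st}.
  by move=> x; rewrite !inE /upd => /andP[/negPf ->].
rewrite /cost1 !(perm_len (perm_collect _ _ eE)) !len_cat (collect_eq _ o).
by rewrite /upd eqxx /=; ring.
Qed.

Lemma minimal_len st e s : minimal st -> e \in E -> valid e s -> uniq (idxs s) ->
  (forall i, i \in idxs s -> i \notin collect idxs (E :\ e) st) ->
  (len (st e) <= len s)%N.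
Proof.
move=> [gs ms] eE vs us ds.
have [+ _] := ms _ (replace_good gs eE vs us ds).
by have := cost1_upd st s eE; lia.
Qed.

(** Two visits to one cell could be joined by a single chord from the first entry to the last exit;
    the part cut out has positive length. *)
Lemma minimal_simple st e : minimal st -> e \in E ->
  uniq [seq a.1 | a : chord <- st e].
Proof.
move=> mst eE; apply: contraT => /nuniq_split[A [c [M [d [Z [es cd]]]]]].
have [gs _] := mst; have [vE _] := gs.
pose x : chord := (c.1, (c.2.1, d.2.2)); pose s := A ++ x :: Z.
have /and4P[v1 v2 v3 v4] := vE e eE; rewrite es in v1 v2 v3 v4.
have vs : valid e s.
  apply/and4P; split; first by rewrite /s; case: (A).
  - move: v2; rewrite !sorted_cat_cons path_cat_cons => /and3P[h1 _ h2].
    by rewrite (@sorted_rcons_eq A c x) // h1 (@path_eq Z d x) //.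
  - move: v3; congr endok; rewrite /s; first by case: (A).
    have -> : A ++ c :: M ++ d :: Z = (A ++ c :: M) ++ d :: Z by rewrite -catA.
    case/lastP: (Z) => [|K z]; first by rewrite !cats1 !lst_end_rcons /x /= cd.
    by rewrite -!rcons_cons -!rcons_cat !lst_end_rcons.
  - by move: v4; rewrite /s !all_cat /= !all_cat /= => /and5P[-> -> _ _ ->].
have sub : subseq (idxs s) (idxs (st e)).
  rewrite es /s; have [h [-> ->]] := @idxs_cat_cons A c (M ++ d :: Z) x Z erefl.
  rewrite /= eqxx !map_cat /= !map_cat /= cat_subseq //.
  rewrite -cat1s -[X in subseq _ X]cat_cons -cat_rcons -cat1s cat_subseq //.
    rewrite -cats1; apply: subseq_trans (suffix_subseq _ _) => //=.
    by rewrite /x /= eqxx.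
have us : uniq (idxs s) by apply: subseq_uniq sub _; exact: idxs_uniq.
have ds i : i \in idxs s -> i \notin collect idxs (E :\ e) st.
  move=> /(mem_subseq sub) ie; apply/negP => /mem_collect[f].
  rewrite !inE => /andP[fe fE] fi.
  have ef : e != f by rewrite eq_sym.
  by have := idxs_disj gs eE fE ef ie; rewrite fi.
have := minimal_len mst eE vs us ds; rewrite es /s.
rewrite !(len_cat, len_cons) /=; have := ell_gt0 d.1; clear.
move: (len A) (len Z) (len M) (ell c.1) (ell d.1) => a z m c1 d1 h1 h2; exfalso; lia.
Qed.

(** Two crossings lie in different cells by [minimal_simple]. After a reversal of [f] if necessary,
    [swap_step] would lower the number of crossings at equal length. *)
Lemma minimal_once st e f c d c' d' : minimal st -> e \in E -> f \in E -> e != f ->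
  c \in st e -> d \in st e -> c' \in st f -> d' \in st f ->
  crosses c c' -> crosses d d' -> c = d.
Proof.
move=> mst eE fE ef; wlog : c d c' d' / exists A M Z, st e = A ++ c :: M ++ d :: Z.
  move=> H ce de cf df cc dd; have [//|cd] := eqVneq c d.
  have [A [M [Z [h|h]]]] := two_split ce de cd.
    by apply: (H c d c' d') => //; exists A, M, Z.
  by apply/esym; apply: (H d c d' c') => //; exists A, M, Z.
move=> [A [M [Z es]]] ce de cf df cc dd; exfalso.
have [gs ms] := mst.
have cd : c.1 != d.1.
  have := minimal_simple mst eE; rewrite es !map_cat /= !map_cat /=.
  rewrite cat_uniq => /and3P[_ _ /= /andP[+ _]].
  by apply: contra => /eqP ->; rewrite mem_cat mem_head orbT.
have cd' : c' != d'.
  apply: contra cd => /eqP e'; move: cc dd => /andP[/eqP -> _] /andP[/eqP -> _].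
  by rewrite e'.
have [B [N [Y [fs|fs]]]] := two_split cf df cd'.
  have [st' [g' c1 c2]] := swap_step gs eE fE ef es fs cc dd cd.
  by have [_ /(_ c1)] := ms st' g'; rewrite leqNgt c2.
have [gr r1 r2] := rev_step gs fE; set st2 := upd _ _ _ in gr r1 r2.
have es2 : st2 e = A ++ c :: M ++ d :: Z by rewrite /st2 /upd (negPf ef).
have fs2 : st2 f = rstrand Y ++ flip c' :: rstrand N ++ flip d' :: rstrand B.
  rewrite /st2 /upd eqxx fs /rstrand !map_cat /= !map_cat /= !rev_cat /= !rev_cons.
  by rewrite rev_cat rev_cons -!cats1 -!catA.
have cc2 : crosses c (flip c') by rewrite crosses_flipr.
have dd2 : crosses d (flip d') by rewrite crosses_flipr.
have [st' [g' c1 c2]] := swap_step gr eE fE ef es2 fs2 cc2 dd2 cd.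
by have [_] := ms st' g'; rewrite c1 r1 => /(_ erefl); rewrite leqNgt -r2 c2.
Qed.

End Minimal.

(** * Routing the edges along strings *)

Definition sd (c x : cell) : side :=
  if c.2 == x.2 then (true, x.1 == c.1 + 1) else (false, x.2 == c.2 + 1).

Lemma nb_sd c x : adj c x -> nb c (sd c x) = x.
Proof.
case: c => a b.
have e1 (z : int) : (z - 1 == z + 1) = false by apply/negP => /eqP; lia.
have e2 (z : int) : (z == z + 1) = false by apply/negP => /eqP; lia.
have e3 (z : int) : (z == z - 1) = false by apply/negP => /eqP; lia.
by move=> /adjP /= [] ->; rewrite /sd /nb /= ?eqxx ?e1 ?e2 ?e3 /= ?eqxx ?e1.
Qed.

Lemma nb_inj c : injective (nb c).
Proof.
by case: c => a b [[] []] [[] []] // [] *; exfalso; lia.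
Qed.

Lemma sd_opp c x : adj c x -> sd x c = opp (sd c x).
Proof.
move=> cx; have h1 := nb_sd cx; rewrite adjC in cx; have h2 := nb_sd cx.
by apply: (@nb_inj x); rewrite h2 -{1}h1 nb_opp.
Qed.

Lemma adj_nb c k : adj c (nb c k).
Proof.
by case: c k => a b [[] []]; rewrite /adj /nb /= ?eqxx ?subrK ?eqxx ?orbT.
Qed.

(** Here [x] is the cell before [c]. Neither [x] nor the last cell of [t] receives a chord: they
    only determine the sides through which the strand enters and leaves. *)
Fixpoint route (phi : nat -> nat) (k : nat) (x c : cell) (t : seq cell) : seq chord :=
  if t is y :: t' then
    (c, ((sd c x, phi k), (sd c y, phi k.+1))) :: route phi k.+1 c y t'
  else [::].

Lemma route_link phi k x c t : adj x c -> path adj c t -> sorted link (route phi k x c t).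
Proof.
elim: t k x c => // y t IH k x c xc /= /andP[cy pt].
have := IH k.+1 c y cy pt; case: t pt {IH} => //= z t _ ->; rewrite andbT.
by rewrite /link /= nb_sd // sd_opp // !eqxx.
Qed.

Lemma route_cells phi k x c t : [seq a.1 | a <- route phi k x c t] = belast c t.
Proof. by elim: t k x c => //= y t IH k x c; rewrite IH. Qed.

Lemma route_idxs phi k x c y t :
  idxs (route phi k x c (y :: t)) = [seq phi i | i <- iota k (size t).+2].
Proof.
rewrite /=; congr (_ :: _ :: _).
elim: t k c y => //= z t IH k c y; congr (_ :: _); exact: IH.
Qed.

Lemma route_fst phi k x c y t :
  fst_end (route phi k x c (y :: t)) = (c, (sd c x, phi k)).
Proof. by []. Qed.

Lemma route_lst phi k x c t z : exists i,
  lst_end (route phi k x c (rcons t z)) = (last c t, (sd (last c t) z, i)).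
Proof.
elim: t k x c => [|y t IH] k x c /=; first by exists (phi k.+1).
have [i] := IH k.+1 c y; case: t {IH} => [|w t] /= e.
  by exists i; move: e => [->].
by exists i; rewrite -e.
Qed.

Section Routing.
Context (R : realFieldType) (pos : port -> R).
Hypothesis pos_inj : forall p p', pos p = pos p' -> p.2 = p'.2.
Context (I : finType) (E : {set I}) (W : I -> seq cell) (x0 xn : I -> cell).
Context (lev : I -> nat).
Hypothesis HW : forall e, e \in E -> [/\ linked (W e),
  adj (x0 e) (head (0, 0) (W e)) & adj (last (0, 0) (W e)) (xn e)].

Definition on_strings (p : cell) : bool := [exists g in E, p \in W g].

Definition ends_at (c x : cell) (y : cell * port) : bool :=
  (y.1 == c) && (nb y.1 y.2.1 == x).

Definition right_ends (e : I) : rel (cell * port) := fun x y =>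
  let h := head (0, 0) (W e) in let l := last (0, 0) (W e) in
  (ends_at h (x0 e) x && ends_at l (xn e) y) ||
  (ends_at h (x0 e) y && ends_at l (xn e) x).

(** As a base it exceeds the size of every [W e]. *)
Let Z : nat := (\sum_(e in E) size (W e)).+2.
Let levc (p : cell) : nat := \max_(g in E | p \in W g) lev g.
Let mx : nat := \max_(g in E) lev g.
(* A strand entering a single cell that carries only strings below the level of
   e already costs more than the whole of W e. *)
Let ell (p : cell) : nat := (Z ^ (mx - levc p))%N.

Let ell_gt0 c : (0 < ell c)%N. Proof. by rewrite expn_gt0. Qed.

Let right_endsC e x y : right_ends e x y = right_ends e y x.
Proof. by rewrite /right_ends orbC. Qed.

Let strand (phi : nat -> nat) (e : I) : seq chord :=
  route phi 0 (x0 e) (head (0, 0) (W e)) (rcons (behead (W e)) (xn e)).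

Let strandP phi e : e \in E -> injective phi ->
  [/\ valid on_strings right_ends e (strand phi e),
      [seq a.1 | a <- strand phi e] = W e,
      uniq (idxs (strand phi e)) &
      forall i, i \in idxs (strand phi e) -> exists k, i = phi k].
Proof.
move=> eE inj; have [lW h0 hn] := HW eE; rewrite /strand.
case EW: (W e) lW h0 hn => [|c w] //= pw h0 hn.
have cells : [seq a.1 | a <- route phi 0 (x0 e) c (rcons w (xn e))] = c :: w.
  by rewrite route_cells belast_rcons.
have idx : exists y t, rcons w (xn e) = y :: t.
  by case: (w) => [|y t] /=; [exists (xn e), [::]|exists y, (rcons t (xn e))].
split=> //.
- apply/and4P; split.
  + by have [y [t ->]] := idx.
  + by apply: route_link => //; rewrite rcons_path pw.
  + have [i ->] := route_lst phi 0 (x0 e) c w (xn e); have [y [t ->]] := idx.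
    rewrite route_fst /right_ends /ends_at EW /= !eqxx /=.
    by have h0' := h0; rewrite adjC in h0'; rewrite (nb_sd h0') (nb_sd hn) !eqxx.
  + have : all on_strings [seq a.1 | a <- route phi 0 (x0 e) c (rcons w (xn e))].
      rewrite cells -EW; apply/allP => p pe; apply/existsP; exists e.
      by rewrite eE.
    by rewrite all_map.
- have [y [t ->]] := idx; rewrite route_idxs map_inj_uniq //; exact: iota_uniq.
- by have [y [t ->]] := idx; rewrite route_idxs => i /mapP[k _ ->]; exists k.
Qed.

Let good0 : exists st, good E on_strings right_ends st.
Proof.
(* [K] exceeds every rank, so the remainder modulo [K] recovers the edge and the quotient the
   position: no index is used twice. *)
pose K := #|I|.+1; pose phi (e : I) k := (k * K + enum_rank e)%N.
have rk (e : I) : (enum_rank e < K)%N by rewrite ltnS ltnW ?ltn_ord.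
have inj2 e e' k k' : phi e k = phi e' k' -> e = e' /\ k = k'.
  move=> h; have hm := congr1 (fun n => n %% K)%N h.
  have hd := congr1 (fun n => n %/ K)%N h.
  rewrite /phi !modnMDl !modn_small // in hm.
  rewrite /phi !divnMDl // !(divn_small (rk _)) !addn0 in hd.
  by split=> //; apply/enum_rank_inj/val_inj.
have inj e : injective (phi e) by move=> k k' /inj2[].
exists (fun e => strand (phi e) e); split.
  by move=> e eE; case: (strandP eE (inj e)).
rewrite /collect.
have: {subset enum E <= E} by move=> x; rewrite mem_enum.
have: uniq (enum E) by exact: enum_uniq.
elim: (enum E) => //= e s IH /andP[es us] sE.
have eE : e \in E by apply: sE; exact: mem_head.
have [_ _ ue ie] := strandP eE (inj e).
rewrite cat_uniq ue IH // ?andbT; last by move=> x xs; apply: sE; rewrite inE xs orbT.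
apply/hasPn => x /flatten_mapP[f fs xf]; apply/negP => /= xe.
have fE : f \in E by apply: sE; rewrite inE fs orbT.
have [_ _ _ if'] := strandP fE (inj f).
have [k hk] := ie x xe; have [k' hk'] := if' x xf.
have [ef _] := inj2 e f k k' (etrans (esym hk) hk').
by move: es; rewrite ef fs.
Qed.

(** The last clause is where the levels act: a strand that strays to cells with only lower strings
    costs more than the direct route along [W e], and what is left is a connected sequence of
    strings of level at least [lev e]. *)
Lemma routing : exists st, [/\ good E on_strings right_ends st,
  (forall e, e \in E -> uniq [seq a.1 | a : chord <- st e]),
  (forall e f c d c' d', e \in E -> f \in E -> e != f ->
    c \in st e -> d \in st e -> c' \in st f -> d' \in st f ->
    crosses pos c c' -> crosses pos d d' -> c = d) &
  (forall e (a : chord), e \in E -> a \in st e ->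
    exists2 g, g \in lcomp W E lev e & a.1 \in W g)].
Proof.
have [st00 g0] := good0.
have [st mst] := exists_minimal pos ell g0; exists st.
have [gs _] := mst; split=> //.
- by move=> e; exact: minimal_simple mst.
- move=> e f c d c' d'; exact: (minimal_once pos_inj ell_gt0 right_endsC mst).
move=> e a0 eE ae0; have [vE _] := gs.
have {}mst := mst; pose S := [set v in E | lev e <= lev v]%N.
have eS : e \in S by rewrite inE eE /=.
have low a : a \in st e -> exists2 g, g \in S & a.1 \in W g.
  move=> ae; apply: contrapT => no.
  (* [B] exceeds all indices of the other strands, which gives fresh indices for the competing route
     along [W e]. *)
  have [B HB] : exists B, forall i, i \in collect idxs (E :\ e) st -> (i < B)%N.
    elim: (collect _ _ _) => [|i s [B IH]]; first by exists 0%N.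
    exists (maxn i.+1 B) => j; rewrite inE => /predU1P[->|/IH jB].
      by rewrite leq_max leqnn.
    by rewrite leq_max jB orbT.
  have inj : injective (fun k => k + B)%N by move=> k k' /addIn.
  have [vs cells us ix] := strandP eE inj.
  have fresh i : i \in idxs (strand (fun k => k + B)%N e) ->
      i \notin collect idxs (E :\ e) st.
    move=> /ix[k ->]; apply/negP => /HB; rewrite ltnNge leq_addl //.
  have := minimal_len mst eE vs us fresh; rewrite leqNgt => /negP; apply.
  have -> : len ell (strand (fun k => k + B)%N e) = (\sum_(p <- W e) ell p)%N.
    by rewrite -cells big_map.
  have up : (\sum_(p <- W e) ell p <= size (W e) * Z ^ (mx - lev e))%N.
    rewrite -sum1_size big_distrl /= [leqRHS]big_seq big_seq; apply: leq_sum => p pW; rewrite mul1n.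
    rewrite leq_pexp2l // leq_sub2l //.
    by apply: (leq_bigmax_cond (F := lev)); rewrite eE.
  have dn : (ell a.1 <= len ell (st e))%N.
    by rewrite /len (big_rem a) //= leq_addr.
  apply: leq_ltn_trans up _; apply: leq_trans dn.
  have lt : (levc a.1 < lev e)%N.
    rewrite ltnNge; apply/negP => le.
    (* At level 0 the cost is no help, since a cell off all strings also has [levc] 0 as an empty
       maximum; there validity supplies a string. *)
    have [/eqP h0|h0] := posnP (lev e).
      have /and4P[_ _ _ /allP/(_ a ae)] := vE e eE.
      move=> /existsP[g /andP[gE ga]]; apply: no; exists g => //.
      by rewrite inE gE (eqP h0).
    have : (lev e <= levc a.1)%N by [].
    rewrite leqNgt => /negP; apply; rewrite /levc -(prednK h0) ltnS.
    apply/bigmax_leqP => g /andP[gE ga]; rewrite -ltnS prednK // ltnNge.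
    by apply/negP => gl; apply: no; exists g; rewrite // inE gE.
  have le : (lev e <= mx)%N by apply: leq_bigmax_cond.
  apply: leq_trans (_ : Z ^ (mx - lev e).+1 <= _)%N; last first.
    by rewrite leq_pexp2l //; lia.
  rewrite expnS ltn_mul2r expn_gt0 /= /Z ltnS.
  by rewrite (bigD1 e) //= -addSn; apply: leq_trans (leq_addr _ _).
(* Consecutive chords lie in adjacent cells, so strings that carry them touch. The strand starts on
   a cell of [W e], whichever its orientation, and induction keeps all these strings in the
   component of [e]. *)
suff H s h : sorted link s -> {subset s <= st e} -> h \in comp W S e ->
    (s != [::] -> (fst_end s).1 \in W h) ->
    forall a g, a \in s -> g \in S -> a.1 \in W g -> g \in comp W S e.
  have [g gS ag] := low a0 ae0; exists g => //.
  have /and4P[n0 so ri _] := vE e eE.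
  have [l0 l1 l2] := HW eE.
  have hW : head (0, 0) (W e) \in W e by case: (W e) l0 => //= c w _; exact: mem_head.
  have lW : last (0, 0) (W e) \in W e by case: (W e) l0 => //= c w _; exact: mem_last.
  apply: (H (st e) e) ae0 gS ag => //; first exact: comp_id.
  move=> _; case/orP: ri => /andP[/andP[/eqP h1 _] /andP[/eqP h2 _]].
    by rewrite h1.
  by rewrite h2.
elim: s h => // a s IH h so ss hC hW b g.
have hW' : a.1 \in W h by apply: hW.
have tcI u v p q : p \in W u -> q \in W v -> touch p q -> tc W u v.
  by move=> pu qv t; apply/hasP; exists p => //; apply/hasP; exists q.
have cC u v : u \in comp W S e -> v \in S -> tc W u v -> v \in comp W S e.
  move=> uC vS t; rewrite -(comp_eq uC) inE vS connect1 //.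
  by rewrite /rin /= (subsetP (comp_sub W S e) u uC) vS.
have aC g' : g' \in S -> a.1 \in W g' -> g' \in comp W S e.
  move=> gS ag; apply: (cC h) => //; apply: (tcI _ _ a.1 a.1) => //.
  by rewrite /touch eqxx.
rewrite inE => /predU1P[->|bs]; first exact: aC.
case: s so ss IH bs {hW} => // x s /= /andP[ax ps] ss IH bs.
have xst : x \in st e by apply: ss; rewrite !inE eqxx orbT.
have [g1 g1S xg1] := low x xst.
apply: (IH g1) bs => //.
- by move=> y ys; apply: ss; rewrite inE ys orbT.
- have [g2 g2S ag2] := low a (ss a (mem_head _ _)).
  apply: (cC g2) => //; first exact: aC.
  apply: tcI ag2 xg1 _; rewrite /touch; case/and3P: ax => /eqP -> _ _.
  by rewrite adj_nb orbT.
Qed.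

End Routing.

(** * Points in general position on the sides of cells *)

Section LocalGeometry.
Context (R : realFieldType).
Implicit Types (a b c d z : R * R) (t s x y : R).

Definition det a b c : R := (b.1 - a.1) * (c.2 - a.2) - (b.2 - a.2) * (c.1 - a.1).

Definition mix a b t : R * R := (a.1 + t * (b.1 - a.1), a.2 + t * (b.2 - a.2)).

Lemma mix0 a b : mix a b 0 = a.
Proof. by case: a => u v; rewrite /mix /= !mul0r !addr0. Qed.

Lemma mix1 a b : mix a b 1 = b.
Proof. by case: a b => u v [u' v']; rewrite /mix /= !mul1r !subrKC. Qed.

Lemma mixC a b t : mix a b t = mix b a (1 - t).
Proof. by rewrite /mix; congr (_, _); ring. Qed.

Lemma det_mix a b t : det a b (mix a b t) = 0.
Proof. by rewrite /det /mix /=; ring. Qed.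

Lemma det_mix2 a b c d t :
  det a b (mix c d t) = (1 - t) * det a b c + t * det a b d.
Proof. by rewrite /det /mix /=; ring. Qed.

Lemma same_side_disjoint a b c d t s : det a b c != 0 -> det a b d != 0 ->
  (det a b c < 0) = (det a b d < 0) -> 0 <= s <= 1 -> mix a b t <> mix c d s.
Proof.
move=> c0 d0 cd s01 e; have := det_mix a b t; rewrite e det_mix2 => H.
move: cd; case: ltgtP c0 => // c0 _; case: ltgtP d0 => // d0 _ _; nra.
Qed.

(** The determinant is affine along the second line and not constantly 0 there, so it vanishes for
    one parameter at most. *)
Lemma two_points a b c d t s t' s' : det a b c != 0 ->
  mix a b t = mix c d s -> mix a b t' = mix c d s' -> s = s'.
Proof.
move=> c0 e e'.
have H : (1 - s) * det a b c + s * det a b d = 0 by rewrite -det_mix2 -e det_mix.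
have H' : (1 - s') * det a b c + s' * det a b d = 0 by rewrite -det_mix2 -e' det_mix.
apply/eqP; rewrite -subr_eq0; apply/negPn/negP => ss.
have : (s - s') * (det a b d - det a b c) = 0 by rewrite -[RHS](subrr 0) -{1}H -H'; ring.
move/eqP; rewrite mulf_eq0 (negPf ss) subr_eq0 => /eqP dd.
by move: H; rewrite dd => H; move/eqP: c0; apply; rewrite -H; ring.
Qed.

Lemma mix_inj a b t t' : a != b -> mix a b t = mix a b t' -> t = t'.
Proof.
have H (u u' : R) : u != u' -> u + t * (u' - u) = u + t' * (u' - u) -> t = t'.
  move=> uu /addrI/eqP; rewrite -subr_eq0 -mulrBl mulf_eq0 !subr_eq0.
  by rewrite (eq_sym u') (negPf uu) orbF => /eqP.
case: a b => u v [u' v']; rewrite xpair_eqE negb_and /mix /= => ne [e1 e2].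
by case/orP: ne => ne; [exact: H e1|exact: H e2].
Qed.

(* The boundary point with offset x on side k of the unit square, and its
   position along the boundary traversed counterclockwise. *)
Definition lpt (k : side) (x : R) : R * R :=
  if k.1 then ((k.2 : nat)%:R, x) else (x, (k.2 : nat)%:R).

Definition bpos (k : side) (x : R) : R :=
  if k.1 then (if k.2 then 1 + x else 4 - x) else (if k.2 then 3 - x else x).

Definition srank (k : side) : nat :=
  if k.1 then (if k.2 then 1 else 3) else (if k.2 then 2 else 0).

(** [k.1 == k.2] holds for the lower and right sides, where the offset grows counterclockwise; on
    the other two it decreases. *)
Lemma bpos_lt k l x y : 0 < x < 1 -> 0 < y < 1 -> (bpos k x < bpos l y) =
  if k == l then (if k.1 == k.2 then x < y else y < x) else (srank k < srank l)%N.
Proof.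
move=> /andP[x0 x1] /andP[y0 y1].
case: k l => [[] []] [[] []]; rewrite /bpos /srank /=;
  first [by apply/idP/idP; lra | by apply/negbTE; rewrite -leNgt; lra | by lra].
Qed.

(** For three points on the boundary of a convex region, orientation is cyclic order; the right side
    is the parity of the inversions in the counterclockwise order. This ties the combinatorial
    [crosses] to actual segments. *)
Lemma det_sign k k' l x x' y : 0 < x < 1 -> 0 < x' < 1 -> 0 < y < 1 ->
  k != k' -> x != y -> x' != y ->
  let D := det (lpt k x) (lpt k' x') (lpt l y) in
  D != 0 /\ (D < 0) = ((bpos k x < bpos l y) (+) (bpos k' x' < bpos l y)
                        (+) (bpos k' x' < bpos k x)).
Proof.
move=> x01 x'01 y01 kk xy x'y D; rewrite !bpos_lt //.
suff: if (if k == l then (if k.1 == k.2 then x < y else y < x) else (srank k < srank l)%N)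
      (+) (if k' == l then (if k'.1 == k'.2 then x' < y else y < x')
           else (srank k' < srank l)%N)
      (+) (if k' == k then (if k'.1 == k'.2 then x' < x else x < x')
           else (srank k' < srank k)%N) then D < 0 else 0 < D.
  by case: ifP => _ h; rewrite ?(lt_eqF h) ?(gt_eqF h) ?h // ltNge (ltW h).
rewrite /D {D}; move: x01 x'01 y01 => /andP[x0 x1] /andP[x'0 x'1] /andP[y0 y1].
case: k k' l kk => [[] []] [[] []] [[] []] //= _; rewrite /lpt /det /srank /=;
  first [by nra | by case: (ltgtP x y) xy => //= h _; nra
        | by case: (ltgtP x' y) x'y => //= h _; nra].
Qed.

End LocalGeometry.

From mathcomp Require Import classical_sets.

Section Generic.
Context (R : realFieldType).
Implicit Types (x y t s : R) (k : side).

Definition concurrent k1 x1 k2 x2 k3 x3 k4 x4 k5 x5 k6 x6 : Prop :=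
  exists t s r : R, [/\ 0 < t < 1, 0 < s < 1, 0 < r < 1,
    mix (lpt k1 x1) (lpt k2 x2) t = mix (lpt k3 x3) (lpt k4 x4) s &
    mix (lpt k1 x1) (lpt k2 x2) t = mix (lpt k5 x5) (lpt k6 x6) r].

Lemma avoid_seq (s : seq R) (a b : R) : a < b ->
  exists x, [/\ a < x, x < b & x \notin s].
Proof.
elim: s a b => [|y s IH] a b ab.
  by exists ((a + b) / 2); split=> //; lra.
have [yl|yg] := ltP y ((a + b) / 2).
  have [|x [h1 h2 h3]] := IH ((a + b) / 2) b; first by lra.
  exists x; split; [lra|lra|]; rewrite inE negb_or h3 andbT.
  by apply/negP => /eqP; lra.
have [|x [h1 h2 h3]] := IH a ((a + b) / 2); first by lra.
exists x; split; [lra|lra|]; rewrite inE negb_or h3 andbT.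
by apply/negP => /eqP; lra.
Qed.

Lemma inside k k' x x' t : k != k' -> 0 < x < 1 -> 0 < x' < 1 -> 0 < t < 1 ->
  let z := mix (lpt k x) (lpt k' x') t in
  [&& 0 < z.1, z.1 < 1, 0 < z.2 & z.2 < 1].
Proof.
move=> kk /andP[x0 x1] /andP[x'0 x'1] /andP[t0 t1] /=.
have H (u v : R) : 0 <= u <= 1 -> 0 <= v <= 1 -> (0 < u) || (0 < v) ->
    (u < 1) || (v < 1) -> (0 < u + t * (v - u)) && (u + t * (v - u) < 1).
  move=> /andP[u0 u1] /andP[v0 v1] /orP[] h1 /orP[] h2; apply/andP; split; nra.
rewrite andbA; apply/andP; split; apply: H;
  by case: k kk => [[] []]; case: k' => [[] []] //= _;
     rewrite ?ler01 ?lexx ?ltr01 ?x0 ?x1 ?x'0 ?x'1 ?(ltW x0) ?(ltW x1) ?(ltW x'0) ?(ltW x'1) ?orbT.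
Qed.

(* For fixed other endpoints at most one position of the moving endpoint makes
   the three chords concurrent. *)
Definition bad_pos k1 k2 x2 k3 x3 k4 x4 k5 x5 k6 x6 : set R :=
  [set x | [/\ 0 < x < 1, 0 < x2 < 1, 0 < x3 < 1, 0 < x4 < 1 & 0 < x5 < 1] /\
    [/\ k1 != k2, k3 != k4, x3 != x5, x4 != x5 &
     concurrent k1 x k2 x2 k3 x3 k4 x4 k5 x5 k6 x6]].

(** The second and third chords have at most one common point, as [lpt k5 x5] is off the second
    line. The line from [lpt k2 x2] through that point, which is interior, meets side [k1] at most
    once. *)
Lemma bad_pos_uniq k1 k2 x2 k3 x3 k4 x4 k5 x5 k6 x6 x x' :
  bad_pos k1 k2 x2 k3 x3 k4 x4 k5 x5 k6 x6 x ->
  bad_pos k1 k2 x2 k3 x3 k4 x4 k5 x5 k6 x6 x' -> x = x'.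
Proof.
move=> [[x01 h2 h3 h4 h5] [k12 k34 x35 x45 [t [s [r [t01 s01 r01 e1 e2]]]]]].
move=> [[x'01 _ _ _ _] [_ _ _ _ [t' [s' [r' [t'01 s'01 r'01 e1' e2']]]]]].
have [D0 _] := det_sign k5 h3 h4 h5 k34 x35 x45.
have rr : r = r'.
  by apply: (two_points (t := s) (t' := s') (d := lpt k6 x6) D0);
    [rewrite -e1; exact: e2|rewrite -e1'; exact: e2'].
subst r'; have e3 : mix (lpt k1 x) (lpt k2 x2) t = mix (lpt k1 x') (lpt k2 x2) t'.
  by rewrite e2 e2'.
have in1 := inside k12 x01 h2 t01; move: e3 in1 t01 t'01 {e1 e2 e1' e2'}.
set z := mix (lpt k1 x) _ t => e3 in1 /andP[t0 t1] /andP[t'0 t'1].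
have tt : t = t'.
  move: e3 in1; rewrite /z /mix /lpt; case: k1 {k12 z} => [[] []] /=;
  by case=> e3 e4 /and4P[h6 h7 h8 h9]; nra.
subst t'; move: e3; rewrite /z /mix; case: (lpt k2 x2) => w1 w2.
rewrite /lpt => -[e3 e4].
have E : (1 - t) * x = (1 - t) * x'.
  by move: e3 e4; case: (k1.1) => /= e3 e4; [move: e4|move: e3] => e; lra.
by apply: mulfI E; rewrite subr_eq0 gt_eqF.
Qed.

Fixpoint words (T : Type) (m : nat) (s : seq T) : seq (seq T) :=
  if m is m'.+1 then [seq u :: w | u <- s, w <- words m' s] else [:: [::]].

Lemma mem_words (T : eqType) (s w : seq T) : {subset w <= s} -> w \in words (size w) s.
Proof.
elim: w => [|x w IH] sub /=; first by rewrite inE.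
apply/allpairsP; exists (x, w); split=> //; first by apply: sub; exact: mem_head.
by apply: IH => y yw; apply: sub; rewrite inE yw orbT.
Qed.

Definition bad_of (ks : seq side) (xs : seq R) : set R :=
  let k i := nth (true, true) ks i in let x i := nth 0 xs i in
  bad_pos (k 0%N) (k 1%N) (x 0%N) (k 2%N) (x 1%N) (k 3%N) (x 2%N) (k 4%N) (x 3%N)
    (k 5%N) (x 4%N).

Definition sides : seq side :=
  [:: (true, true); (true, false); (false, true); (false, false)].

(** Every set [bad_of] has at most one element, so picking one from each captures all forbidden
    positions in a finite list; dummy picks only forbid a little more. *)
Definition bads (s : seq R) : seq R :=
  [seq xget 0 (bad_of ks xs) | ks <- words 6 sides, xs <- words 5 s].

Lemma mem_sides k : k \in sides.
Proof. by case: k => [[] []]. Qed.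

Lemma mem_bads (s : seq R) k1 k2 x2 k3 x3 k4 x4 k5 x5 k6 x6 x :
  {subset [:: x2; x3; x4; x5; x6] <= s} ->
  bad_pos k1 k2 x2 k3 x3 k4 x4 k5 x5 k6 x6 x -> x \in bads s.
Proof.
move=> sub bx; pose ks := [:: k1; k2; k3; k4; k5; k6].
pose xs := [:: x2; x3; x4; x5; x6].
have -> : x = xget 0 (bad_of ks xs).
  by case: xgetP => [y _ /(bad_pos_uniq bx) //|/(_ x)].
apply/allpairsP; exists (ks, xs); split=> //=.
  by apply: (@mem_words _ sides ks) => k _; exact: mem_sides.
exact: (@mem_words _ s xs).
Qed.

Lemma greedy_seq : exists q : nat -> R, [/\ forall i, 0 < q i < 1,
  forall i j, (j < i)%N -> q i != q j &
  forall n (s : seq R), {subset s <= [seq q j | j <- iota 0 n]} -> q n \notin bads s].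
Proof.
have H (s : seq R) : exists x, 0 < x < 1 /\ x \notin s.
  by have [x [h1 h2 h3]] := avoid_seq s (@ltr01 R); exists x; rewrite h1 h2.
have [pick pickP] := choice H.
pose seqs n := iter n (fun s : seq R => rcons s (pick (s ++ bads s))) [::].
have sz n : size (seqs n) = n by elim: n => //= n IH; rewrite size_rcons IH.
pose q n := pick (seqs n ++ bads (seqs n)).
have sE n : seqs n = [seq q j | j <- iota 0 n].
  elim: n => // n IH; rewrite -[n.+1]addn1 iotaD map_cat -IH /= add0n cats1.
  by rewrite addn1 /=.
have sub_bads (s s' : seq R) : {subset s <= s'} -> {subset bads s <= bads s'}.
  move=> ss y /allpairsP[[ks xs] /= [kW xW ->]]; apply/allpairsP; exists (ks, xs).
  split=> //; have W : forall m (w : seq R), w \in words m s -> w \in words m s'.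
    elim=> [|m IH] w //= /allpairsP[[x v] /= [xs' vW ->]].
    by apply/allpairsP; exists (x, v); split=> //=; [exact: ss|exact: IH].
  exact: (W 5 xs).
exists q; split=> [i|i j ji|n s sub].
- by have [] := pickP (seqs i ++ bads (seqs i)).
- have [_] := pickP (seqs i ++ bads (seqs i)); rewrite mem_cat negb_or => /andP[+ _].
  apply: contra => /eqP; rewrite -/(q i) => ->; rewrite sE; apply/mapP; exists j => //.
  by rewrite mem_iota.
- have [_] := pickP (seqs n ++ bads (seqs n)); rewrite mem_cat negb_or => /andP[_].
  by apply: contra; apply: sub_bads => x /sub; rewrite sE.
Qed.

Lemma mix_rev (a b c : R * R) t : 0 < t < 1 -> mix a b t = c ->
  exists2 t', 0 < t' < 1 & mix b a t' = c.
Proof.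
move=> t01 <-; exists (1 - t); last by rewrite -mixC.
by move: t01 => /andP[? ?]; apply/andP; split; lra.
Qed.

Lemma concurrent_rev k1 x1 k2 x2 k3 x3 k4 x4 k5 x5 k6 x6 :
  concurrent k1 x1 k2 x2 k3 x3 k4 x4 k5 x5 k6 x6 ->
  concurrent k2 x2 k1 x1 k3 x3 k4 x4 k5 x5 k6 x6.
Proof.
move=> [t [s [r [t01 s01 r01 e1 e2]]]].
have [t' t'01 h] := mix_rev t01 (erefl (mix (lpt k1 x1) (lpt k2 x2) t)).
by exists t', s, r; split; rewrite ?h.
Qed.

Lemma concurrent_rot k1 x1 k2 x2 k3 x3 k4 x4 k5 x5 k6 x6 :
  concurrent k1 x1 k2 x2 k3 x3 k4 x4 k5 x5 k6 x6 ->
  concurrent k3 x3 k4 x4 k5 x5 k6 x6 k1 x1 k2 x2.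
Proof.
move=> [t [s [r [t01 s01 r01 e1 e2]]]].
by exists s, r, t; split; rewrite -?e1 -?e2.
Qed.

(** Of the six indices the largest was chosen last and avoided all bad positions determined by the
    others. Reversing and rotating chords brings it to the front. *)
Lemma generic_seq : exists q : nat -> R, [/\ forall i, 0 < q i < 1, injective q &
  forall k1 i1 k2 i2 k3 i3 k4 i4 k5 i5 k6 i6, k1 != k2 -> k3 != k4 -> k5 != k6 ->
    uniq [:: i1; i2; i3; i4; i5; i6] ->
    ~ concurrent k1 (q i1) k2 (q i2) k3 (q i3) k4 (q i4) k5 (q i5) k6 (q i6)].
Proof.
have [q [q01 qlt qbad]] := greedy_seq.
have qinj : injective q.
  move=> i j ij; apply/eqP; case: ltngtP => // h; move: (qlt _ _ h);
  by rewrite ij eqxx.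
exists q; split=> //.
have qn i j : i != j -> q i != q j by apply: contra => /eqP/qinj ->.
have H k1 i1 k2 i2 k3 i3 k4 i4 k5 i5 k6 i6 : k1 != k2 -> k3 != k4 -> k5 != k6 ->
    uniq [:: i1; i2; i3; i4; i5; i6] ->
    all (fun j => j < i1)%N [:: i2; i3; i4; i5; i6] ->
    ~ concurrent k1 (q i1) k2 (q i2) k3 (q i3) k4 (q i4) k5 (q i5) k6 (q i6).
  move=> k12 k34 k56 u /allP lt cc.
  have sub : {subset [seq q j | j <- [:: i2; i3; i4; i5; i6]] <=
      [seq q j | j <- iota 0 i1]}.
    by move=> y /mapP[j /lt ji ->]; apply/map_f; rewrite mem_iota.
  move: (qbad i1 _ sub) => /negP; apply.
  apply: (@mem_bads _ k1 k2 (q i2) k3 (q i3) k4 (q i4) k5 (q i5) k6 (q i6)) => //.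
  have [n35 n45] : i3 != i5 /\ i4 != i5.
    by move: u; rewrite /= !inE !negb_or => /and5P[_ _ /and3P[_ ? _] /andP[? _] _].
  by split; split=> //; exact: qn.
move=> k1 i1 k2 i2 k3 i3 k4 i4 k5 i5 k6 i6 k12 k34 k56 u cc.
pose l := [:: i1; i2; i3; i4; i5; i6].
have [m ml mmax] : exists2 m, m \in l & forall j, j \in l -> (j <= m)%N.
  rewrite /l; move: [:: i2; i3; i4; i5; i6] => s.
  elim: s i1 {u cc l} => [|y s IH] x.
    by exists x => [|j]; rewrite inE // => /eqP ->.
  have [m ms mm] := IH y; have [xm|mx] := leqP x m.
    by exists m => [|j]; rewrite in_cons ?ms ?orbT // => /predU1P[->|/mm].
  exists x => [|j]; first by rewrite mem_head.
  by rewrite in_cons => /predU1P[->//|/mm jm]; exact: leq_trans jm (ltnW mx).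
have lt (s : seq nat) : uniq (m :: s) -> {subset s <= l} ->
    all (fun j => j < m)%N s.
  move=> /= /andP[ms _] sl; apply/allP => x xs.
  by rewrite ltn_neqAle mmax ?sl // andbT; apply: contraNneq ms => <-.
have k21 : k2 != k1 by rewrite eq_sym.
have k43 : k4 != k3 by rewrite eq_sym.
have k65 : k6 != k5 by rewrite eq_sym.
have fin ka ia kb ib kc ic kd id ke ie kf jf :
    concurrent ka (q ia) kb (q ib) kc (q ic) kd (q id) ke (q ie) kf (q jf) ->
    ka != kb -> kc != kd -> ke != kf ->
    perm_eq [:: ia; ib; ic; id; ie; jf] l -> m = ia -> False.
  move=> cc' h1 h2 h3 pe mi; apply: H cc' => //; first by rewrite (perm_uniq pe).
  rewrite -mi; apply: lt; first by rewrite mi (perm_uniq pe).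
  by move=> x xs; rewrite -(perm_mem pe) inE xs orbT.
have P (w : seq nat) : (forall n, count_mem n w = count_mem n l) -> perm_eq w l.
  by move=> h; apply/allP => n _; apply/eqP; exact: h.
move: ml; rewrite !inE => /orP[|/orP[|/orP[|/orP[|/orP[|]]]]] /eqP mi.
- by apply: (fin _ _ _ _ _ _ _ _ _ _ _ _ cc) => //; apply: P.
- apply: (fin _ _ _ _ _ _ _ _ _ _ _ _ (concurrent_rev cc)) => //.
  by apply: P => x /=; ring.
- apply: (fin _ _ _ _ _ _ _ _ _ _ _ _ (concurrent_rot cc)) => //.
  by apply: P => x /=; ring.
- apply: (fin _ _ _ _ _ _ _ _ _ _ _ _ (concurrent_rev (concurrent_rot cc))) => //.
  by apply: P => x /=; ring.
- apply: (fin _ _ _ _ _ _ _ _ _ _ _ _ (concurrent_rot (concurrent_rot cc))) => //.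
  by apply: P => x /=; ring.
- apply: (fin _ _ _ _ _ _ _ _ _ _ _ _
    (concurrent_rev (concurrent_rot (concurrent_rot cc)))) => //.
  by apply: P => x /=; ring.
Qed.

End Generic.

From mathcomp Require Import all_classical all_reals all_analysis.
Import numFieldNormedType.Exports.
Local Open Scope classical_set_scope.
Local Open Scope ring_scope.

(** * Realizing a routing by a drawing *)

Section Arcs.
Context (R : realType).
Implicit Types (A B : set (R * R)) (a b c z : R * R).

Lemma continuous_pairl (T : topologicalType) (f g : T -> R) :
  continuous f -> continuous g -> continuous (fun t => (f t, g t)).
Proof. by move=> cf cg t; exact: cvg_pair (cf t) (cg t). Qed.

Lemma continuous_fst (T : topologicalType) (f : T -> R * R) :
  continuous f -> continuous (fun t => (f t).1).
Proof. by move=> cf t; apply: cvg_comp (cf t) cvg_fst. Qed.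

Lemma continuous_snd (T : topologicalType) (f : T -> R * R) :
  continuous f -> continuous (fun t => (f t).2).
Proof. by move=> cf t; apply: cvg_comp (cf t) cvg_snd. Qed.

Definition is_arc A a b : Prop := exists g : R -> R * R,
  [/\ continuous g, {in `[0, 1] &, injective g}, g 0 = a, g 1 = b &
      g @` `[0, 1] = A].

Definition seg a b : set (R * R) := [set z | exists2 t, 0 <= t <= 1 & z = mix a b t].

Lemma continuous_aff (u v : R) : continuous (fun t : R => u + t * v).
Proof.
move=> t; apply: cvgD; first exact: cvg_cst.
by apply: cvgM; [exact: cvg_id|exact: cvg_cst].
Qed.

Lemma arc_seg a b : a != b -> is_arc (seg a b) a b.
Proof.
move=> ab; exists (mix a b); split; rewrite ?mix0 ?mix1 //.
- by apply: continuous_pairl; exact: continuous_aff.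
- by move=> t s _ _; exact: mix_inj.
- apply/seteqP; split=> z /=.
    by move=> [t]; rewrite in_itv /= => t01 <-; exists t.
  by move=> [t t01 ->]; exists t => //; rewrite in_itv.
Qed.

Lemma arc_cat A B a b c : is_arc A a b -> is_arc B b c ->
  (forall z, A z -> B z -> z = b) -> is_arc (A `|` B) a c.
Proof.
move=> [g [cg ig g0 g1 gA]] [h [ch ih h0 h1 hB]] AB.
(* The sum of two stopped arcs minus [b] is continuous without any gluing: the second rests at [b]
   up to time 1/2, the first from then on. *)
pose m (t : R) := Num.min (2 * t) 1; pose M (t : R) := Num.max (2 * t - 1) 0.
pose k t : R * R := ((g (m t)).1 + (h (M t)).1 - b.1, (g (m t)).2 + (h (M t)).2 - b.2).
have cm : continuous m.
  apply: min_fun_continuous; last by move=> t; exact: cvg_cst.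
  by move=> t; apply: cvgM; [exact: cvg_cst|exact: cvg_id].
have cM : continuous M.
  apply: max_fun_continuous; last by move=> t; exact: cvg_cst.
  move=> t; apply: cvgB; last exact: cvg_cst.
  by apply: cvgM; [exact: cvg_cst|exact: cvg_id].
have cgm : continuous (g \o m) by move=> t; apply: continuous_comp; [exact: cm|exact: cg].
have chM : continuous (h \o M) by move=> t; apply: continuous_comp; [exact: cM|exact: ch].
have kl t : t <= 2^-1 -> k t = g (2 * t).
  move=> tl; have e1 : m t = 2 * t by rewrite /m; apply/min_idPl; lra.
  have e2 : M t = 0 by rewrite /M; apply/max_idPr; lra.
  by rewrite /k e1 e2 h0 !addrK -surjective_pairing.
have kr t : 2^-1 <= t -> k t = h (2 * t - 1).
  move=> tl; have e1 : m t = 1 by rewrite /m; apply/min_idPr; lra.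
  have e2 : M t = 2 * t - 1 by rewrite /M; apply/max_idPl; lra.
  by rewrite /k e1 e2 g1 addrAC subrr add0r addrAC subrr add0r -surjective_pairing.
have gin t : 0 <= t <= 1 -> A (g t) by move=> t01; rewrite -gA; exists t; rewrite /= ?in_itv.
have hin t : 0 <= t <= 1 -> B (h t) by move=> t01; rewrite -hB; exists t; rewrite /= ?in_itv.
have iA s t : 0 <= s <= 1 -> 0 <= t <= 1 -> g s = g t -> s = t.
  by move=> s01 t01; apply: ig; rewrite in_itv.
have iB s t : 0 <= s <= 1 -> 0 <= t <= 1 -> h s = h t -> s = t.
  by move=> s01 t01; apply: ih; rewrite in_itv.
have mixed s t : 0 <= s <= 2^-1 -> 2^-1 < t <= 1 -> k s = k t -> False.
  move=> /andP[s0 s1] /andP[t0 t1]; rewrite kl // kr; last by lra.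
  move=> e; have hz : h (2 * t - 1) = b.
    apply: AB; last by apply: hin; lra.
    by rewrite -e; apply: gin; lra.
  have : 2 * t - 1 = 0 by apply: iB; rewrite ?hz ?h0 //; lra.
  lra.
exists k; split.
- apply: continuous_pairl => t; apply: cvgB; try exact: cvg_cst; apply: cvgD.
  + exact: (continuous_fst cgm).
  + exact: (continuous_fst chM).
  + exact: (continuous_snd cgm).
  + exact: (continuous_snd chM).
- move=> s t; rewrite !in_itv /= => /andP[s0 s1] /andP[t0 t1] e.
  have [sl|sr] := leP s 2^-1; have [tl|tr] := leP t 2^-1.
  + have : 2 * s = 2 * t by apply: iA; rewrite -?kl //; lra.
    lra.
  + by exfalso; apply: (mixed s t) => //; rewrite ?s0 ?sl ?tr.
  + by exfalso; apply: (mixed t s) => //; rewrite ?t0 ?tl ?sr.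
  + have : 2 * s - 1 = 2 * t - 1 by apply: iB; rewrite -?kr //; lra.
    lra.
- by rewrite kl ?mulr0 //; lra.
- have e1 : 2 * 1 - 1 = 1 :> R by ring.
  by rewrite kr ?e1 //; lra.
- apply/seteqP; split=> z /=.
    move=> [t]; rewrite in_itv /= => /andP[t0 t1] <-.
    have [tl|tr] := leP t 2^-1; [left|right].
      by rewrite kl //; apply: gin; lra.
    by rewrite kr; [apply: hin; lra|lra].
  move=> [|].
    rewrite -gA => -[t /=]; rewrite in_itv /= => /andP[t0 t1] <-.
    exists (t / 2); first by rewrite in_itv /=; lra.
    by rewrite kl; [congr g; lra|lra].
  rewrite -hB => -[t /=]; rewrite in_itv /= => /andP[t0 t1] <-.
  exists ((t + 1) / 2); first by rewrite in_itv /=; lra.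
  by rewrite kr; [congr h; lra|lra].
Qed.

Lemma arc_interior (g : R -> R * R) A : {in `[0, 1] &, injective g} ->
  g @` `[0, 1] = A -> g @` `]0, 1[ = [set z | [/\ A z, z <> g 0 & z <> g 1]].
Proof.
move=> ig gA.
have i01 (t : R) : 0 <= t <= 1 -> t \in `[0, 1] by rewrite in_itv.
apply/seteqP; split=> z /=.
  move=> [t]; rewrite in_itv /= => /andP[t0 t1] <-.
  have t01 : 0 <= t <= 1 by rewrite !ltW.
  split.
  - by rewrite -gA; exists t => //; rewrite /= in_itv /= !ltW.
  - move=> /ig e; have t00 : t = 0.
      by apply: e; rewrite in_itv /= ?(ltW t0) ?(ltW t1) ?lexx ?ler01.
    by move: t0; rewrite t00 ltxx.
  - move=> /ig e; have t00 : t = 1.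
      by apply: e; rewrite in_itv /= ?(ltW t0) ?(ltW t1) ?lexx ?ler01.
    by move: t1; rewrite t00 ltxx.
rewrite -gA => -[[t /=]]; rewrite in_itv /= => /andP[t0 t1] <- n0 n1.
exists t => //; rewrite in_itv /= !lt_neqAle t0 t1 !andbT.
by apply/andP; split; apply/eqP => e; [apply: n0; rewrite -e|apply: n1; rewrite e].
Qed.

End Arcs.

(** * Charts at transversal crossings *)

Section Chart.
Context (R : realType).

(** [phi] squeezes the line homeomorphically onto the interval from -1 to 1, with inverse [psi]. *)
Let phi (x : R) : R := x / (1 + `|x|).
Let psi (x : R) : R := x / (1 - `|x|).

Lemma phi_lt1 x : `|phi x| < 1.
Proof.
have := normr_ge0 x => x0.
rewrite /phi normrM normfV [ `|1 + _| ]ger0_norm ?addr_ge0 //.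
by rewrite ltr_pdivrMr; lra.
Qed.

Lemma phiK x : psi (phi x) = x.
Proof.
have x0 := normr_ge0 x; have p0 : 1 + `|x| != 0 by rewrite gt_eqF //; lra.
have e : `|phi x| = `|x| / (1 + `|x|).
  by rewrite /phi normrM normfV [ `|1 + _| ]ger0_norm ?addr_ge0.
have e2 : 1 - `|phi x| = (1 + `|x|)^-1 by rewrite e; field.
by rewrite /psi e2 invrK /phi mulfVK.
Qed.

Lemma psiK x : `|x| < 1 -> phi (psi x) = x.
Proof.
move=> x1; have x0 := normr_ge0 x; have p0 : 1 - `|x| != 0 by rewrite gt_eqF //; lra.
have e : `|psi x| = `|x| / (1 - `|x|).
  rewrite /psi normrM normfV [ `|1 - _| ]ger0_norm //; lra.
have e2 : 1 + `|psi x| = (1 - `|x|)^-1 by rewrite e; field.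
by rewrite {1}/phi e2 invrK /psi mulfVK.
Qed.

Lemma phi_eq0 x : (phi x = 0) <-> (x = 0).
Proof.
split=> [e|->]; last by rewrite /phi mul0r.
by rewrite -(phiK x) e /psi mul0r.
Qed.

Lemma phi_continuous : continuous phi.
Proof.
move=> x; have x0 := normr_ge0 x; apply: cvgM; first exact: cvg_id.
apply: cvgV; first by rewrite gt_eqF //; lra.
by apply: cvgD; [exact: cvg_cst|apply: cvg_norm; exact: cvg_id].
Qed.

Lemma psi_cvg (T : Type) (F : set_system T) (FF : Filter F) (f : T -> R) x :
  `|x| < 1 -> f y @[y --> F] --> x -> psi (f y) @[y --> F] --> psi x.
Proof.
move=> x1 fx; apply: cvgM => //; apply: cvgV; first by rewrite gt_eqF //; lra.
by apply: cvgB; [exact: cvg_cst|exact: cvg_norm].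
Qed.

(** [cross_at] wants an embedding of the whole plane, whereas the two sets are segments only near
    the point. So the coordinates are squeezed by [phi] before an affine map along both directions;
    [al] and [be] invert that map by Cramer's rule. *)
Lemma chart (S T : set (R * R)) (a b c d : R * R) (t s e : R) :
  0 < t < 1 -> 0 < s < 1 -> mix a b t = mix c d s ->
  (b.1 - a.1) * (d.2 - c.2) - (b.2 - a.2) * (d.1 - c.1) != 0 ->
  0 < e -> (forall z, `|z.1 - (mix a b t).1| < e -> `|z.2 - (mix a b t).2| < e ->
    (S z <-> seg a b z) /\ (T z <-> seg c d z)) ->
  cross_at S T (mix a b t).
Proof.
move=> /andP[t0 t1] /andP[s0 s1] ts.
set p := mix a b t in ts *; set u1 := b.1 - a.1; set u2 := b.2 - a.2.
set v1 := d.1 - c.1; set v2 := d.2 - c.2; set D := _ - _ => D0 e0 loc.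
pose N := 1 + `|u1| + `|u2| + `|v1| + `|v2|.
have nu1 := normr_ge0 u1; have nu2 := normr_ge0 u2.
have nv1 := normr_ge0 v1; have nv2 := normr_ge0 v2.
have N0 : 0 < N by rewrite /N; lra.
(* [r] is so small that the image of the chart stays in the box where [loc] applies and the
   parameters on both segments stay between 0 and 1. *)
have [r [r0 rt rt' [rs rs' re]]] : exists r, [/\ 0 < r, r <= t, r <= 1 - t &
    [/\ r <= s, r <= 1 - s & r * N <= e]].
  exists (Num.min (Num.min t (1 - t)) (Num.min (Num.min s (1 - s)) (e / N))).
  rewrite !lt_min !ge_min divr_gt0 // !lexx !orbT /=.
  split=> //; first by apply/and3P; split=> //; lra.
  split=> //; rewrite -ler_pdivlMr //.
  by rewrite !ge_min lexx !orbT.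
pose h (z : R * R) : R * R :=
  (p.1 + r * (phi z.1 * u1 + phi z.2 * v1), p.2 + r * (phi z.1 * u2 + phi z.2 * v2)).
pose al (w : R * R) := ((w.1 - p.1) * v2 - (w.2 - p.2) * v1) / (r * D).
pose be (w : R * R) := (u1 * (w.2 - p.2) - u2 * (w.1 - p.1)) / (r * D).
have rn : r != 0 by rewrite gt_eqF.
have alh z : al (h z) = phi z.1.
  by rewrite /al /h /D /=; field; rewrite rn andbT; exact: D0.
have beh z : be (h z) = phi z.2.
  by rewrite /be /h /D /=; field; rewrite rn andbT; exact: D0.
have hE w : `|al w| < 1 -> `|be w| < 1 -> h (psi (al w), psi (be w)) = w.
  move=> a1 b1; rewrite /h /= !psiK // /al /be /D; case: w {a1 b1} => w1 w2 /=.
  by congr (_, _); field; rewrite rn andbT; exact: D0.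
have cal : continuous al.
  move=> w; apply: cvgM; last exact: cvg_cst.
  by apply: cvgB; apply: cvgM; try exact: cvg_cst; apply: cvgB; try exact: cvg_cst;
    [exact: cvg_fst|exact: cvg_snd].
have cbe : continuous be.
  move=> w; apply: cvgM; last exact: cvg_cst.
  by apply: cvgB; apply: cvgM; try exact: cvg_cst; apply: cvgB; try exact: cvg_cst;
    [exact: cvg_snd|exact: cvg_fst].
exists h; split.
- apply: continuous_pairl => z; apply: cvgD; try exact: cvg_cst;
    apply: cvgM; try exact: cvg_cst; apply: cvgD; apply: cvgM; try exact: cvg_cst.
  + by apply: cvg_comp (@cvg_fst _ _ _ _ _) _; exact: phi_continuous.
  + by apply: cvg_comp (@cvg_snd _ _ _ _ _) _; exact: phi_continuous.
  + by apply: cvg_comp (@cvg_fst _ _ _ _ _) _; exact: phi_continuous.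
  + by apply: cvg_comp (@cvg_snd _ _ _ _ _) _; exact: phi_continuous.
- move=> z z' hz; rewrite [z]surjective_pairing [z']surjective_pairing.
  by rewrite -(phiK z.1) -(phiK z.2) -!alh -!beh hz !alh !beh !phiK.
- move=> U oU; rewrite openE => w [z Uz <-] /=.
  have a1 : `|al (h z)| < 1 by rewrite alh phi_lt1.
  have b1 : `|be (h z)| < 1 by rewrite beh phi_lt1.
  have n1 : \forall w \near h z, `|al w| < 1.
    have /cvgr_norm_lt : al w @[w --> h z] --> al (h z) by exact: cal.
    by apply.
  have n2 : \forall w \near h z, `|be w| < 1.
    have /cvgr_norm_lt : be w @[w --> h z] --> be (h z) by exact: cbe.
    by apply.
  have n3 : \forall w \near h z, U (psi (al w), psi (be w)).
    have H : (psi (al w), psi (be w)) @[w --> h z] --> (psi (al (h z)), psi (be (h z))).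
      have p1 : psi (al w) @[w --> h z] --> psi (al (h z)) by apply: psi_cvg => //; exact: cal.
      have p2 : psi (be w) @[w --> h z] --> psi (be (h z)) by apply: psi_cvg => //; exact: cbe.
      exact: cvg_pair p1 p2.
    apply: (H U); rewrite alh beh !phiK -surjective_pairing.
    exact: open_nbhs_nbhs.
  near=> w'; exists (psi (al w'), psi (be w')); first by near: w'.
  by apply: hE; near: w'.
- by rewrite /h /phi !mul0r addr0 mulr0 !addr0 -surjective_pairing.
- move=> z; have f1 := phi_lt1 z.1; have f2 := phi_lt1 z.2.
  have near1 (x y : R) : `|x| + `|y| < N ->
      `|r * (phi z.1 * x + phi z.2 * y)| < e.
    move=> xyN; rewrite normrM (gtr0_norm r0); apply: lt_le_trans re.
    rewrite ltr_pM2l //; apply: le_lt_trans xyN; apply: le_trans (ler_normD _ _) _.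
    by apply: lerD; rewrite normrM ler_piMl // ltW.
  have [||lS lT] := loc (h z).
  + by rewrite /h /= addrAC subrr add0r near1 // /N; lra.
  + by rewrite /h /= addrAC subrr add0r near1 // /N; lra.
  have bnd (x : R) : `|x| < 1 -> -1 < x < 1 by rewrite ltr_norml.
  split.
    rewrite lS; split.
      move=> [t' _ e']; apply/phi_eq0; rewrite -beh e' /be /p /mix /= /u1 /u2.
      by rewrite [X in X / _](_ : _ = 0) ?mul0r //; ring.
    move=> z2; exists (t + r * phi z.1).
      have /andP[] := bnd _ f1; move: (phi z.1) => x x1 x2; apply/andP; split; nra.
    by rewrite /h z2 /phi mul0r !mul0r !addr0 -/(phi z.1) /p /mix /= -/u1 -/u2; congr (_, _); ring.
  rewrite lT; split.
    move=> [t' _ e']; apply/phi_eq0; rewrite -alh e' /al ts /mix /= /v1 /v2.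
    by rewrite [X in X / _](_ : _ = 0) ?mul0r //; ring.
  move=> z1; exists (s + r * phi z.2).
    have /andP[] := bnd _ f2; move: (phi z.2) => x x1 x2; apply/andP; split; nra.
  by rewrite /h z1 ts /phi mul0r !mul0r !add0r -/(phi z.2) /mix /= -/v1 -/v2; congr (_, _); ring.
Unshelve. all: by end_near. Qed.

End Chart.

(* Lower left cell and side length of a square. *)
Definition region := (cell * nat)%type.

Definition inreg (r : region) (p : cell) : bool :=
  (r.1.1 <= p.1 < r.1.1 + r.2%:Z) && (r.1.2 <= p.2 < r.1.2 + r.2%:Z).

Section Regions.
Context (R : realType).
Implicit Types (z : R * R) (r : region).

Definition oreg r z : bool :=
  (r.1.1%:~R < z.1 < (r.1.1 + r.2%:Z)%:~R) && (r.1.2%:~R < z.2 < (r.1.2 + r.2%:Z)%:~R).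
Definition creg r z : bool :=
  (r.1.1%:~R <= z.1 <= (r.1.1 + r.2%:Z)%:~R) && (r.1.2%:~R <= z.2 <= (r.1.2 + r.2%:Z)%:~R).

Lemma oreg_creg r z : oreg r z -> creg r z.
Proof.
by move=> /andP[/andP[h1 h2] /andP[h3 h4]]; rewrite /creg !ltW.
Qed.

Lemma regs_disj r r' z : (0 < r'.2)%N -> (forall p, inreg r p -> inreg r' p -> False) ->
  oreg r z -> creg r' z -> False.
Proof.
case: r r' => [[a b] n] [[a' b'] m] /= m0 H.
move=> /andP[/andP[/= h1 h2] /andP[/= h3 h4]] /andP[/andP[/= k1 k2] /andP[/= k3 k4]].
have := lt_le_trans h1 k2; have := le_lt_trans k1 h2.
have := lt_le_trans h3 k4; have := le_lt_trans k3 h4.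
have := lt_trans h1 h2; rewrite !ltr_int => l0 l1 l2 l3 l4.
(* The common cell is the coordinatewise maximum of the two lower left corners. *)
clear -H l0 l1 l2 l3 l4 m0; case: (leP a a') => e1; case: (leP b b') => e2;
  [apply: (H (a', b'))|apply: (H (a', b))|apply: (H (a, b'))|apply: (H (a, b))];
  rewrite /inreg /=; clear H; apply/andP; split; apply/andP; split; lia.
Qed.

Lemma inreg1 c p : inreg (c, 1%N) p -> p = c.
Proof.
case: c p => [a b] [c d]; rewrite /inreg /= => /andP[/andP[h1 h2] /andP[h3 h4]].
by congr (_, _); lia.
Qed.

Lemma creg_sub r c z : inreg r c -> creg (c, 1%N) z -> creg r z.
Proof.
case: r c => [[a b] n] [c d]; rewrite /inreg /creg /=.
move=> /andP[/andP[h1 h2] /andP[h3 h4]] /andP[/andP[k1 k2] /andP[k3 k4]].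
have e1 : (c + 1)%:~R <= (a + n%:Z)%:~R :> R by rewrite ler_int; lia.
have e2 : (d + 1)%:~R <= (b + n%:Z)%:~R :> R by rewrite ler_int; lia.
have e3 : a%:~R <= c%:~R :> R by rewrite ler_int.
have e4 : b%:~R <= d%:~R :> R by rewrite ler_int.
by rewrite (le_trans e3 k1) (le_trans k2 e1) (le_trans e4 k3) (le_trans k4 e2).
Qed.

Lemma oreg_cell r c z : oreg r z -> creg (c, 1%N) z -> inreg r c.
Proof.
move=> oz cz; apply: contraT => nc; exfalso; apply: regs_disj oz cz => // p pr.
by move=> /inreg1 pc; move: nc; rewrite -pc pr.
Qed.

Definition ctr r : R * R :=
  (r.1.1%:~R + r.2%:R / 2, r.1.2%:~R + r.2%:R / 2).

Lemma ctr_oreg r : (0 < r.2)%N -> oreg r (ctr r).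
Proof.
case: r => [[a b] n] /= n0; rewrite /oreg /ctr /=.
have : 0 < n%:R :> R by rewrite ltr0n.
by rewrite !intrD -!pmulrn => h; apply/andP; split; apply/andP; split; lra.
Qed.

Lemma spoke_open r z z' t : oreg r z -> creg r z' -> 0 <= t < 1 -> oreg r (mix z z' t).
Proof.
case: r => [[a b] n]; rewrite /oreg /creg /mix /=.
move: (a%:~R) (b%:~R) ((a + n%:Z)%:~R) ((b + n%:Z)%:~R) => A B C D.
case: z z' => [x y] [x' y'] /= /andP[/andP[h1 h2] /andP[h3 h4]].
move=> /andP[/andP[k1 k2] /andP[k3 k4]] /andP[t0 t1].
have H (l u x0 x1 : R) : l < x0 -> x0 < u -> l <= x1 -> x1 <= u ->
    l < x0 + t * (x1 - x0) < u.
  by move=> g1 g2 g3 g4; apply/andP; split; nra.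
by rewrite !H.
Qed.

(** If two spokes met off the centre, they would lie on one ray; then either their ends agree, or
    the nearer end lies inside the open square, which is excluded. *)
Lemma spokes_meet r z p p' t t' : oreg r z -> creg r p -> creg r p' ->
  ~~ oreg r p -> ~~ oreg r p' -> p <> p' -> 0 <= t < 1 -> 0 <= t' < 1 ->
  mix z p t = mix z p' t' -> t = 0.
Proof.
move=> oz cp cp' np np' pp t01 t'01 e.
apply: contrapT => tn0.
have t0 : 0 < t by rewrite lt_neqAle eq_sym; move/eqP: tn0 => ->; case/andP: t01.
have key (u u' : R * R) s s' : creg r u -> ~~ oreg r u' -> u <> u' -> 0 < s -> s <= s' ->
    mix z u s = mix z u' s' -> False.
  move=> cu nu uu s0 ss E; have s'0 : 0 < s' by apply: lt_le_trans ss.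
  have [es|lt] := eqVneq s s'.
  - rewrite -es in E; apply: uu; move: E; rewrite /mix => -[E1 E2].
    rewrite [u]surjective_pairing [u']surjective_pairing; congr (_, _).
      by apply: (addIr (- z.1)); apply: (mulfI (lt0r_neq0 s0)); move/addrI: E1.
    by apply: (addIr (- z.2)); apply: (mulfI (lt0r_neq0 s0)); move/addrI: E2.
  - have sl : s < s' by rewrite lt_neqAle lt.
    move/negP: nu; apply; suff -> : u' = mix z u (s / s').
      apply: spoke_open => //; rewrite divr_ge0 ?ltW //= ltr_pdivrMr //.
      by rewrite mul1r.
    move: E; rewrite /mix => -[/addrI E1 /addrI E2]; rewrite [u']surjective_pairing.
    have s'n : s' != 0 by rewrite gt_eqF.
    congr (_, _); [rewrite -[s / s']mulrC -mulrA E1|rewrite -[s / s']mulrC -mulrA E2];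
      by rewrite mulKf // addrC subrK.
have [tt|tt] := leP t t'; first exact: key cp np' pp t0 tt e.
have t'0 : 0 < t'.
  rewrite lt_neqAle; case/andP: t'01 => -> _; rewrite andbT; apply/eqP => h.
  move: e; rewrite -h mix0 => e; move/negP: np; apply.
  have [-> //|pz] := eqVneq p z; exfalso; apply: tn0.
  by apply: (@mix_inj R z p); rewrite ?mix0 // eq_sym.
by apply: (key p' p t' t cp' np _ t'0 (ltW tt) (esym e)) => h; apply: pp.
Qed.

End Regions.

(** * Assembling the drawing from chords and spokes *)

Section Realization.
Context (R : realType) (q : nat -> R).
Hypothesis q01 : forall i, 0 < q i < 1.
Hypothesis qinj : injective q.
Hypothesis qgen : forall k1 i1 k2 i2 k3 i3 k4 i4 k5 i5 k6 i6,
  k1 != k2 -> k3 != k4 -> k5 != k6 -> uniq [:: i1; i2; i3; i4; i5; i6] ->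
  ~ concurrent k1 (q i1) k2 (q i2) k3 (q i3) k4 (q i4) k5 (q i5) k6 (q i6).

Definition ppos (p : port) : R := bpos p.1 (q p.2).

Lemma ppos_inj p p' : ppos p = ppos p' -> p.2 = p'.2.
Proof.
case: p p' => k i [k' i']; rewrite /ppos /= => e; apply: qinj.
have H := bpos_lt k k' (q01 i) (q01 i'); have H' := bpos_lt k' k (q01 i') (q01 i).
rewrite e ltxx in H; rewrite e ltxx in H'.
have [kk|nkk] := eqVneq k k'.
  rewrite kk eqxx in H H'; move: H H'; case: ifP => _ h1 h2;
  by apply/eqP; rewrite eq_le !leNgt -h1 -h2.
rewrite (negPf nkk) in H; rewrite eq_sym (negPf nkk) in H'.
by exfalso; move: H H' nkk {e}; case: k => [[] []]; case: k' => [[] []].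
Qed.

Definition pt (c : cell) (p : port) : R * R :=
  (c.1%:~R + (lpt p.1 (q p.2)).1, c.2%:~R + (lpt p.1 (q p.2)).2).

Lemma mix_pt c p p' t : mix (pt c p) (pt c p') t =
  (c.1%:~R + (mix (lpt p.1 (q p.2)) (lpt p'.1 (q p'.2)) t).1,
   c.2%:~R + (mix (lpt p.1 (q p.2)) (lpt p'.1 (q p'.2)) t).2).
Proof. by rewrite /mix /pt /=; congr (_, _); ring. Qed.

Lemma mix_pt_eq c p1 p2 p3 p4 t s :
  mix (pt c p1) (pt c p2) t = mix (pt c p3) (pt c p4) s ->
  mix (lpt p1.1 (q p1.2)) (lpt p2.1 (q p2.2)) t =
  mix (lpt p3.1 (q p3.2)) (lpt p4.1 (q p4.2)) s.
Proof.
rewrite !mix_pt => -[/addrI e1 /addrI e2].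
by rewrite /mix; congr (_, _); [exact: e1|exact: e2].
Qed.

Lemma pt_creg c p : creg (c, 1%N) (pt c p).
Proof.
have /andP[q0 q1] := q01 p.2.
case: c p q0 q1 => a b [[[] []] i] /= q0 q1; rewrite /creg /pt /lpt /= !intrD;
  by apply/andP; split; apply/andP; split; lra.
Qed.

Lemma pt_nb c k i : pt (nb c k) (opp k, i) = pt c (k, i).
Proof.
case: c k => a b [[] []]; rewrite /pt /lpt /nb /= ?intrD ?intrB /=; congr (_, _); ring.
Qed.

Lemma pt_creg_nb c p : creg (nb c p.1, 1%N) (pt c p).
Proof. by case: p => k i; rewrite -pt_nb /=; exact: pt_creg. Qed.

Lemma oreg_pt r c p : oreg r (pt c p) -> inreg r c && inreg r (nb c p.1).
Proof.
by move=> o; rewrite (oreg_cell o (pt_creg _ _)) (oreg_cell o (pt_creg_nb _ _)).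
Qed.

Lemma oreg_pt_cell c c' p : ~~ oreg (c', 1%N) (pt c p).
Proof.
apply/negP => /oreg_pt/andP[/inreg1 h1 /inreg1 h2].
by move: (nb_neq c p.1); rewrite h2 h1 eqxx.
Qed.

Lemma frac_inj (a b : int) (x y : R) : 0 <= x < 1 -> 0 <= y < 1 ->
  a%:~R + x = b%:~R + y -> a = b /\ x = y.
Proof.
move=> /andP[x0 x1] /andP[y0 y1] e.
suff ab : a = b by split=> //; move: e; rewrite ab => /addrI.
have h1 : a%:~R < (b + 1)%:~R :> R by rewrite intrD; lra.
have h2 : b%:~R < (a + 1)%:~R :> R by rewrite intrD; lra.
by move: h1 h2; rewrite !ltr_int => h1 h2; clear -h1 h2; lia.
Qed.

(** One coordinate of a port is an integer and the other has the fractional part [q p.2], which lies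
    strictly between 0 and 1 and determines the index. *)
Lemma pt_idx c c' p p' : pt c p = pt c' p' -> p.2 = p'.2.
Proof.
have /andP[q0 q1] := q01 p.2; have /andP[r0 r1] := q01 p'.2.
have F0 (x : R) : 0 < x -> x < 1 -> 0 <= x < 1 by move=> h1 h2; rewrite ltW.
have Z0 : 0 <= (0 : R) < 1 by rewrite lexx ltr01.
have NB (a : int) (s : bool) : a%:~R + s%:R = (a + s%:Z)%:~R + 0 :> R.
  by rewrite addr0 intrD; case: s.
have X (a b : int) (s : bool) (x : R) : 0 < x -> x < 1 -> a%:~R + x = b%:~R + s%:R -> False.
  move=> x0 x1; rewrite NB => e; have [_ x00] := frac_inj (F0 _ x0 x1) Z0 e.
  by move: x0; rewrite x00 ltxx.
case: p p' q0 q1 r0 r1 => [[h s] i] [[h' s'] i'] /= q0 q1 r0 r1.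
rewrite /pt /lpt /=; case: h; case: h' => /= -[e1 e2].
- by case: (frac_inj (F0 _ q0 q1) (F0 _ r0 r1) e2) => _ /qinj.
- by exfalso; exact: X q0 q1 e2.
- by exfalso; exact: X q0 q1 e1.
- by case: (frac_inj (F0 _ q0 q1) (F0 _ r0 r1) e1) => _ /qinj.
Qed.

Lemma chord_open c p p' t : p.1 != p'.1 -> 0 < t < 1 ->
  oreg (c, 1%N) (mix (pt c p) (pt c p') t).
Proof.
move=> pp t01; rewrite mix_pt; have := inside pp (q01 p.2) (q01 p'.2) t01.
move: (mix _ _ t) => w /= /and4P[h1 h2 h3 h4].
by rewrite /oreg /= !intrD; apply/andP; split; apply/andP; split; lra.
Qed.

Lemma seg_cases (a b z : R * R) : seg a b z ->
  [\/ z = a, z = b | exists2 t, 0 < t < 1 & z = mix a b t].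
Proof.
move=> [t /andP[t0 t1] ->].
have [->|tn0] := eqVneq t 0; first by rewrite mix0; constructor 1.
have [->|tn1] := eqVneq t 1; first by rewrite mix1; constructor 2.
constructor 3; exists t => //.
by rewrite !lt_neqAle t0 t1 tn1 eq_sym tn0.
Qed.

Lemma chord_creg c p p' z : p.1 != p'.1 -> seg (pt c p) (pt c p') z ->
  creg (c, 1%N) z.
Proof.
move=> pp /seg_cases[->|->|[t t01 ->]]; try exact: pt_creg.
by apply: oreg_creg; exact: chord_open.
Qed.

Definition cseg (a : chord) : set (R * R) := seg (pt a.1 a.2.1) (pt a.1 a.2.2).
Definition poly (s : seq chord) : set (R * R) := [set z | exists2 a, a \in s & cseg a z].
Definition distinct_sides (a : chord) : bool := a.2.1.1 != a.2.2.1.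

Lemma pt_neq c p p' : p.2 != p'.2 -> pt c p != pt c p'.
Proof. by apply: contra => /eqP/pt_idx ->. Qed.

Lemma link_pt a b : link a b -> pt b.1 b.2.1 = pt a.1 a.2.2.
Proof.
case: a b => c [i [k o]] [d [[k' i'] o']] /and3P[/= /eqP -> /eqP -> /eqP ->].
exact: pt_nb.
Qed.

(** Chords of different cells can only meet at ports. The entry port of the first chord has an index
    that occurs nowhere later, so the first segment meets the remaining polygon just at its exit. *)
Lemma poly_arc a s : path link a s -> uniq (idxs (a :: s)) ->
  uniq [seq b.1 | b : chord <- a :: s] -> all distinct_sides (a :: s) ->
  is_arc (poly (a :: s)) (pt a.1 a.2.1) (pt (last a s).1 (last a s).2.2).
Proof.
elim: s a => [|b s IH] a.
  move=> _ /= /andP[]; rewrite !inE => io _ _ _.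
  suff -> : poly [:: a] = cseg a by apply: arc_seg; exact: pt_neq.
  apply/seteqP; split=> z; first by move=> [c]; rewrite inE => /eqP ->.
  by exists a; rewrite ?mem_head.
move=> /= /andP[ab ps] /andP[i0 ui] /andP[c0 uc] /andP[da ds].
have ba : b.2.1.2 = a.2.2.2 by case/and3P: ab => _ _ /eqP.
have uib : uniq (idxs (b :: s)) by rewrite /= ba; exact: ui.
have -> : poly [:: a, b & s] = cseg a `|` poly (b :: s).
  apply/seteqP; split=> z.
    move=> [c]; rewrite in_cons => /predU1P[->|cs] cz; first by left.
    by right; exists c.
  move=> [cz|[c cs cz]]; first by exists a; rewrite ?mem_head.
  by exists c; rewrite // in_cons cs orbT.
have io : a.2.1.2 != a.2.2.2 by move: i0; rewrite inE negb_or => /andP[].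
apply: (@arc_cat _ _ _ _ (pt a.1 a.2.2)); first by apply: arc_seg; exact: pt_neq.
  by rewrite -(link_pt ab); exact: IH.
move=> z az [c cs cz].
have dc : distinct_sides c by exact: (allP (ds : all distinct_sides (b :: s)) c cs).
have ac : a.1 != c.1.
  by apply: contraNneq c0 => e; rewrite e; exact: (map_f (fun d : chord => d.1) cs).
have no (d : chord) z' : d.1 != a.1 -> distinct_sides d -> cseg d z' -> oreg (a.1, 1%N) z' -> False.
  move=> da' dd dz oz; have := oreg_cell oz (chord_creg dd dz) => /inreg1 h.
  by rewrite h eqxx in da'.
have az' : z = pt a.1 a.2.1 \/ z = pt a.1 a.2.2.
  case: (seg_cases az) => [->|->|[t t01 zt]]; [by left|by right|].
  by exfalso; apply: (no c z) => //; rewrite 1?eq_sym // zt; exact: chord_open.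
case: az' => // za; exfalso.
have cidx : exists p : port, z = pt c.1 p /\ p.2 \in idxs (b :: s).
  have /andP[h1 h2] : (c.2.1.2 \in idxs (b :: s)) && (c.2.2.2 \in idxs (b :: s)).
    exact: in_idxs.
  case: (seg_cases cz) => [->|->|[t t01 zt]]; [by exists c.2.1|by exists c.2.2|].
  have := @chord_open c.1 c.2.1 c.2.2 t dc t01; rewrite -zt za.
  by rewrite (negPf (oreg_pt_cell _ _ _)).
move: cidx => [p [zp pi]]; rewrite za in zp; have := pt_idx zp => e.
by move: i0; rewrite e; move: pi; rewrite /= ba !inE => ->.
Qed.

Context (V : finType) (E : {set {set V}}) (bl : V -> cell) (L : nat).
Context (st : {set V} -> seq chord).

Let blk (v : V) : region := (bl v, L).

Hypothesis L_gt0 : (0 < L)%N.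
Hypothesis blk_disj : forall u v p, inreg (blk u) p -> inreg (blk v) p -> u = v.
Hypothesis st_link : forall e, e \in E -> sorted link (st e).
Hypothesis st_idx : forall e, e \in E -> uniq (idxs (st e)).
Hypothesis st_cells : forall e, e \in E -> uniq [seq a.1 | a : chord <- st e].
Hypothesis st_out : forall e (a : chord) v, e \in E -> a \in st e -> ~~ inreg (blk v) a.1.
Hypothesis st_ends : forall e, e \in E -> exists v w,
  [/\ v != w, e = [set v; w]%SET, st e != [::],
    inreg (blk v) (nb (fst_end (st e)).1 (fst_end (st e)).2.1) &
    inreg (blk w) (nb (lst_end (st e)).1 (lst_end (st e)).2.1)].
Hypothesis st_disj : forall e f i, e \in E -> f \in E -> e != f ->
  i \in idxs (st e) -> i \notin idxs (st f).
Hypothesis st_once : forall e f c d c' d', e \in E -> f \in E -> e != f ->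
  c \in st e -> d \in st e -> c' \in st f -> d' \in st f ->
  crosses ppos c c' -> crosses ppos d d' -> c = d.

Let ct (v : V) : R * R := ctr R (blk v).

(** A chord that leaves through the side by which it entered has the same cell before and after it.
    That cell would be visited twice, or be a cell of the strand inside a block, or lie in the
    blocks of both ends. *)
Lemma st_sides e a : e \in E -> a \in st e -> distinct_sides a.
Proof.
move=> eE ae; apply/negP => /eqP ks.
have [v [w [vw _ _ fv lw]]] := st_ends eE.
have so := st_link eE; have uc := st_cells eE; have out := st_out _ eE.
case/splitPr: ae so uc out fv lw => A B so uc out fv lw.
have nxt b B' : B = b :: B' -> b.1 = nb a.1 a.2.1.1.
  move=> BE; move: so; rewrite BE sorted_cat_cons /= => /andP[_ /andP[+ _]].
  by rewrite ks => /and3P[/eqP].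
have prv b A' : A = rcons A' b -> b.1 = nb a.1 a.2.1.1.
  move=> AE; move: so; rewrite AE cat_rcons sorted_cat_cons /= => /andP[_ /andP[+ _]].
  by case/and3P => /eqP -> /eqP -> _; rewrite nb_opp.
case/lastP: A so uc out fv lw nxt prv => [|A b]; case: B => [|b' B] so uc out fv lw nxt prv.
- move: fv lw; rewrite /= -ks => fv lw; move: vw.
  by rewrite (blk_disj fv lw) eqxx.
- have h := nxt _ _ erefl; move: fv; rewrite /= -h => fv.
  by move: (out b' v); rewrite fv !inE eqxx orbT => /(_ isT).
- have h := prv _ _ erefl; move: lw; rewrite cats1 lst_end_rcons /= -ks -h => lw.
  by move: (out b w); rewrite lw mem_cat mem_rcons mem_head => /(_ isT).
- have h1 := nxt _ _ erefl; have h2 := prv _ _ erefl.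
  move: uc; rewrite map_cat map_rcons cat_uniq => /and3P[_ /hasPn/(_ b'.1) + _].
  rewrite /= !inE eqxx orbT => /(_ isT); rewrite mem_rcons.
  by rewrite h1 -h2 mem_head.
Qed.

Lemma port_not_open e a p r : e \in E -> a \in st e -> p \in [:: a.2.1; a.2.2] ->
  (exists v, r = blk v) \/ r.2 = 1%N -> ~~ oreg r (pt a.1 p).
Proof.
move=> eE ae pa [[v ->]|r1].
  apply/negP => /oreg_pt/andP[h _]; by move: (st_out v eE ae); rewrite h.
by case: r r1 => c n /= ->; exact: oreg_pt_cell.
Qed.

Lemma port_idx e a p : e \in E -> a \in st e -> p \in [:: a.2.1; a.2.2] ->
  p.2 \in idxs (st e).
Proof.
move=> eE ae; have /andP[h1 h2] := in_idxs (st_link eE) ae.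
by rewrite !inE => /orP[]/eqP ->.
Qed.

Lemma ports_neq e f a b p p' : e \in E -> f \in E -> e != f ->
  a \in st e -> b \in st f -> p \in [:: a.2.1; a.2.2] -> p' \in [:: b.2.1; b.2.2] ->
  pt a.1 p <> pt b.1 p'.
Proof.
move=> eE fE ef ae bf pa pb /pt_idx h; have := st_disj eE fE ef (port_idx eE ae pa).
by rewrite h (port_idx fE bf pb).
Qed.

Lemma blk_cell v c (z : R * R) : ~~ inreg (blk v) c -> oreg (blk v) z -> creg (c, 1%N) z -> False.
Proof. by move=> nc oz cz; move: nc; rewrite (oreg_cell oz cz). Qed.

Lemma blk_blk u v (z : R * R) : oreg (blk u) z -> creg (blk v) z -> u = v.
Proof.
move=> oz cz; apply: contrapT => uv; apply: regs_disj oz cz => // p h h'.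
exact/uv/(blk_disj h h').
Qed.

Lemma cell_cell c c' (z : R * R) : oreg (c, 1%N) z -> creg (c', 1%N) z -> c = c'.
Proof. by move=> oz cz; have /inreg1 := oreg_cell oz cz. Qed.

Lemma ct_open v : oreg (blk v) (ct v). Proof. exact: ctr_oreg. Qed.

(** The bound [t < 1] leaves out the port, so that a spoke lies in the open block. *)
Definition on_spoke e (u : V) (z : R * R) : Prop :=
  exists a p t, [/\ a \in st e, p \in [:: a.2.1; a.2.2],
    inreg (blk u) (nb a.1 p.1), 0 <= t < 1 & z = mix (ct u) (pt a.1 p) t].

Lemma spoke_oreg e u z : e \in E -> on_spoke e u z -> oreg (blk u) z.
Proof.
move=> eE [a [p [t [ae pa up t01 ->]]]]; apply: spoke_open t01; first exact: ct_open.
exact: creg_sub up (pt_creg_nb _ _).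
Qed.

Definition arc_of e (A : set (R * R)) (v w : V) : Prop :=
  [/\ v != w, e = [set v; w]%SET, is_arc A (ct v) (ct w),
     (forall z, A z -> [\/ exists a t, [/\ a \in st e, 0 < t < 1 &
                            z = mix (pt a.1 a.2.1) (pt a.1 a.2.2) t],
                         exists a p, [/\ a \in st e, p \in [:: a.2.1; a.2.2] &
                            z = pt a.1 p] |
                         exists2 u, u \in e & on_spoke e u z]) &
     (forall a, a \in st e -> cseg a `<=` A)].

Lemma arc_exists e : e \in E -> exists A v w, arc_of e A v w.
Proof.
move=> eE; have [v [w [vw ee n0 fv lw]]] := st_ends eE.
have so := st_link eE; have ui := st_idx eE; have uc := st_cells eE.
have sd' : all distinct_sides (st e) by apply/allP => a; exact: st_sides.
have out := st_out _ eE.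
have [a [s es]] : exists a s, st e = a :: s.
  by case: (st e) n0 => // a s _; exists a, s.
rewrite es in so ui uc sd' out fv lw.
have pa := poly_arc so ui uc sd'.
set l := last a s in pa; have le : l \in a :: s by exact: mem_last.
have ae : a \in a :: s by exact: mem_head.
have in1 (x : chord) : x.2.1 \in [:: x.2.1; x.2.2] by rewrite mem_head.
have in2 (x : chord) : x.2.2 \in [:: x.2.1; x.2.2] by rewrite !inE eqxx orbT.
have nopen (x : chord) p r : x \in a :: s -> p \in [:: x.2.1; x.2.2] ->
    (exists v, r = blk v) \/ r.2 = 1%N -> ~~ oreg r (pt x.1 p).
  by rewrite -es; exact: port_not_open.
have sp u z p (x : chord) : x \in a :: s -> p \in [:: x.2.1; x.2.2] ->
    inreg (blk u) (nb x.1 p.1) -> seg (ct u) (pt x.1 p) z ->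
    z = pt x.1 p \/ on_spoke e u z.
  move=> xs px up /seg_cases[->|->|[t /andP[t0 t1] ->]]; [right|by left|right].
    exists x, p, 0; rewrite es; split=> //; first by rewrite lexx ltr01.
    by rewrite mix0.
  by exists x, p, t; rewrite es; split=> //; rewrite ltW.
have cneq u p (x : chord) : x \in a :: s -> p \in [:: x.2.1; x.2.2] -> ct u != pt x.1 p.
  move=> xs px; apply/negP => /eqP h; have := ct_open u; rewrite h.
  by rewrite (negPf (nopen x p (blk u) xs px _)) //; left; exists u.
have segC (x y z : R * R) : seg x y z -> seg y x z.
  move=> [t /andP[t0 t1] ->]; exists (1 - t); last by rewrite mixC.
  by rewrite subr_ge0 t1 /= lerBlDr lerDl.
have poly_c z : poly (a :: s) z -> exists2 b, b \in a :: s & creg (b.1, 1%N) z.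
  move=> [b bs bz]; exists b => //; apply: chord_creg bz.
  exact: (allP sd').
have c1 : is_arc (seg (ct v) (pt a.1 a.2.1) `|` poly (a :: s)) (ct v) (pt l.1 l.2.2).
  apply: (arc_cat (b := pt a.1 a.2.1)); [by apply: arc_seg; exact: cneq|exact: pa|].
  move=> z /(sp v z _ a ae (in1 a) fv)[//|sz] /poly_c[b bs bz]; exfalso.
  exact: (blk_cell (out b v bs) (spoke_oreg eE sz) bz).
have c2 : is_arc ((seg (ct v) (pt a.1 a.2.1) `|` poly (a :: s)) `|`
    seg (pt l.1 l.2.2) (ct w)) (ct v) (ct w).
  apply: arc_cat c1 _ _; first by apply: arc_seg; rewrite eq_sym cneq.
  move=> z [vz|pz] /segC/(sp w z _ l le (in2 l) lw)[//|sz]; exfalso.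
    have oz := spoke_oreg eE sz.
    have cz : creg (blk v) z.
      have [->|vz'] := sp v z _ a ae (in1 a) fv vz.
        exact: creg_sub fv (pt_creg_nb _ _).
      by apply: oreg_creg; exact: spoke_oreg eE vz'.
    by move: vw; rewrite (blk_blk oz cz) eqxx.
  have [b bs bz] := poly_c z pz.
  exact: (blk_cell (out b w bs) (spoke_oreg eE sz) bz).
eexists; exists v, w; split=> //; first exact: c2.
  rewrite es; move=> z [[vz|[b bs bz]]|wz].
  - have [->|vz'] := sp v z _ a ae (in1 a) fv vz; first by constructor 2; exists a, a.2.1.
    by constructor 3; exists v => //; rewrite ee !inE eqxx.
  - case: (seg_cases bz) => [->|->|[t t01 ->]].
    + by constructor 2; exists b, b.2.1.
    + by constructor 2; exists b, b.2.2.
    + by constructor 1; exists b, t.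
  - have [->|vz'] := sp w z _ l le (in2 l) lw (segC _ _ _ wz).
      by constructor 2; exists l, l.2.2.
    by constructor 3; exists w => //; rewrite ee !inE eqxx orbT.
by rewrite es => b bs z bz; left; right; exists b.
Qed.

(** Chords run in open cells outside the blocks, spokes in open blocks, and ports lie in neither and
    have indices private to their edge. Hence only chord meets chord, in a common cell, or spoke
    meets spoke, at the centre. *)
Lemma arcs_meet e f A v w B v' w' z : e \in E -> f \in E -> e != f ->
  arc_of e A v w -> arc_of f B v' w' -> A z -> B z ->
  (exists a b t s, [/\ a \in st e, b \in st f, a.1 = b.1 &
     [/\ 0 < t < 1, 0 < s < 1, z = mix (pt a.1 a.2.1) (pt a.1 a.2.2) t &
      z = mix (pt b.1 b.2.1) (pt b.1 b.2.2) s]]) \/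
  (exists u, [/\ u \in e, u \in f & z = ct u]).
Proof.
move=> eE fE ef [_ _ _ Ac _] [_ _ _ Bc _] Az Bz.
have op g a t : g \in E -> a \in st g -> 0 < t < 1 ->
    oreg (a.1, 1%N) (mix (pt a.1 a.2.1) (pt a.1 a.2.2) t).
  by move=> gE ag t01; apply: chord_open => //; exact: st_sides ag.
have bk (v0 : V) : (exists v, blk v0 = blk v) \/ (blk v0).2 = 1%N by left; exists v0.
have ck (c : cell) : (exists v, (c, 1%N) = blk v) \/ (c, 1%N).2 = 1%N by right.
case: (Ac z Az) => [[a [t [ae t01 za]]]|[a [p [ae pa za]]]|[u ue su]];
case: (Bc z Bz) => [[b [s [bf s01 zb]]]|[b [p' [bf pb zb]]]|[u' uf su']].
- left; exists a, b, t, s; split=> //.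
  apply: (@cell_cell _ _ z); first by rewrite za; exact: (op e a t).
  by apply: oreg_creg; rewrite zb; exact: (op f b s).
- have := op e a t eE ae t01; rewrite -za zb.
  by rewrite (negPf (port_not_open fE bf pb (ck _))).
- have := spoke_oreg fE su' => oz; exfalso.
  apply: (blk_cell (st_out u' eE ae) oz); rewrite za; apply: oreg_creg; exact: (op e a t).
- have := op f b s fE bf s01; rewrite -zb za.
  by rewrite (negPf (port_not_open eE ae pa (ck _))).
- by exfalso; apply: (ports_neq eE fE ef ae bf pa pb); rewrite -za -zb.
- have := spoke_oreg fE su'; rewrite za.
  by rewrite (negPf (port_not_open eE ae pa (bk _))).
- have := spoke_oreg eE su => oz; exfalso.
  apply: (blk_cell (st_out u fE bf) oz); rewrite zb; apply: oreg_creg; exact: (op f b s).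
- have := spoke_oreg eE su; rewrite zb.
  by rewrite (negPf (port_not_open fE bf pb (bk _))).
- have oz := spoke_oreg eE su; have oz' := spoke_oreg fE su'.
  have uu : u = u' by apply: blk_blk oz (oreg_creg oz').
  subst u'; right; exists u; split=> //.
  move: su su' => [a [p [t [ae pa up t01 zt]]]] [b [p' [s [bf pb up' s01 zs]]]].
  have t0 : t = 0.
    apply: (@spokes_meet R (blk u) (ct u) (pt a.1 p) (pt b.1 p') t s) => //.
    + exact: ct_open.
    + exact: creg_sub up (pt_creg_nb _ _).
    + exact: creg_sub up' (pt_creg_nb _ _).
    + exact: (port_not_open eE ae pa (bk _)).
    + exact: (port_not_open fE bf pb (bk _)).
    + exact: (ports_neq eE fE ef ae bf pa pb).
    + by rewrite -zt -zs.
  by rewrite zt t0 mix0.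
Qed.

Lemma st_dj e f a b : e \in E -> f \in E -> e != f -> a \in st e -> b \in st f -> apart a b.
Proof.
move=> eE fE ef ae bf; have /andP[a1 a2] := in_idxs (st_link eE) ae.
have /andP[b1 b2] := in_idxs (st_link fE) bf.
have H i j : i \in idxs (st e) -> j \in idxs (st f) -> i != j.
  by move=> ie jf; apply: contraTneq jf => <-; exact: st_disj ie.
by rewrite /apart !H // implybT.
Qed.

(** In the sum of the two signs given by [det_sign] the common term for the ends of [a] cancels, and
    what remains is [x4]. *)
Lemma ports_det e f a b : e \in E -> f \in E -> e != f -> a \in st e -> b \in st f ->
  a.1 = b.1 ->
  let la := lpt a.2.1.1 (q a.2.1.2) in let la' := lpt a.2.2.1 (q a.2.2.2) in
  let lb := lpt b.2.1.1 (q b.2.1.2) in let lb' := lpt b.2.2.1 (q b.2.2.2) in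
  [/\ det la la' lb != 0, det la la' lb' != 0 &
    (det la la' lb < 0) (+) (det la la' lb' < 0) = crosses ppos a b].
Proof.
move=> eE fE ef ae bf ab; have := st_dj eE fE ef ae bf.
rewrite /apart ab eqxx /= => /and4P[h1 h2 h3 h4].
have qn i j : i != j -> q i != q j by apply: contra => /eqP/qinj ->.
have da := st_sides eE ae.
have [d1 s1] := det_sign b.2.1.1 (q01 a.2.1.2) (q01 a.2.2.2) (q01 b.2.1.2) da (qn _ _ h1) (qn _ _ h3).
have [d2 s2] := det_sign b.2.2.1 (q01 a.2.1.2) (q01 a.2.2.2) (q01 b.2.2.2) da (qn _ _ h2) (qn _ _ h4).
split=> //; rewrite s1 s2 /crosses ab eqxx /= /x4 /ppos.
by case: (_ < bpos b.2.1.1 _); case: (_ < bpos b.2.1.1 _);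
  case: (_ < bpos b.2.2.1 _); case: (_ < bpos b.2.2.1 _); case: (_ < _).
Qed.

Lemma common_crosses e f a b t s : e \in E -> f \in E -> e != f ->
  a \in st e -> b \in st f -> a.1 = b.1 -> 0 < t < 1 -> 0 < s < 1 ->
  mix (pt a.1 a.2.1) (pt a.1 a.2.2) t = mix (pt b.1 b.2.1) (pt b.1 b.2.2) s ->
  crosses ppos a b.
Proof.
move=> eE fE ef ae bf ab t01 /andP[s0 s1] E0.
have [d1 d2 <-] := ports_det eE fE ef ae bf ab.
apply: contraT => /negP h; exfalso; rewrite -ab in E0.
apply: same_side_disjoint d1 d2 _ _ (mix_pt_eq E0); last by rewrite !ltW.
by move: h; case: (_ < 0); case: (_ < 0).
Qed.

Lemma common_uniq e f a b t s t' s' : e \in E -> f \in E -> e != f ->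
  a \in st e -> b \in st f -> a.1 = b.1 ->
  mix (pt a.1 a.2.1) (pt a.1 a.2.2) t = mix (pt b.1 b.2.1) (pt b.1 b.2.2) s ->
  mix (pt a.1 a.2.1) (pt a.1 a.2.2) t' = mix (pt b.1 b.2.1) (pt b.1 b.2.2) s' ->
  mix (pt b.1 b.2.1) (pt b.1 b.2.2) s = mix (pt b.1 b.2.1) (pt b.1 b.2.2) s'.
Proof.
move=> eE fE ef ae bf ab E1 E2; have [d1 _ _] := ports_det eE fE ef ae bf ab.
rewrite -ab in E1 E2.
by rewrite (two_points d1 (mix_pt_eq E1) (mix_pt_eq E2)).
Qed.

Lemma st_cell_inj e a b : e \in E -> a \in st e -> b \in st e -> a.1 = b.1 -> a = b.
Proof.
move=> eE; have := st_cells eE; elim: (st e) => //= c s IH /andP[cs us].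
rewrite !in_cons => /predU1P[->|as'] /predU1P[->|bs] // ab.
- by move: cs; rewrite ab (map_f (fun d : chord => d.1) bs).
- by move: cs; rewrite -ab (map_f (fun d : chord => d.1) as').
- exact: IH.
Qed.

Lemma arc_local e A v w a z : e \in E -> arc_of e A v w -> a \in st e ->
  oreg (a.1, 1%N) z -> ((A z /\ z <> ct v /\ z <> ct w) <-> cseg a z).
Proof.
move=> eE [_ _ _ Ac sA] ae oz; split; last first.
  move=> az; split; first exact: sA az.
  by split=> zc; move: (oreg_creg oz); rewrite zc => cz;
    exact: (blk_cell (st_out _ eE ae) (ct_open _) cz).
move=> [/Ac[[a' [t [a'e t01 za]]]|[a' [p [a'e pa za]]]|[u ue su]] _].
- have a'a : a'.1 = a.1.
    apply: (@cell_cell _ _ z); last exact: oreg_creg.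
    by rewrite za; apply: chord_open => //; exact: st_sides a'e.
  rewrite -(st_cell_inj eE a'e ae a'a) za; exists t => //.
  by case/andP: t01 => t0 t1; rewrite !ltW.
- move: oz; rewrite za (negPf (port_not_open eE a'e pa _)) //; by right.
- exfalso; apply: (blk_cell (st_out u eE ae) (spoke_oreg eE su)); exact: oreg_creg.
Qed.

(** A common interior point forces interleaved chords; by [st_once] their pair is determined by the
    two edges, and two such chords meet in one point. So each pair in [X] accounts for at most one
    crossing point. *)
Lemma realization (X : {set {set {set V}}}) :
  (forall e f (a b : chord), e \in E -> f \in E -> e != f -> a \in st e -> b \in st f ->
     crosses ppos a b -> [set e; f]%SET \in X) ->
  exists D : drawing R V, is_drawing E D /\ (crossings E D <= #|X|)%N.
Proof.
move=> HX.
have /choice[g gP] : forall e, exists g : R -> R * R, e \in E -> exists A v w,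
    arc_of e A v w /\ [/\ continuous g, {in `[0, 1] &, injective g}, g 0 = ct v,
      g 1 = ct w & g @` `[0, 1] = A].
  move=> e; have [eE|] := boolP (e \in E); last by exists (fun=> 0).
  have [A [v [w H]]] := arc_exists eE; have [_ _ [g gH] _ _] := H.
  by exists g => _; exists A, v, w.
pose D := Drawing ct g.
have ai e : e \in E -> exists A v w, [/\ arc_of e A v w, edge_arc D e = A,
    g e 0 = ct v, g e 1 = ct w &
    edge_interior D e = [set z | [/\ A z, z <> ct v & z <> ct w]]].
  move=> eE; have [A [v [w [H [cg ig g0 g1 gA]]]]] := gP e eE.
  exists A, v, w; split=> //; rewrite /edge_interior /= (arc_interior ig gA).
  by rewrite g0 g1.
have int e f z : e \in E -> f \in E -> e != f -> edge_interior D e z ->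
   edge_interior D f z -> exists a b t s, [/\ a \in st e, b \in st f, a.1 = b.1 &
     [/\ 0 < t < 1, 0 < s < 1, z = mix (pt a.1 a.2.1) (pt a.1 a.2.2) t &
      z = mix (pt b.1 b.2.1) (pt b.1 b.2.2) s]].
  move=> eE fE ef; have [A [v [w [HA _ _ _ ->]]]] := ai e eE.
  have [B [v' [w' [HB _ _ _ ->]]]] := ai f fE.
  move=> [Az nv nw] [Bz _ _]; case: (arcs_meet eE fE ef HA HB Az Bz) => // -[u [ue _ zu]].
  have [_ ee _ _ _] := HA; move: ue; rewrite ee !inE => /orP[]/eqP uu.
    by rewrite uu in zu.
  by rewrite uu in zu.
have loc e a z : e \in E -> a \in st e -> oreg (a.1, 1%N) z ->
    (edge_interior D e z <-> cseg a z).
  move=> eE ae oz; have [A [v [w [HA _ _ _ ->]]]] := ai e eE.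
  rewrite -(arc_local eE HA ae oz) /=.
  by split=> [[h1 h2 h3]|[h1 [h2 h3]]]; split.
have ctinj : injective ct.
  move=> u v uv; apply: (@blk_blk u v (ct u)); first exact: ct_open.
  by rewrite uv; apply/oreg_creg/ct_open.
have common e f a b (z z' : R * R) t s t' s' : e \in E -> f \in E -> e != f ->
    a \in st e -> b \in st f -> a.1 = b.1 ->
    z = mix (pt a.1 a.2.1) (pt a.1 a.2.2) t -> z = mix (pt b.1 b.2.1) (pt b.1 b.2.2) s ->
    z' = mix (pt a.1 a.2.1) (pt a.1 a.2.2) t' -> z' = mix (pt b.1 b.2.1) (pt b.1 b.2.2) s' ->
    z = z'.
  move=> eE fE ef ae bf ab h1 h2 h3 h4; rewrite h2 h4.
  apply: (common_uniq eE fE ef ae bf ab (t := t) (t' := t')).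
    by rewrite -h1 -h2.
  by rewrite -h3 -h4.
have isD : is_drawing E D.
  split.
  - exact: ctinj.
  - move=> e eE; have [A [v [w [_ [cg _ _ _ _]]]]] := gP e eE.
    exact: continuous_subspaceT.
  - by move=> e eE; have [A [v [w [_ [_ ig _ _ _]]]]] := gP e eE.
  - move=> e eE; have [A [v [w [HA _ /= -> -> _]]]] := ai e eE.
    have [_ ee _ _ _] := HA; apply/seteqP; split=> z /=.
      by move=> [->|->]; [exists v|exists w]; rewrite // ee !inE eqxx ?orbT.
    by move=> [u]; rewrite ee !inE => /orP[]/eqP -> <-; [left|right].
  - move=> e v eE ve; have [A [v1 [w1 [HA -> _ _ _]]]] := ai e eE.
    have [_ _ _ Ac _] := HA => /Ac[[a' [t [a'e t01 za]]]|[a' [p [a'e pa za]]]|[u ue su]].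
    + apply: (blk_cell (st_out v eE a'e) (ct_open v)); rewrite [ct v]za.
      by apply/oreg_creg/chord_open => //; exact: st_sides a'e.
    + have := ct_open v; rewrite [ct v]za (negPf (port_not_open eE a'e pa _)) //.
      by left; exists v.
    + have := blk_blk (ct_open v) (oreg_creg (spoke_oreg eE su)) => vu.
      by rewrite vu ue in ve.
  - move=> e f eE fE ef.
    have [A [v [w [HA -> _ _ _]]]] := ai e eE; have [B [v' [w' [HB -> _ _ _]]]] := ai f fE.
    (* Two chords have at most one common point, so one pick per pair of chords, together with the
       vertices, lists the whole intersection. *)
    pose P (ab : chord * chord) : set (R * R) := [set z | exists t s,
      [/\ ab.1.1 = ab.2.1, z = mix (pt ab.1.1 ab.1.2.1) (pt ab.1.1 ab.1.2.2) t &
          z = mix (pt ab.2.1 ab.2.2.1) (pt ab.2.1 ab.2.2.2) s]].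
    pose l := [seq xget 0 (P (a, b)) | a <- st e, b <- st f] ++ [seq ct u | u <- enum V].
    apply: (@sub_finite_set _ _ [set` l]); last exact: finite_seq.
    move=> z [Az Bz]; rewrite /= /l mem_cat; apply/orP.
    case: (arcs_meet eE fE ef HA HB Az Bz) =>
        [[a [b [t [s [ae bf ab [_ _ h1 h2]]]]]]|[u [_ _ ->]]]; last first.
      by right; apply/map_f; rewrite mem_enum.
    left; apply/allpairsP; exists (a, b); split=> //=.
    have Pz : P (a, b) z by exists t, s.
    case: xgetP => [z' _ [t' [s' [_ h3 h4]]]|/(_ z) //].
    exact: (common _ _ _ _ _ _ _ _ _ _ eE fE ef ae bf ab h1 h2 h3 h4).
  - move=> e f z eE fE ef ez fz.
    have [a [b [t [s [ae bf ab [t01 s01 h1 h2]]]]]] := int e f z eE fE ef ez fz.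
    have [d1 d2 dx] := ports_det eE fE ef ae bf ab.
    have oz : oreg (a.1, 1%N) z by rewrite h1; apply: chord_open => //; exact: st_sides ae.
    have /andP[/andP[w1 w2] /andP[w3 w4]] := oz.
    set x1 := _%:~R in w1; set x2 := _%:~R in w2; set y1 := _%:~R in w3; set y2 := _%:~R in w4.
    pose ep := Num.min (Num.min (z.1 - x1) (x2 - z.1)) (Num.min (z.2 - y1) (y2 - z.2)).
    have ep0 : 0 < ep by rewrite !lt_min !subr_gt0 w1 w2 w3 w4.
    have near z' : `|z'.1 - z.1| < ep -> `|z'.2 - z.2| < ep -> oreg (a.1, 1%N) z'.
      rewrite !lt_min !ltr_norml => /andP[/andP[/andP[k1 k2] /andP[k3 k4]] _].
      move=> /andP[_ /andP[/andP[k5 k6] /andP[k7 k8]]].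
      rewrite /oreg -/x1 -/x2 -/y1 -/y2; move: k1 k4 k5 k8.
      by rewrite !opprB !ltrD2r => -> -> -> ->.
    rewrite h1; apply: (chart (e := ep) t01 s01) => //.
    + by rewrite -h1 h2.
    (* If the chords were parallel, the determinant would be constant along the second one; it
       vanishes at the common point but not at the end of [b]. *)
    + apply/negP => /eqP par; move: d1; apply/negP; rewrite negbK; apply/eqP.
      have E1 := mix_pt_eq (etrans (esym h1) (etrans h2 (congr1 (fun c => mix (pt c b.2.1) (pt c b.2.2) s) (esym ab)))).
      have := det_mix (lpt a.2.1.1 (q a.2.1.2)) (lpt a.2.2.1 (q a.2.2.2)) t.
      rewrite E1 det_mix2; move: par; rewrite ab /det /pt /=.
      move: (lpt _ _) (lpt _ _) (lpt _ _) (lpt _ _) => A B C C'; nra.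
    + move=> z'; rewrite -h1 => n1 n2; have oz' := near z' n1 n2.
      by split; [exact: loc|apply: loc; rewrite -?ab].
  - move=> e f h eE fE hE ef fh eh; apply/seteqP; split=> z // [[ez fz] hz].
    have [a [b [t [s [ae bf ab [t01 s01 h1 h2]]]]]] := int e f z eE fE ef ez fz.
    have [a' [c [t' [r [a'e ch ac [t'01 r01 h3 h4]]]]]] := int e h z eE hE eh ez hz.
    have aa : a' = a.
      apply: (st_cell_inj eE) => //; apply: (@cell_cell _ _ z).
        by rewrite h3; apply: chord_open => //; exact: st_sides a'e.
      by rewrite h1; apply/oreg_creg/chord_open => //; exact: st_sides ae.
    subst a'; have dab := st_dj eE fE ef ae bf; have dac := st_dj eE hE eh ae ch.
    have dbc := st_dj fE hE fh bf ch.
    have io k (d : chord) : k \in E -> d \in st k -> d.2.1.2 != d.2.2.2.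
      move=> kE dk; have /andP[_ /allP/(_ d dk)] := apart_strand (st_link kE) (st_idx kE).
      by [].
    have ioa := io e a eE ae; have iob := io f b fE bf; have ioc := io h c hE ch.
    have bc : b.1 = c.1 by rewrite -ab ac.
    apply: (qgen (st_sides eE ae) (st_sides fE bf) (st_sides hE ch)
      (i1 := a.2.1.2) (i2 := a.2.2.2) (i3 := b.2.1.2) (i4 := b.2.2.2)
      (i5 := c.2.1.2) (i6 := c.2.2.2)).
      move: dab dac dbc; rewrite /apart ab bc eqxx /= => /and4P[d1 d2 d3 d4].
      move=> /and4P[d5 d6 d7 d8] /and4P[d9 d10 d11 d12]; rewrite !inE !negb_or.
      by rewrite ioa iob ioc d1 d2 d3 d4 d5 d6 d7 d8 d9 d10 d11 d12.
    exists t, s, r; split=> //.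
      by apply: (@mix_pt_eq a.1); rewrite -h1 h2 ab.
    by apply: (@mix_pt_eq a.1); rewrite -h1 h4 ac.
exists D; split=> //.
have uni e f z z' : e \in E -> f \in E -> e != f ->
    edge_interior D e z -> edge_interior D f z ->
    edge_interior D e z' -> edge_interior D f z' -> z = z'.
  move=> eE fE ef ez fz ez' fz'.
  have [a [b [t [s [ae bf ab [t01 s01 h1 h2]]]]]] := int e f z eE fE ef ez fz.
  have [a' [b' [t' [s' [a'e b'f ab' [t'01 s'01 h3 h4]]]]]] := int e f z' eE fE ef ez' fz'.
  have cr : crosses ppos a b.
    by apply: (common_crosses eE fE ef ae bf ab t01 s01); rewrite -h1 -h2.
  have cr' : crosses ppos a' b'.
    by apply: (common_crosses eE fE ef a'e b'f ab' t'01 s'01); rewrite -h3 -h4.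
  have aa := st_once eE fE ef ae a'e bf b'f cr cr'; subst a'.
  have bb : b = b' by apply: (st_cell_inj fE) => //; rewrite -ab -ab'.
  subst b'; exact: (common _ _ _ _ _ _ _ _ _ _ eE fE ef ae bf ab h1 h2 h3 h4).
pose P (p : {set {set V}}) : set (R * R) := [set z | exists e f,
  [/\ e \in E, f \in E, e != f, p = [set e; f]%SET &
     edge_interior D e z /\ edge_interior D f z]].
have Puni p z z' : P p z -> P p z' -> z = z'.
  move=> [e [f [eE fE ef -> [ez fz]]]] [e' [f' [e'E f'E ef' pp [ez' fz']]]].
  have e'p : e' \in [set e; f]%SET by rewrite pp !inE eqxx.
  have f'p : f' \in [set e; f]%SET by rewrite pp !inE eqxx orbT.
  move: e'p f'p ez' fz' ef'; rewrite !inE => /orP[]/eqP -> /orP[]/eqP ->;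
    rewrite ?eqxx // => ez' fz' _; exact: (uni e f).
pose gp p : R * R := xget 0 (P p).
have fin := finite_crossing_points isD.
have size_le : (size (enum_fset (fset_set (crossing_points E D))) <=
    size [seq gp p | p <- enum X])%N.
  apply: uniq_leq_size; first exact: fset_uniq.
  move=> z zA; have : z \in crossing_points E D by rewrite -(in_fset_set fin).
  rewrite inE => -[e [f [eE fE ef ez fz]]].
  have [a [b [t [s [ae bf ab [t01 s01 h1 h2]]]]]] := int e f z eE fE ef ez fz.
  have cr : crosses ppos a b.
    by apply: (common_crosses eE fE ef ae bf ab t01 s01); rewrite -h1 -h2.
  apply/mapP; exists [set e; f]%SET; first by rewrite mem_enum; exact: HX cr.
  have Pz : P [set e; f]%SET z by exists e, f.
  by rewrite /gp; case: xgetP => [z' _ Pz'|/(_ z) //]; exact: Puni Pz Pz'.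
by move: size_le; rewrite size_map -cardE.
Qed.

End Realization.

(** * Discretizing a drawing *)

Section Sampling.
Context (R : realType).
Implicit Types (z : R * R) (t s r : R).

(** At the supremum [s] of the good parameters some good [t] lies within [r], so goodness spreads
    past [s] unless 1 is already within reach. *)
Lemma interval_induct (P : R -> Prop) : P 0 ->
  (forall s, 0 <= s <= 1 -> exists2 r, 0 < r & forall t t', 0 <= t <= 1 ->
    0 <= t' <= 1 -> `|s - t| < r -> `|s - t'| < r -> P t -> P t') -> P 1.
Proof.
move=> P0 Ps; pose S : set R := [set t | 0 <= t <= 1 /\ P t].
have S0 : S 0 by split; rewrite ?lexx ?ler01.
have ub : ubound S 1 by move=> t [/andP[]].
have hs : has_sup S by split; [exists 0|exists 1].
pose s := sup S; have s1 : s <= 1 by apply: ge_sup => //; exists 0.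
have s0 : 0 <= s by apply: (sup_upper_bound hs).
have s01 : 0 <= s <= 1 by rewrite s0.
have [r r0 H] := Ps s s01.
have [t [t01 Pt] ts] := sup_adherent r0 hs.
have tls : t <= s by apply: (sup_upper_bound hs).
have d1 : `|s - t| < r by rewrite ger0_norm ?subr_ge0 //; rewrite -/s in ts; lra.
have [s1r|s1r] := ltP (1 - s) r.
  apply: (H t 1 t01 _ d1 _ Pt); first by rewrite ler01 lexx.
  by rewrite ler0_norm ?subr_le0 // opprB.
have t'01 : 0 <= s + r / 2 <= 1 by apply/andP; split; lra.
have Pt' : P (s + r / 2).
  apply: (H t (s + r / 2) t01 t'01 d1 _ Pt).
  rewrite opprD addNKr normrN ger0_norm; lra.
have : s + r / 2 <= s by apply: (sup_upper_bound hs).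
by move=> h; exfalso; lra.
Qed.

Definition cellof (d : R) z : cell := (Num.floor (z.1 / d), Num.floor (z.2 / d)).

(** The allowance is [2 * d], not [d], because of the intermediate cells inserted in [sampling]. *)
Definition closeto (d : R) (p : cell) z : Prop :=
  `|p.1%:~R * d - z.1| <= 2 * d /\ `|p.2%:~R * d - z.2| <= 2 * d.

Lemma floor_bounds (d x : R) : 0 < d ->
  (Num.floor (x / d))%:~R * d <= x < ((Num.floor (x / d))%:~R + 1) * d.
Proof.
move=> d0; rewrite -ler_pdivlMr // floor_le /=.
by rewrite -ltr_pdivrMr // -[1]/(1%:~R) -intrD floorD1_gt.
Qed.

Lemma floor_close (d x y : R) : 0 < d -> `|x - y| < d ->
  let m := Num.floor (x / d) in let n := Num.floor (y / d) in
  [\/ n = m, n = m + 1 | n = m - 1].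
Proof.
move=> d0; rewrite ltr_norml => /andP[xy1 xy2] m n.
have /andP[m1 m2] := floor_bounds x d0; have /andP[n1 n2] := floor_bounds y d0.
have h1 : n%:~R < (m + 2)%:~R :> R.
  by rewrite intrD -(ltr_pM2r d0) mulrDl; move: m2; rewrite mulrDl mul1r -/m -/n in m1 n1 n2 *; lra.
have h2 : m%:~R < (n + 2)%:~R :> R.
  by rewrite intrD -(ltr_pM2r d0) mulrDl; move: n2; rewrite mulrDl mul1r -/m -/n in m1 m2 n1 *; lra.
move: h1 h2; rewrite !ltr_int; clear => h1 h2.
have [|nm] := eqVneq n m; first by constructor 1.
have [|nm'] := eqVneq n (m + 1); first by constructor 2.
by constructor 3; lia.
Qed.

Lemma sampling (g : R -> R * R) (d : R) : continuous g -> 0 < d ->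
  exists w, [/\ path adj (cellof d (g 0)) w,
    last (cellof d (g 0)) w = cellof d (g 1) &
    forall p, p \in cellof d (g 0) :: w -> exists2 t, 0 <= t <= 1 & closeto d p (g t)].
Proof.
move=> cg d0; pose C t := cellof d (g t).
pose P t := exists w, [/\ path adj (C 0) w, last (C 0) w = C t &
    forall p, p \in C 0 :: w -> exists2 t, 0 <= t <= 1 & closeto d p (g t)].
have bnd x : `|(Num.floor (x / d))%:~R * d - x| <= d.
  have /andP[h1 h2] := floor_bounds x d0; rewrite mulrDl mul1r in h2.
  by rewrite ler_norml; apply/andP; split; lra.
have close0 t : closeto d (C t) (g t).
  by split; apply: le_trans (bnd _) _; lra.
change (P 1); apply: interval_induct.
  exists [::]; split=> // p; rewrite inE => /eqP ->; exists 0; last exact: close0.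
  by rewrite lexx ler01.
move=> s s01.
have c1 : (g t).1 @[t --> s] --> (g s).1 by exact: (continuous_fst cg).
have c2 : (g t).2 @[t --> s] --> (g s).2 by exact: (continuous_snd cg).
have d2 : 0 < d / 2 by lra.
have n1 : \forall t \near s, `|(g s).1 - (g t).1| < d / 2.
  by move/cvgr_dist_lt: c1; apply.
have n2 : \forall t \near s, `|(g s).2 - (g t).2| < d / 2.
  by move/cvgr_dist_lt: c2; apply.
have /nbhs_ballP[r1 r10 H1] := n1; have /nbhs_ballP[r2 r20 H2] := n2.
exists (Num.min r1 r2); first by rewrite lt_min; apply/andP; split; [exact: r10|exact: r20].
move=> t t' t01 t'01; rewrite !lt_min => /andP[a1 a2] /andP[b1 b2] [w [pw lw iw]].
have tri (x y z : R) : `|x - y| < d / 2 -> `|x - z| < d / 2 -> `|y - z| < d.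
  rewrite !ltr_norml => /andP[h1 h2] /andP[h3 h4]; apply/andP; split; lra.
have k1 : `|(g t).1 - (g t').1| < d by apply: tri (H1 t a1) (H1 t' b1).
have k2 : `|(g t).2 - (g t').2| < d by apply: tri (H2 t a2) (H2 t' b2).
(* With one coordinate from each of the two cells, [mid] splits a diagonal move into two steps; its
   distance from [g t] is at most [d + d] in the changed coordinate. *)
pose mid : cell := ((C t').1, (C t).2).
have cmid : closeto d mid (g t).
  split; last by apply: le_trans (bnd _) _; lra.
  have := bnd (g t').1; move: k1; rewrite /mid /C /cellof /= ltr_norml !ler_norml.
  by move=> /andP[h1 h2] /andP[h3 h4]; apply/andP; split; lra.
have adj1 : touch (C t) mid.
  rewrite /touch /mid; have [e|e|e] := floor_close d0 k1.
  - by apply/predU1P; left; rewrite [LHS]surjective_pairing; congr (_, _); exact: esym e.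
  - by rewrite [(C t').1]e /adj /= !eqxx !orbT.
  - by rewrite [(C t').1]e /adj /= subrK !eqxx !orbT.
have adj2 : touch mid (C t').
  rewrite /touch /mid; have [e|e|e] := floor_close d0 k2.
  - by apply/predU1P; left; rewrite [RHS]surjective_pairing; congr (_, _); exact: esym e.
  - by rewrite /adj /= e !eqxx !orbT.
  - by rewrite /adj /= e subrK !eqxx !orbT.
have ext p (x : R) v : 0 <= x <= 1 -> closeto d p (g x) ->
    path adj (C 0) v -> touch (last (C 0) v) p ->
    (forall p, p \in C 0 :: v -> exists2 t, 0 <= t <= 1 & closeto d p (g t)) ->
    exists v', [/\ path adj (C 0) v', last (C 0) v' = p &
     forall p, p \in C 0 :: v' -> exists2 t, 0 <= t <= 1 & closeto d p (g t)].
  move=> x01 px pv /predU1P[e|a] iv; first by exists v.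
  exists (rcons v p); rewrite rcons_path pv last_rcons; split=> // y.
  rewrite -rcons_cons mem_rcons in_cons => /predU1P[->|/iv //].
  by exists x.
have [v [pv lv iv]] : exists v', [/\ path adj (C 0) v', last (C 0) v' = mid &
     forall p, p \in C 0 :: v' -> exists2 t, 0 <= t <= 1 & closeto d p (g t)].
  by apply: (ext mid t w) => //; rewrite lw.
by apply: (ext (C t') t' v) => //; rewrite lv.
Qed.

End Sampling.

Lemma first_hit (T : eqType) (e : rel T) (P : pred T) (x : T) (s : seq T) : path e x s ->
  ~~ P x -> P (last x s) -> exists s' y, [/\ path e x (rcons s' y), P y,
    all (predC P) (x :: s') & {subset rcons s' y <= s}].
Proof.
elim: s x => [|z s IH] x /= ps nP Pl; first by rewrite Pl in nP.
case/andP: ps => xz ps; have [Pz|nz] := boolP (P z).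
  by exists [::], z; rewrite /= xz Pz nP; split=> // y; rewrite !inE => ->.
have [s' [y [p1 p2 p3 p4]]] := IH z ps nz Pl.
exists (z :: s'), y; split=> //=; first by rewrite xz.
  by rewrite nP.
move=> u; rewrite in_cons => /predU1P[->|/p4 h]; rewrite in_cons ?eqxx //.
by rewrite h orbT.
Qed.

(** Stop at the first cell in [B], then go back to the last cell in [A] before it. As [A] and [B]
    are not adjacent, some cell remains between. *)
Lemma truncate (A B : pred cell) (x : cell) (s : seq cell) : path adj x s -> A x -> B (last x s) ->
  (forall p, A p -> B p -> false) -> (forall p p', A p -> B p' -> adj p p' -> false) ->
  exists a (w : seq cell) b, [/\ A a, B b, linked w,
    adj a (head (0, 0) w) && adj (last (0, 0) w) b &
    forall p, p \in w -> [/\ p \in x :: s, ~~ A p & ~~ B p]].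
Proof.
move=> ps Ax Bl AB AnB; have nB : ~~ B x by apply/negP => /(AB x Ax).
have [s1 [b [p1 Bb nB1 i1]]] := first_hit ps nB Bl.
have p2 : path adj b (rev (x :: s1)).
  rewrite -[b](last_rcons x s1 b) -(belast_rcons x s1 b) rev_path.
  by rewrite (eq_path (e' := adj)) // => u v; rewrite adjC.
have nA : ~~ A b by apply/negP => Ab; move: (AB b Ab Bb).
have Al : A (last b (rev (x :: s1))) by rewrite rev_cons last_rcons.
have [s3 [a [p3 Aa nA3 i3]]] := first_hit p2 nA Al.
case: s3 p3 nA3 i3 => [|c s3] p3 nA3 i3.
  by move: p3; rewrite /= andbT adjC => /(AnB a b Aa Bb).
move: p3; rewrite /= => /andP[bc p3].
move: p3; rewrite rcons_path => /andP[p3 la].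
have [s4 [p4 l4 i4]] := path_revsym adjC p3.
exists a, (last c s3 :: s4), b; split=> //.
  by rewrite /= l4 (adjC a) la adjC bc.
move=> p /i4 pc.
have nAp : ~~ A p by move/allP: nA3; apply; rewrite in_cons pc orbT.
have pin : p \in x :: s1.
  by rewrite -mem_rev; apply: i3; rewrite mem_rcons in_cons pc orbT.
have nBp : ~~ B p by move/allP: nB1; apply.
split=> //; move: pin; rewrite !in_cons => /predU1P[->|ps1]; first by rewrite eqxx.
by rewrite i1 ?orbT // mem_rcons in_cons ps1 orbT.
Qed.

(** * Separation constants and the mesh of the grid *)

Section Discretize.
Context (R : realType).

Definition ld (a b : R * R) : R := `|a.1 - b.1| + `|a.2 - b.2|.

Lemma ld_ge0 a b : 0 <= ld a b. Proof. by rewrite addr_ge0. Qed.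

Lemma ld_eq0 a b : ld a b = 0 -> a = b.
Proof.
case: a b => x y [u v]; rewrite /ld /= => /eqP.
by rewrite paddr_eq0 // !normr_eq0 !subr_eq0 => /andP[/eqP -> /eqP ->].
Qed.

Lemma ldxx a : ld a a = 0. Proof. by rewrite /ld !subrr normr0 addr0. Qed.

Lemma ld_continuous (T : topologicalType) (f g : T -> R * R) :
  continuous f -> continuous g -> continuous (fun t => ld (f t) (g t)).
Proof.
move=> cf cg t; apply: cvgD; apply: cvg_norm; apply: cvgB.
- exact: (continuous_fst cf).
- exact: (continuous_fst cg).
- exact: (continuous_snd cf).
- exact: (continuous_snd cg).
Qed.

(** Edges are continuous on the unit interval only; composing with this retraction extends them to
    the line with the same image. *)
Definition clamp (t : R) : R := Num.min (Num.max t 0) 1.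

Lemma clamp_in t : 0 <= clamp t <= 1.
Proof. by rewrite /clamp le_min le_max lexx orbT ler01 ge_min lexx orbT. Qed.

Lemma clampE t : 0 <= t <= 1 -> clamp t = t.
Proof.
by move=> /andP[t0 t1]; rewrite /clamp max_l // min_l.
Qed.

Lemma clamp_continuous : continuous clamp.
Proof.
apply: min_fun_continuous; last by move=> t; exact: cvg_cst.
by apply: max_fun_continuous; [move=> t; exact: cvg_id|move=> t; exact: cvg_cst].
Qed.

Lemma within_clamp (f : R -> R * R) : {within `[0, 1], continuous f} ->
  continuous (f \o clamp).
Proof.
move=> /subspace_continuousP cf t.
have it : (`[0, 1]%classic : set R) (clamp t) by rewrite /= in_itv /= clamp_in.
have C : clamp x @[x --> t] --> clamp t by exact: clamp_continuous.
have C' : clamp x @[x --> t] --> within `[0, 1] (nbhs (clamp t)).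
  move=> U HU; have HU' : \forall x \near t, `[0, 1]%classic (clamp x) -> U (clamp x).
    exact: (C _ HU).
  suff : \forall x \near t, U (clamp x) by [].
  near=> x; apply: (near HU' x) => //=.
  by rewrite in_itv /= clamp_in.
exact: cvg_comp C' (cf _ it).
Unshelve. all: by end_near.
Qed.

Lemma fin_eps (T : finType) (Q : T -> R -> Prop) :
  (forall x, exists2 e, 0 < e & forall e', 0 < e' -> e' <= e -> Q x e') ->
  exists2 e, 0 < e & forall e', 0 < e' -> e' <= e -> forall x, Q x e'.
Proof.
move=> H; suff [e e0 He] : exists2 e, 0 < e & forall e', 0 < e' -> e' <= e ->
    forall x, x \in enum T -> Q x e'.
  by exists e => // e' h1 h2 x; apply: He; rewrite ?mem_enum.
elim: (enum T) => [|x s [e e0 IH]]; first by exists 1.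
have [e2 e20 H2] := H x; exists (Num.min e e2); first by rewrite lt_min e0.
move=> e' e'0; rewrite le_min => /andP[h1 h2] y; rewrite inE => /predU1P[->|ys].
  exact: H2.
exact: IH ys.
Qed.

Context (V : finType) (E : {set {set V}}) (D : drawing R V).
Hypothesis simpleE : simple_graph E.
Hypothesis isD : is_drawing E D.

Let P (v : V) : R * R := pos D v.
Let gam (e : {set V}) : R -> R * R := curve D e \o clamp.

Let gam_cont e : e \in E -> continuous (gam e).
Proof. by move=> eE; apply: within_clamp; exact: (curve_continuous isD). Qed.

Let gam_arc e t : edge_arc D e (gam e t).
Proof. by exists (clamp t) => //; rewrite /= in_itv /= clamp_in. Qed.

Lemma gam_ends e : e \in E -> exists v w,
  [/\ v != w, e = [set v; w]%SET, gam e 0 = P v & gam e 1 = P w].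
Proof.
move=> eE; have h := curve_ends isD eE.
have z01 : 0 <= (0 : R) <= 1 by rewrite lexx ler01.
have o01 : 0 <= (1 : R) <= 1 by rewrite ler01 lexx.
have : (pos D @` [set` e]) (curve D e 0) by rewrite -h; left.
move=> [v ve pv]; have : (pos D @` [set` e]) (curve D e 1) by rewrite -h; right.
move=> [w we pw]; exists v, w.
have vw : v != w.
  apply/negP => /eqP vw; move: pw; rewrite -vw pv => /(curve_simple isD eE).
  by rewrite !in_itv /= => /(_ z01 o01) /eqP; rewrite eq_sym oner_eq0.
split=> //; rewrite /gam /= ?clampE //; apply/esym/eqP.
rewrite eqEcard cards2 vw simpleE // andbT; apply/fintype.subsetP => x.
by rewrite !inE => /orP[]/eqP ->.
Qed.

Lemma arc_min (T : topologicalType) (A : set T) (F : T -> R) : compact A -> A !=set0 ->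
  continuous F -> (forall x, A x -> 0 < F x) -> exists2 m, 0 < m & forall x, A x -> m <= F x.
Proof.
move=> cA A0 cF F0; have [|c cc cm] := compact_EVT_min A0 cA (f := F).
  exact: continuous_subspaceT.
exists (F c); first by apply: F0; rewrite inE in cc.
by move=> x Ax; apply: cm; rewrite inE.
Qed.

Let I01 : set R := `[0, 1]%classic.
Let I01_compact : compact I01. Proof. exact: segment_compact. Qed.
Let I01_0 : I01 0. Proof. by rewrite /I01 /= in_itv /= lexx ler01. Qed.

Lemma sep_vertices : exists2 h, 0 < h & forall h', 0 < h' -> h' <= h ->
  forall uv : V * V, uv.1 != uv.2 -> 8 * h' <= ld (P uv.1) (P uv.2).
Proof.
apply: (fin_eps (Q := fun uv h' => uv.1 != uv.2 -> 8 * h' <= ld (P uv.1) (P uv.2))).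
move=> [u v] /=; have [_|uv] := eqVneq u v; first by exists 1.
have l0 : 0 < ld (P u) (P v).
  rewrite lt_neqAle ld_ge0 andbT eq_sym; apply/eqP => /ld_eq0/(pos_inj isD) e.
  by rewrite e eqxx in uv.
by exists (ld (P u) (P v) / 8) => [|e' e0 e1 _]; lra.
Qed.

Lemma sep_edges : exists2 h, 0 < h & forall h', 0 < h' -> h' <= h ->
  forall eu : {set V} * V, eu.1 \in E -> eu.2 \notin eu.1 -> forall t,
    8 * h' <= ld (P eu.2) (gam eu.1 t).
Proof.
apply: (fin_eps (Q := fun eu h' => eu.1 \in E -> eu.2 \notin eu.1 -> forall t,
    8 * h' <= ld (P eu.2) (gam eu.1 t))).
move=> [e u] /=; have [eE|_] := boolP (e \in E); last by exists 1.
have [_|ue] := boolP (u \in e); first by exists 1.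
have cF : continuous (fun t => ld (P u) (gam e t)).
  by apply: ld_continuous; [move=> t; exact: cvg_cst|exact: gam_cont].
have [|t _|m m0 hm] := arc_min I01_compact _ cF; first by exists 0.
  rewrite lt_neqAle ld_ge0 andbT eq_sym; apply/eqP => /ld_eq0 h.
  by apply: (curve_avoids isD eE ue); rewrite -/(P u) h; exact: gam_arc.
exists (m / 8) => [|h' h0 h1 _ _ t]; first by lra.
have -> : gam e t = gam e (clamp t) by rewrite /gam /= (clampE (clamp_in t)).
have := hm (clamp t); rewrite /I01 /= in_itv /= clamp_in => /(_ isT); lra.
Qed.

Lemma sep_curves (h : R) : 0 < h -> exists2 d, 0 < d & forall d', 0 < d' -> d' <= d ->
  forall ef : {set V} * {set V}, ef.1 \in E -> ef.2 \in E -> ef.1 != ef.2 ->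
   [set ef.1; ef.2]%SET \notin crossing_pairs E D -> forall t s,
   (forall v, h <= ld (gam ef.1 t) (P v)) -> 10 * d' < ld (gam ef.1 t) (gam ef.2 s).
Proof.
move=> h0; apply: (fin_eps (Q := fun ef d' =>
   ef.1 \in E -> ef.2 \in E -> ef.1 != ef.2 ->
   [set ef.1; ef.2]%SET \notin crossing_pairs E D -> forall t s,
   (forall v, h <= ld (gam ef.1 t) (P v)) -> 10 * d' < ld (gam ef.1 t) (gam ef.2 s))).
move=> [e f] /=; have [eE|_] := boolP (e \in E); last by exists 1.
have [fE|_] := boolP (f \in E); last by exists 1.
have [_|ef] := eqVneq e f; first by exists 1.
have [_|nc] := boolP ([set e; f]%SET \in _); first by exists 1.
(* Edges that do not cross may still share an end. The penalty makes [F] positive there and vanishes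
   at points of distance at least [h] from all vertices, so the positive minimum of [F] over a
   compact square bounds the distance of the curves at such points. *)
pose F (ts : R * R) : R := ld (gam e ts.1) (gam f ts.2) +
  \sum_(v : V) Num.max (h - ld (gam e ts.1) (P v)) 0.
have c1 : continuous (fun ts : R * R => gam e ts.1).
  by move=> ts; apply: continuous_comp; [exact: cvg_fst|exact: gam_cont].
have c2 : continuous (fun ts : R * R => gam f ts.2).
  by move=> ts; apply: continuous_comp; [exact: cvg_snd|exact: gam_cont].
have cF : continuous F.
  move=> ts; apply: cvgD; first exact: (ld_continuous c1 c2).
  apply: cvg_big => [|v _]; first exact: add_continuous.
  have : continuous ((fun ts : R * R => h - ld (gam e ts.1) (P v)) \max (fun=> 0)).
    apply: max_fun_continuous; last by move=> x; exact: cvg_cst.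
    move=> x; apply: cvgB; first exact: cvg_cst.
    by apply: (ld_continuous c1); move=> y; exact: cvg_cst.
  by apply.
have s0 ts (v : V) : 0 <= Num.max (h - ld (gam e ts) (P v)) 0 by rewrite le_max lexx orbT.
have arcE g t : g \in E -> (exists v, gam g t = P v) \/ edge_interior D g (gam g t).
  move=> gE; have [v [w [_ _ g0 g1]]] := gam_ends gE.
  have /andP[t0 t1] := clamp_in t; have gt : gam g t = gam g (clamp t).
    by rewrite /gam /= (clampE (clamp_in t)).
  have [tz|tn0] := eqVneq (clamp t) 0; first by left; exists v; rewrite gt tz.
  have [tz|tn1] := eqVneq (clamp t) 1; first by left; exists w; rewrite gt tz.
  right; exists (clamp t) => //; rewrite /= in_itv /=.
  by rewrite !lt_neqAle t0 t1 tn1 eq_sym tn0.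
have F0 ts : 0 < F ts.
  case: ts => t s; rewrite /F /=.
  have S0 : 0 <= \sum_(v : V) Num.max (h - ld (gam e t) (P v)) 0.
    by apply: sumr_ge0 => v _; exact: s0.
  have [l0|ln0] := eqVneq (ld (gam e t) (gam f s)) 0; last first.
    by rewrite ltr_pwDl // lt_neqAle ld_ge0 eq_sym ln0.
  have ee := ld_eq0 l0; rewrite l0 add0r.
  have [v ev] : exists v, gam e t = P v.
    have [//|ie] := arcE e t eE; have [[v fv]|jf] := arcE f s fE.
      by exists v; rewrite ee.
    exfalso; move/negP: nc; apply; rewrite inE; apply/asboolP; exists e, f; split=> //.
    by exists (gam e t); split=> //; rewrite ee.
  rewrite (bigD1 v) //= ltr_pwDl //.
    by rewrite ev ldxx subr0 lt_max h0.
  by apply: sumr_ge0 => u _; exact: s0.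
have [||m m0 hm] := arc_min (compact_setX I01_compact I01_compact) _ cF.
- by exists (0, 0); split.
- by move=> x _; exact: F0.
exists (m / 20) => [|d' d0 d1 _ _ _ _ t s far]; first by lra.
have -> : gam e t = gam e (clamp t) by rewrite /gam /= (clampE (clamp_in t)).
have -> : gam f s = gam f (clamp s) by rewrite /gam /= (clampE (clamp_in s)).
have := hm (clamp t, clamp s) _; rewrite /F /= big1 ?addr0.
  move=> H; have := H; rewrite /I01 /= !in_itv /= !clamp_in.
  by move=> /(_ (conj isT isT)) => k; lra.
move=> v _; apply/max_idPr; rewrite subr_le0.
by have := far v; rewrite {1}/gam /= -{1}(clampE (clamp_in t)).
Qed.

Lemma touch_near (p p' : cell) (d : R) : 0 < d -> touch p p' ->
  `|p.1%:~R * d - p'.1%:~R * d| <= d /\ `|p.2%:~R * d - p'.2%:~R * d| <= d.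
Proof.
move=> d0 t.
have [h1 h2] : [/\ - 1 <= p.1 - p'.1 & p.1 - p'.1 <= 1] /\
    [/\ - 1 <= p.2 - p'.2 & p.2 - p'.2 <= 1].
  case/predU1P: t => [->|]; first by rewrite !subrr.
  by case: p => a b /adjP /= [] -> /=; split; split; lia.
have H (a b : int) : -1 <= a - b -> a - b <= 1 -> `|a%:~R * d - b%:~R * d| <= d.
  move=> k1 k2; have k : `|(a - b)%:~R| <= 1 :> R.
    by rewrite ler_norml -[1]/(1%:~R) -intrN !ler_int k1.
  by rewrite -mulrBl -intrB normrM (gtr0_norm d0) ler_piMl //; exact: ltW.
by case: h1 => ? ?; case: h2 => ? ?; split; exact: H.
Qed.

Lemma abs_bounds (x y c : R) : `|x - y| <= c -> y - c <= x <= y + c.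
Proof. by rewrite ler_norml => /andP[h1 h2]; apply/andP; split; lra. Qed.

(** A block of side [2 * N] replaces each vertex, as edges with a common end get arbitrarily close
    there. Outside the blocks, strings touch only if their edges cross. *)
Lemma discretize : exists (bl : V -> cell) (L : nat) (W : {set V} -> seq cell)
    (x0 xn : {set V} -> cell),
  [/\ (0 < L)%N,
   forall u v p, inreg (bl u, L) p -> inreg (bl v, L) p -> u = v,
   forall e, e \in E -> [/\ linked (W e), adj (x0 e) (head (0, 0) (W e)) &
      adj (last (0, 0) (W e)) (xn e)],
   forall e v p, e \in E -> p \in W e -> ~~ inreg (bl v, L) p &
   (forall e, e \in E -> exists v w, [/\ v != w, e = [set v; w]%SET,
      inreg (bl v, L) (x0 e) & inreg (bl w, L) (xn e)]) /\
   (forall e f p p', e \in E -> f \in E -> e != f -> p \in W e -> p' \in W f ->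
      touch p p' -> [set e; f]%SET \in crossing_pairs E D)].
Proof.
have [h1 h10 sv] := sep_vertices; have [h2 h20 se] := sep_edges.
pose h := Num.min h1 h2; have h0 : 0 < h by rewrite lt_min h10.
have {}sv : forall u v, u != v -> 8 * h <= ld (P u) (P v).
  by move=> u v uv; apply: (sv h h0 _ (u, v)) => //; rewrite ge_min lexx.
have {}se : forall e u t, e \in E -> u \notin e -> 8 * h <= ld (P u) (gam e t).
  by move=> e u t eE ue; apply: (se h h0 _ (e, u)) => //; rewrite ge_min lexx orbT.
have hh0 : 0 < h / 2 by lra.
have [d0 d00 sc] := sep_curves hh0.
(* With at least 6 cells to the length [h] one has [3 * d <= h / 2], so a cell sampled within
   [h / 2] of a vertex belongs to its block. *)
have [N N6 Nd] : exists2 N : nat, (6 <= N)%N & h / N%:R <= d0.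
  pose M := Num.bound (h / d0); exists (6 + M)%N; first exact: leq_addr.
  have MB : h / d0 < M%:R by apply: archi_boundP; rewrite divr_ge0 // ltW.
  have N0 : 0 < (6 + M)%N%:R :> R by rewrite ltr0n.
  rewrite ler_pdivrMr // -ler_pdivrMl // mulrC; apply: le_trans (ltW MB) _.
  by rewrite ler_nat leq_addl.
pose d := h / N%:R.
have N0 : 0 < N%:R :> R by rewrite ltr0n; lia.
have d_gt0 : 0 < d by rewrite divr_gt0.
have hE : h = N%:R * d by rewrite /d mulrC divfK // gt_eqF.
have {}sc : forall e f t s, e \in E -> f \in E -> e != f ->
   [set e; f]%SET \notin crossing_pairs E D ->
   (forall v, h / 2 <= ld (gam e t) (P v)) -> 10 * d < ld (gam e t) (gam f s).
  by move=> e f t s *; apply: (sc d d_gt0 Nd (e, f)).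
have N6' : 6 <= N%:R :> R by rewrite (ler_nat R 6 N).
pose fl v := cellof d (P v).
pose bl v : cell := ((fl v).1 - N%:Z, (fl v).2 - N%:Z); pose L := (2 * N)%N.
have flb v : [/\ (fl v).1%:~R * d <= (P v).1, (P v).1 < ((fl v).1%:~R + 1) * d,
    (fl v).2%:~R * d <= (P v).2 & (P v).2 < ((fl v).2%:~R + 1) * d].
  have /andP[k1 k2] := floor_bounds (P v).1 d_gt0.
  by have /andP[k3 k4] := floor_bounds (P v).2 d_gt0.
have L0 : (0 < L)%N by rewrite /L; lia.
have inregP v (p : cell) : inreg (bl v, L) p =
    ((fl v).1 - N%:Z <= p.1 < (fl v).1 + N%:Z) && ((fl v).2 - N%:Z <= p.2 < (fl v).2 + N%:Z).
  rewrite /inreg /bl /L /=; have e (a : int) : a - N%:Z + (2 * N)%N%:Z = a + N%:Z by lia.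
  by rewrite !e.
have blk_near v (p : cell) : inreg (bl v, L) p ->
    `|p.1%:~R * d - (P v).1| <= h + d /\ `|p.2%:~R * d - (P v).2| <= h + d.
  rewrite inregP => /andP[/andP[a1 a2] /andP[b1 b2]]; have [k1 k2 k3 k4] := flb v.
  have K (x m : int) (z : R) : m%:~R * d <= z -> z < (m%:~R + 1) * d ->
      m - N%:Z <= x -> x < m + N%:Z -> `|x%:~R * d - z| <= h + d.
    move=> l1 l2; rewrite -(ler_int R) -(ltr_int R) intrB intrD -!pmulrn => l3 l4.
    have g1 : (m%:~R - N%:R) * d <= x%:~R * d by rewrite ler_wpM2r // ltW.
    have g2 : x%:~R * d <= (m%:~R + N%:R) * d by rewrite ler_wpM2r // ltW.
    by rewrite hE ler_norml; apply/andP; split; lra.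
  by split; [exact: K k1 k2 a1 a2|exact: K k3 k4 b1 b2].
have near_blk v (p : cell) (z : R * R) : closeto d p z -> ld z (P v) < h / 2 ->
    inreg (bl v, L) p.
  move=> [c1 c2] lz; rewrite inregP; have [k1 k2 k3 k4] := flb v.
  have K (x m : int) (z1 z2 : R) : m%:~R * d <= z2 -> z2 < (m%:~R + 1) * d ->
      `|x%:~R * d - z1| <= 2 * d -> `|z1 - z2| < h / 2 ->
      (m - N%:Z <= x) && (x < m + N%:Z).
    move=> l1 l2 /abs_bounds/andP[l3 l4]; rewrite ltr_norml => /andP[l5 l6].
    have N3 : 3 * d <= N%:R / 2 * d by apply: ler_wpM2r; [exact: ltW|lra].
    rewrite -(ler_int R) -(ltr_int R) intrB intrD -!pmulrn.
    rewrite -(ler_pM2r d_gt0) -(ltr_pM2r d_gt0) mulrBl mulrDl -hE.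
    have e : N%:R / 2 * d = h / 2 by rewrite hE; ring.
    by apply/andP; split; lra.
  have [n1 n2] : `|z.1 - (P v).1| < h / 2 /\ `|z.2 - (P v).2| < h / 2.
    have g1 := normr_ge0 (z.1 - (P v).1); have g2 := normr_ge0 (z.2 - (P v).2).
    by move: lz; rewrite /ld => lz; split; lra.
  by rewrite (K _ _ _ _ k1 k2 c1 n1) (K _ _ _ _ k3 k4 c2 n2).
(* Vertices of touching blocks are within 4 h + 6 d of each other, and an edge sampled in a block is
   within 2 h + 6 d of its vertex; both are below [8 * h]. *)
have d8 : 8 * h > 4 * h + 12 * d.
  have : 6 * d <= N%:R * d by rewrite ler_wpM2r // ltW.
  by rewrite -hE; lra.
have tri (x y z : R) a b : `|x - y| <= a -> `|x - z| <= b -> `|y - z| <= a + b.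
  move=> /abs_bounds/andP[? ?] /abs_bounds/andP[? ?].
  by rewrite ler_norml; apply/andP; split; lra.
have blk_touch u v p p' : inreg (bl u, L) p -> inreg (bl v, L) p' -> touch p p' -> u = v.
  move=> pu pv t; apply/eqP; apply: contraT => uv.
  have [a1 a2] := blk_near u p pu; have [b1 b2] := blk_near v p' pv.
  have [t1 t2] := touch_near d_gt0 t.
  have := sv u v uv; rewrite /ld.
  have e1 := tri _ _ _ _ _ (tri _ _ _ _ _ t1 a1) b1.
  have e2 := tri _ _ _ _ _ (tri _ _ _ _ _ t2 a2) b2.
  by lra.
have ctr_in v : inreg (bl v, L) (fl v).
  by rewrite inregP; move: N6; clear; case: (fl v) => a b /=; lia.
have walks e : exists t : seq cell * (cell * cell), e \in E ->
   [/\ linked t.1, adj t.2.1 (head (0, 0) t.1), adj (last (0, 0) t.1) t.2.2,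
     exists v w, [/\ v != w, e = [set v; w]%SET, inreg (bl v, L) t.2.1 &
       inreg (bl w, L) t.2.2] &
     (forall v p, p \in t.1 -> ~~ inreg (bl v, L) p) /\
     forall p, p \in t.1 -> exists s, closeto d p (gam e s)].
  have [eE|_] := boolP (e \in E); last by exists ([::], ((0, 0), (0, 0))).
  have [v [w [vw ee g0 g1]]] := gam_ends eE.
  have [s [ps ls si]] := sampling (gam_cont eE) d_gt0.
  rewrite g0 g1 in ps ls si.
  have bw : inreg (bl w, L) (last (cellof d (P v)) s) by rewrite ls; exact: ctr_in.
  have [||a [t [b [ab bb lt /andP[at' tb] tin]]]] :=
    @truncate (inreg (bl v, L)) (inreg (bl w, L)) _ _ ps (ctr_in v) bw.
  - move=> p p1 p2; move: vw; rewrite (blk_touch v w p p p1 p2) ?eqxx //.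
    by rewrite /touch eqxx.
  - move=> p p' p1 p2 pp; move: vw; rewrite (blk_touch v w p p' p1 p2) ?eqxx //.
    by rewrite /touch pp orbT.
  exists (t, (a, b)) => _; split=> //=; first by exists v, w.
  split; last by move=> p /tin[/si[x _ px] _ _]; exists x.
  move=> u p pt; have [/si[x _ [c1 c2]] nv nw] := tin p pt.
  have [->//|uv] := eqVneq u v; have [->//|uw] := eqVneq u w.
  apply/negP => /blk_near[b1 b2].
  have ue : u \notin e by rewrite ee !inE negb_or uv.
  have := se e u x eE ue; rewrite /ld.
  have e1 := tri _ _ _ _ _ b1 c1; have e2 := tri _ _ _ _ _ b2 c2.
  by move=> q; lra.
have [T TP] := choice walks.
exists bl, L, (fun e => (T e).1), (fun e => (T e).2.1), (fun e => (T e).2.2).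
split=> //.
- by move=> u v p p1 p2; apply: (blk_touch u v p p) => //; rewrite /touch eqxx.
- by move=> e eE; have [] := TP e eE.
- by move=> e v p eE; have [_ _ _ _ [H _]] := TP e eE; exact: H.
split; first by move=> e eE; have [] := TP e eE.
move=> e f p p' eE fE ef pe pf t; apply: contraT => nc.
have [_ _ _ _ [oe ne]] := TP e eE; have [_ _ _ _ [of' nf]] := TP f fE.
have [x cx] := ne p pe; have [y cy] := nf p' pf.
have far v : h / 2 <= ld (gam e x) (P v).
  by rewrite leNgt; apply/negP => lt; move: (oe v p pe); rewrite (near_blk v p _ cx lt).
(* Each coordinate differs by at most d + 2 d + 2 d, so the distance is at most 10 d. *)
have := sc e f x y eE fE ef nc far; rewrite /ld.
have [t1 t2] := touch_near d_gt0 t; move: cx cy => [c1 c2] [c3 c4].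
have e1 := tri _ _ _ _ _ (tri _ _ _ _ _ t1 c1) c3.
have e2 := tri _ _ _ _ _ (tri _ _ _ _ _ t2 c2) c4.
by move=> q; lra.
Qed.

End Discretize.

(** * The bound on the crossing number *)

Lemma redraw (R : realType) (V : finType) (E : {set {set V}}) (D : drawing R V) :
  simple_graph E -> is_drawing E D ->
  exists D' : drawing R V, is_drawing E D' /\
    (crossings E D')%:R <= 896 * #|crossing_pairs E D|%:R * Num.sqrt #|crossing_pairs E D|%:R :> R.
Proof.
move=> sE isD; set k := #|crossing_pairs E D|.
have [bl [L [W [x0 [xn [L0 bd HW Wout [Wends Wtc]]]]]]] := discretize sE isD.
have HC e f : e \in E -> f \in E -> e != f -> tc W e f ->
    [set e; f]%SET \in crossing_pairs E D.
  move=> eE fE ef /hasP[p pe /hasP[p' pf t]]; exact: (Wtc e f p p').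
have mB := mass_touching HC; set B := touching W E in mB.
have BW g : g \in B -> linked (W g) by rewrite inE => /andP[/HW[]].
have [lev hlev] := levels R BW.
have [q [q01 qinj qgen]] := generic_seq R.
have [st [gs sc so sl]] := routing (ppos_inj q01 qinj) lev HW.
have vs e (eE : e \in E) := gs.1 e eE.
pose hit e f := has (fun a => has (crosses (ppos q) a) (st f)) (st e).
pose X := [set P : {set {set V}} | [exists e in E, exists f in E,
   [&& e != f, P == [set e; f]%SET & hit e f]]]%SET.
have XB : (#|X| <= \sum_(e in B) #|lcomp W B lev e|)%N.
  apply: card_crossing => P.
  rewrite inE => /existsP[e /andP[eE /existsP[f /and4P[fE ef /eqP -> /hasP[a ae]]]]].
  case/hasP=> b bf /andP[/eqP ab _].
  have [g gl ag] := sl e a eE ae; have [g' gl' bg] := sl f b fE bf.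
  by exists e, f, g, g', a.1; split=> //; split=> //; rewrite ab.
have [||||||D' [isD' cD']] := @realization R q q01 qinj qgen V E bl L st L0 bd _ _ sc _ _ _ so X.
- by move=> e /vs/and4P[].
- by move=> e; exact: idxs_uniq gs.
- move=> e a v eE ae; have /and4P[_ _ _ /allP/(_ a ae)] := vs e eE.
  by case/existsP=> g /andP[gE]; exact: Wout.
- move=> e eE; have [v [w [vw ee iv iw]]] := Wends e eE.
  have /and4P[s0 _ re _] := vs e eE.
  case/orP: re => /andP[/andP[_ /eqP h1] /andP[_ /eqP h2]].
    by exists v, w; rewrite h1 h2.
  by exists w, v; rewrite h1 h2 eq_sym finset.setUC.
- by move=> e f i; exact: (idxs_disj gs).
- move=> e f a b eE fE ef ae bf ab; rewrite inE.
  apply/existsP; exists e; rewrite eE; apply/existsP; exists f; rewrite fE ef eqxx /=.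
  by apply/hasP; exists a => //; apply/hasP; exists b.
exists D'; split=> //.
apply: (@le_trans _ _ (\sum_(e in B) #|lcomp W B lev e|)%N%:R).
  by rewrite ler_nat; exact: leq_trans XB.
apply: le_trans hlev _.
have mR : (mass W B B)%:R <= 4 * k%:R :> R by rewrite -natrM ler_nat.
have sR : Num.sqrt (mass W B B)%:R <= 2 * Num.sqrt k%:R :> R.
  have -> : 2 = Num.sqrt (2 ^+ 2) :> R by rewrite sqrtr_sqr ger0_norm.
  rewrite -sqrtrM ?exprn_ge0 // ler_wsqrtr //.
  by apply: le_trans mR _; rewrite -natrX.
have -> : 896 * k%:R * Num.sqrt k%:R = 112 * (4 * k%:R) * (2 * Num.sqrt k%:R) :> R by ring.
by rewrite ler_pM ?mulr_ge0 ?sqrtr_ge0 ?ler_wpM2l.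
Qed.

Lemma nat_min_empty (A : set nat) : (forall n, ~ A n) -> nat_min A = 0%N.
Proof. by move=> A0; apply: xgetPN => n [/A0]. Qed.

Theorem theorem1 (R : realType) :
  exists2 c : R, 0 < c &
    forall (V : finType) (E : {set {set V}}), simple_graph E ->
      (cr R E)%:R <= c * (pcr R E)%:R `^ (3 / 2).
Proof.
exists 896; first by rewrite ltr0n.
move=> V E sE; rewrite /cr /pcr.
set A := [set n | _]; set A' := [set n | _].
have [[D0 isD0]|no] := pselect (exists D : drawing R V, is_drawing E D); last first.
  (* Without any drawing [cr] takes its default value 0, and the bound is trivial. *)
  rewrite nat_min_empty; last by move=> n [D isD _]; apply: no; exists D.
  by rewrite mulr_ge0 ?ler0n ?powR_ge0.
have AD : A' #|crossing_pairs E D0| by exists D0.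
have [[D isD ->] _] := nat_minP (ex_intro A' _ AD).
have [D' [isD' le]] := redraw sE isD.
have AD' : A (crossings E D') by exists D'.
have [_ /(_ _ AD') minA] := nat_minP (ex_intro A _ AD').
apply: (@le_trans _ _ (crossings E D')%:R); first by rewrite ler_nat.
apply: le_trans le _; rewrite -mulrA; apply: ler_wpM2l; first exact: ler0n.
set k : R := _%:R; have k0 : 0 <= k by exact: ler0n.
have -> : 3 / 2 = 1 + 2^-1 :> R by lra.
(* The side condition concerns base 0: the exponents 1 and 1/2 do not add up to 0. *)
rewrite powRD; last by apply/implyP => /eqP h; exfalso; lra.
by rewrite powRr1 // powR12_sqrt.
Qed.
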